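(* Let a Markov renewal process on $S=S_1\cup\dots\cup S_M$ satisfy conditions (a)–(f) below, suppose the limits $\tau_i=\lim_{\varepsilon\downarrow0}\tau^\varepsilon_i$ exist with $\tau_{i_0}=1$ for some $i_0$ and $0\le\tau_i\le1$ for all $i$, and suppose $\{1,\dots,M\}$ forms one ergodic class with respect to $P^0_{ij}$, with invariant probability measure $\lambda$. Let $\mu(i)=\lambda(i)\tau_i/\sum_{j=1}^M\lambda(j)\tau_j$. If $t(\varepsilon)\to\infty$ as $\varepsilon\downarrow0$, then $\lim_{\varepsilon\downarrow0}\mathbb P(X^{x,\varepsilon}_{t(\varepsilon)}\in S_i)=\mu(i)$ uniformly in $x\in S$.
   Context: $S$ is a metric space partitioned into disjoint Borel sets $S_1,\dots,S_M$; $Q^\varepsilon$ are Markov kernels from $S$ to $S\times[0,\infty)$; $(\mathbf X^{x,\varepsilon}_n,\mathbf T^{x,\varepsilon}_n)$ is the Markov chain started at $(x,0)$ with transitions $Q^\varepsilon(y,\cdot)$ from $(y,s)$; $X^{x,\varepsilon}_t=\mathbf X^{x,\varepsilon}_n$ for $\sum_{m\le n}\mathbf T^{x,\varepsilon}_m\le t<\sum_{m\le n+1}\mathbf T^{x,\varepsilon}_m$. $P^\varepsilon(x,B)=Q^\varepsilon(x,B\times[0,\infty))$; $T^\varepsilon(x,B)$ has law $Q^\varepsilon(x,B\times\cdot)/P^\varepsilon(x,B)$. (a) $P^\varepsilon(x,S_i)=0$ for $x\in S_i$; for $i\ne j$, $P^\varepsilon(x,S_j)$ is $0$ for all $x\in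 S_i,\varepsilon$ ($P^\varepsilon_{ij}:\equiv0$) or positive, with positive $P^\varepsilon_{ij}$, $P^\varepsilon(x,S_j)/P^\varepsilon_{ij}\to1$ uniformly in $x\in S_i$, $\sum_jP^\varepsilon_{ij}=1$, and every $i\ne j$ connected by a chain of indices with positive $P^\varepsilon$. (b) Positive $\tau^\varepsilon_i$ with $\mathbb ET^\varepsilon(x,S_j)/\tau^\varepsilon_i\to1$ uniformly in $x\in S_i$ when $P^\varepsilon_{ij}\not\equiv0$. (c) $\mathrm{Var}\,T^\varepsilon(x,S_j)\le C(\tau^\varepsilon_i)^2$ for $\varepsilon\le\varepsilon_0$. (d) For bounded continuous $f$: $\mathbb Ef(T^\varepsilon(x_1,S_{j_1})/\tau^\varepsilon_i)-\mathbb Ef(T^\varepsilon(x_2,S_{j_2})/\tau^\varepsilon_i)\to0$ uniformly in $x_1,x_2\in S_i$ when $P^\varepsilon_{ij_1},P^\varepsilon_{ij_2}\not\equiv0$. (e) If $x_n\in S_i$, $\varepsilon_n\downarrow0$ and $T^{\varepsilon_n}(x_n,S_j)/\tau^{\varepsilon_n}_i\to\xi$ in distribution, then $\xi$ has no atoms. (f) $\lim_{\varepsilon\downarrow0}\prod_{k=1}^n\frac{P^\varepsilon_{a_kb_k}}{P^\varepsilon_{a_kd_k}}\frac{\tau^\varepsilon_a}{\tau^\varepsilon_c}\in[0,\infty]$ whenever defined. $P^0_{ij}=\lim P^\varepsilon_{ij}$; one ergodic class means $(P^0_{ij})$ is irreducible on $\{1,\dots,M\}$. *)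

(* Defs.v *)
From HB Require Import structures.
From mathcomp Require Import all_boot all_order all_algebra.
From mathcomp Require Import all_classical all_reals all_analysis.
Set Implicit Arguments. Unset Strict Implicit. Unset Printing Implicit Defensive.
Import Order.TTheory GRing.Theory Num.Theory.
Import numFieldNormedType.Exports.
Local Open Scope classical_set_scope.
Local Open Scope ring_scope.

Section MRP.
Context {d : measure_display} {R : realType} {T : measurableType d}.

(* Q x : law of (next state, holding time) from state x *)
Variable Q : R.-pker T ~> (T * R)%type.

(* P(x,B) = Q(x, B x [0,oo)) (the kernel is supported on times >= 0) *)
Definition Pk (x : T) (B : set T) : \bar R := Q x (B `*` setT).

(* E T(x,B) : mean of the law Q(x, B x .)/P(x,B) *)
Definition ET (x : T) (B : set T) : \bar R :=
  ((\int[Q x]_(p in B `*` setT) (p.2)%:E) * ((fine (Pk x B))^-1)%:E)%E.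

Definition VarT (x : T) (B : set T) : \bar R :=
  ((\int[Q x]_(p in B `*` setT) ((p.2 - fine (ET x B)) ^+ 2)%:E)
     * ((fine (Pk x B))^-1)%:E)%E.

Definition Ef (f : R -> R) (c : R) (x : T) (B : set T) : R :=
  fine (\int[Q x]_(p in B `*` setT) (f (p.2 / c))%:E) / fine (Pk x B).

(* Law of the semi-Markov process X_t started at (x,0), via the iterated
   kernels of the chain (X_n, T_n):
   G n y s = P_{(y,s)}( X_n in A, s + T_1+..+T_n <= t < s + T_1+..+T_{n+1} ). *)
Fixpoint G (t : R) (A : set T) (n : nat) (y : T) (s : R) : \bar R :=
  match n with
  | 0 => if `[< A y /\ s <= t >] then Q y [set p | t < s + p.2] else 0%E
  | n'.+1 => (\int[Q y]_p G t A n' p.1 (s + p.2))%E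
  end.

Definition probX (x : T) (t : R) (A : set T) : \bar R :=
  (\sum_(n <oo) G t A n x 0)%E.

End MRP.

Definition bounded_continuous {R : realType} (f : R -> R) :=
  continuous f /\ exists M : R, forall r, `|f r| <= M.

(* Main.v *)
(** Only lower bounds are needed, because the probabilities of the classes at
    time t sum to at most one.  The probability of being in S_i at time t
    dominates [value], the least solution of the renewal equation in which the
    indicator that the current sojourn covers t is replaced by a trapezoid of
    slope 1/h; it is 1/h-Lipschitz in t, uniformly in eps.  Let b be the supremum
    of the c such that value >= c for all small eps and all large t.  A Lyapunov
    maximum principle yields eps_n -> 0 and t_n -> oo at which the infimum of
    [value] over some class is at most b + 2/n.  Superharmonicity propagates
    near-minimality backwards in time by sums of holding times taken in the
    supports of their limit laws (limits along an ultrafilter); as these laws have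
    no atoms for the class i0, the set of such sums is arbitrarily dense far away,
    so near-minimality holds on a whole long window before t_n.  Summing the
    superharmonicity inequality over the weights lambda and over a time grid
    telescopes to that window and gives
    lambda_i (tau_i - 2h) <= b * sum_j lambda_j tau_j; finally h -> 0. *)
From HB Require Import structures.
From mathcomp Require Import all_boot all_order all_algebra.
From mathcomp Require Import all_classical all_reals all_analysis.
From mathcomp Require Import measurable_realfun ring lra.
Require Import Defs.
Import Order.TTheory GRing.Theory Num.Theory.
Import numFieldNormedType.Exports.
Local Open Scope classical_set_scope.
Local Open Scope ring_scope.
Set Implicit Arguments.
Unset Strict Implicit.

(** * Integrals against a probability *)

(** The mean sojourns in classes other than [i0] may vanish with [eps], at unrelated rates, so a
    renewal theorem uniform in [eps] is not at hand. Condition (d) makes the next class, the holding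
    time and the starting state within its class asymptotically independent, but only against a
    fixed continuous test function. Hence the Lipschitz smoothing; and hence the infimum over each
    class, which leaves [M] inequalities in time, with an additive error [eta], for the laws started
    from one reference state per class. Summed over a time span of length [t_n] this error grows to
    about [eta * t_n], so it must be small against [1 / t_n]. This is what the maximum principle
    secures: it yields a nearly minimal value at a time in [[n, n + K]] with [K] independent of
    [eps], so that [eta] can be fixed before [eps]. For the propagation no limit law is formed: an
    ultrafilter gives a meaning to its support and decides every alternative. A genuine limit law is
    built, by Helly selection, only to contradict condition (e). *)

Section bounded_expectation.
Context {d : measure_display} {T : measurableType d} {R : realType}.
Context (P : {measure set T -> \bar R}) (P1 : P setT = 1%E).

Lemma le_prob1 (D : set T) : measurable D -> (P D <= 1)%E.
Proof. by move=> mD; rewrite -P1 le_measure ?inE. Qed.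

Lemma fin_num_prob (D : set T) : measurable D -> P D \is a fin_num.
Proof.
by move=> mD; rewrite ge0_fin_numE//; apply: (le_lt_trans (le_prob1 mD)); rewrite ltry.
Qed.

Lemma integrable_of_bounded (D : set T) (f : T -> R) (K : R) :
  measurable D -> measurable_fun D f -> (forall x, D x -> `|f x| <= K) ->
  P.-integrable D (EFin \o f).
Proof.
move=> mD mf fK; apply: measurable_bounded_integrable => //.
  by apply: (le_lt_trans (le_prob1 mD)); rewrite ltry.
by exists K; split; [exact: num_real|move=> M KM x Dx; apply: (le_trans (fK _ Dx)); exact: ltW].
Qed.

Lemma le_Rintegral_cst (D : set T) (f : T -> R) (K : R) :
  measurable D -> P.-integrable D (EFin \o f) -> (forall x, D x -> f x <= K) ->
  \int[P]_(x in D) f x <= K * fine (P D).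
Proof.
move=> mD If fK; rewrite -Rintegral_cst//; apply: le_Rintegral => //.
by apply: (@integrable_of_bounded _ _ `|K|).
Qed.

Lemma fine_prob_ge0 (D : set T) : 0 <= fine (P D).
Proof. exact: fine_ge0. Qed.

Lemma fine_prob_le1 (D : set T) : measurable D -> fine (P D) <= 1.
Proof.
move=> mD; rewrite -lee_fin fineK ?fin_num_prob//; exact: le_prob1.
Qed.

Lemma fine_prob_setT : fine (P [set: T]) = 1.
Proof. by rewrite P1. Qed.

Lemma normr_Rintegral_le_cst (D : set T) (f : T -> R) (K : R) :
  measurable D -> measurable_fun D f -> (forall x, D x -> `|f x| <= K) ->
  `|\int[P]_(x in D) f x| <= K * fine (P D).
Proof.
move=> mD mf fK; have If := integrable_of_bounded mD mf fK.
apply: (le_trans (le_normr_Rintegral mD If)); apply: le_Rintegral_cst => //.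
by move: If => /integrable_norm.
Qed.

Lemma fine_prob_indic (D : set T) : measurable D ->
  \int[P]_x (\1_D x) = fine (P D).
Proof. by move=> mD; rewrite /Rintegral integral_indic// setIT. Qed.

Lemma integrable_cstr (c : R) : P.-integrable setT (EFin \o (fun=> c)).
Proof. by apply: (@integrable_of_bounded _ _ `|c|). Qed.

Lemma integrable_addr (D : set T) (f g : T -> R) : measurable D ->
  P.-integrable D (EFin \o f) -> P.-integrable D (EFin \o g) ->
  P.-integrable D (EFin \o (fun x => f x + g x)).
Proof. by move=> mD If Ig; exact: (integrableD mD If Ig). Qed.

Lemma integrable_subr (D : set T) (f g : T -> R) : measurable D ->
  P.-integrable D (EFin \o f) -> P.-integrable D (EFin \o g) ->
  P.-integrable D (EFin \o (fun x => f x - g x)).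
Proof. by move=> mD If Ig; exact: (integrableB mD If Ig). Qed.

Lemma integrable_mulrl (D : set T) (c : R) (f : T -> R) : measurable D ->
  P.-integrable D (EFin \o f) -> P.-integrable D (EFin \o (fun x => c * f x)).
Proof. by move=> mD If; exact: (integrableZl mD c If). Qed.

Lemma le_RintegralT (f : T -> R) (K : R) :
  P.-integrable setT (EFin \o f) -> (forall x, f x <= K) -> \int[P]_x f x <= K.
Proof.
move=> If fK; rewrite -[leRHS]mulr1 -[X in _ * X]fine_prob_setT.
by apply: le_Rintegral_cst.
Qed.

Lemma normr_RintegralT (f : T -> R) (K : R) :
  measurable_fun setT f -> (forall x, `|f x| <= K) -> `|\int[P]_x f x| <= K.
Proof.
move=> mf fK; rewrite -[leRHS]mulr1 -[X in _ * X]fine_prob_setT.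
by apply: normr_Rintegral_le_cst.
Qed.

Lemma integrable_sumr N (f : 'I_N -> T -> R) :
  (forall l, P.-integrable setT (EFin \o f l)) ->
  P.-integrable setT (EFin \o (fun o => \sum_(l < N) f l o)).
Proof.
elim: N f => [|N IH] f If.
  under [X in EFin \o X]eq_fun do rewrite big_ord0.
  exact: integrable_cstr 0.
under [X in EFin \o X]eq_fun do rewrite big_ord_recr.
by apply: integrable_addr => //; apply: IH.
Qed.

Lemma Rintegral_sum N (f : 'I_N -> T -> R) :
  (forall l, P.-integrable setT (EFin \o f l)) ->
  \int[P]_o (\sum_(l < N) f l o) = \sum_(l < N) \int[P]_o f l o.
Proof.
elim: N f => [|N IH] f If.
  under eq_Rintegral do rewrite big_ord0.
  by rewrite big_ord0 Rintegral_cst// mul0r.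
under eq_Rintegral do rewrite big_ord_recr.
rewrite RintegralD//; last by apply: integrable_sumr.
by rewrite big_ord_recr/= IH.
Qed.

End bounded_expectation.

(** * Limits along an ultrafilter and uniform continuity *)

Section ultralimit.
Context {R : realType}.
Context (U : set_system nat) (UU : UltraFilter U).

(** Compactness of [[- K, K]] gives a cluster point, and an ultrafilter converges to each of its
    cluster points because it decides every preimage. *)
Lemma ultra_bounded_cvg (a : nat -> R) (K : R) :
  (forall n, `|a n| <= K) -> exists p : R, a @ U --> p.
Proof.
move=> aK; have PU : ProperFilter U by exact: (@ultra_proper _ U UU).
have := @segment_compact R (- K) K.
move=> /(_ (a @ U)) [|p [pK cp]].
  apply: (@filterE _ U) => n /=; rewrite in_itv/= -ler_norml; exact: aK.
exists p => B nB.
have [//|UB] := in_ultra_setVsetC (a @^-1` B) UU.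
have [x [/= nBx Bx]] := cp (~` B) B UB nB.
by [].
Qed.

End ultralimit.

(** Compactness is applied in its near-covering form, which leaves the second point [y] free to lie
    outside the segment. *)
Lemma segment_uniform_continuity {R : realType} (f : R -> R) (A : R) :
  continuous f -> forall e : R, 0 < e -> exists2 del : R, 0 < del &
    forall x y, - A <= x <= A -> `|x - y| < del -> `|f x - f y| < e.
Proof.
move=> cf e e0.
have /compact_near_coveringP := @segment_compact R (- A) A.
move=> /(_ _ (0 : R)^'+ (fun del x => forall y, `|x - y| < del -> `|f x - f y| < e)).
case.
  move=> x xA; have e20 : 0 < e / 2 by rewrite divr_gt0.
  have /(@cvgrPdist_lt _ R^o) /(_ _ e20) := cf x.
  move=> /nbhs_ballP[r /= r0 hr].
  have r20 : 0 < r / 2 by rewrite divr_gt0.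
  exists (ball x (r / 2), [set t | t < r / 2]) => /=.
    split; first exact: nbhsx_ballx.
    by exists (r / 2) => // t /=; rewrite sub0r normrN => /(le_lt_trans (ler_norm _)).
  move=> [x' t] /= [xx' tr] y x'y.
  have h1 : `|f x - f x'| < e / 2 by apply: hr; apply: lt_trans xx' _; rewrite ltr_pdivrMr// ltr_pMr// ltrDl.
  have h2 : `|f x - f y| < e / 2.
    apply: hr; rewrite /ball/= in xx' *.
    rewrite -(subrKA x') (le_lt_trans (ler_normD _ _))//.
    by rewrite (splitr r) ltrD// (lt_trans x'y).
  rewrite -(subrKA (f x)) (le_lt_trans (ler_normD _ _))// (splitr e) ltrD//.
  by rewrite distrC.
move=> r r0 hr; exists (r / 2); first by rewrite divr_gt0.
move=> x y xA; apply: (hr (r / 2)) => //=.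
- by rewrite sub0r normrN gtr0_norm ?divr_gt0// ltr_pdivrMr// ltr_pMr// ltrDl.
- by rewrite divr_gt0.
Qed.

(** * Helly's selection theorem *)

Section stieltjes_sums.
Context {R : realType}.

Lemma abel_summation (f D : nat -> R) (N : nat) :
  \sum_(l < N) f l.+1 * (D l.+1 - D l) =
  f N * D N - f 0 * D 0 - \sum_(l < N) (f l.+1 - f l) * D l.
Proof.
elim: N => [|N IH]; first by rewrite !big_ord0; ring.
by rewrite !big_ord_recr /= IH; ring.
Qed.

(** Summation by parts moves the differences from [D] to [f], whose increments are small. It serves
    with [D] the gap between a monotone function and its right regularization, which is not small
    pointwise but has a bounded sum over a grid. *)
Lemma abel_bound (f D : nat -> R) (N : nat) (K e : R) :
  (forall l, (l <= N)%N -> `|f l| <= K) -> (forall l, (l <= N)%N -> 0 <= D l) ->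
  (forall l, (l < N)%N -> `|f l.+1 - f l| <= e) ->
  `|\sum_(l < N) f l.+1 * (D l.+1 - D l)|
  <= K * D N + K * D 0 + e * \sum_(l < N) D l.
Proof.
move=> fK D0 fe; rewrite abel_summation.
apply: (le_trans (ler_normB _ _)); apply: lerD.
  apply: (le_trans (ler_normB _ _)); rewrite !normrM; apply: lerD.
    by rewrite (ger0_norm (D0 _ _))// ler_wpM2r ?D0 ?fK.
  by rewrite (ger0_norm (D0 _ _))// ler_wpM2r ?D0 ?fK.
rewrite mulr_sumr; apply: (le_trans (ler_norm_sum _ _ _)); apply: ler_sum => l _.
have Dl := D0 _ (ltnW (ltn_ord l)).
by rewrite normrM (ger0_norm Dl) ler_wpM2r// fe.
Qed.

Lemma Rintegral_ocitv_approx (P : probability R R) (f : R -> R) (a b e K : R)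
    (c : R) : measurable_fun setT f -> a <= b ->
  (forall x, `|f x| <= K) ->
  (forall x, a < x <= b -> `|f x - c| <= e) ->
  `|\int[P]_(x in `]a, b]) f x - c * fine (P `]a, b]%classic)| <= e * fine (P `]a, b]%classic).
Proof.
move=> mf ab fK fe.
have mf' : measurable_fun `]a, b] f by exact: measurable_funS mf.
have If : P.-integrable `]a, b] (EFin \o f).
  by apply: (@integrable_of_bounded _ _ _ P (probability_setT P) _ _ K).
rewrite -Rintegral_cst// -RintegralB//; last first.
  by apply: (@integrable_of_bounded _ _ _ P (probability_setT P) _ _ `|c|).
apply: normr_Rintegral_le_cst => //; first exact: probability_setT.
exact: measurable_funB.
Qed.

Definition dfun (P : probability R R) (x : R) : R := fine (P `]-oo, x]%classic).

Lemma dfun_ge0 P x : 0 <= dfun P x. Proof. exact: fine_prob_ge0. Qed.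
Lemma dfun_le1 P x : dfun P x <= 1. Proof. by apply: fine_prob_le1 => //; exact: probability_setT. Qed.

Lemma fine_prob_ocitv (P : probability R R) (a b : R) : a <= b ->
  fine (P `]a, b]%classic) = dfun P b - dfun P a.
Proof.
move=> ab; rewrite /dfun -fineB ?fin_num_measure//; congr fine.
have -> : `]a, b]%classic = `]-oo, b] `\` `]-oo, a] :> set R.
  by rewrite -[RHS]setCK setCD setCitvl setUC -[LHS]setCK setCitv.
rewrite measureD ?setIidr//; first exact: subset_itvl.
by rewrite -ge0_fin_numE// fin_num_measure.
Qed.

Lemma dfun_le (P : probability R R) x y : x <= y -> dfun P x <= dfun P y.
Proof. by move=> xy; rewrite -subr_ge0 -fine_prob_ocitv// fine_prob_ge0. Qed.

(** On each cell [f] oscillates by at most [e]; on the two tails, of total mass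
    [dfun P (q 0) + (1 - dfun P (q N))], only the bound [K] is used. *)
Lemma stieltjes_approx (P : probability R R) (f : R -> R) (q : nat -> R)
    (N : nat) (K e : R) :
  measurable_fun setT f -> (forall x, `|f x| <= K) ->
  (forall l, (l < N)%N -> q l <= q l.+1) ->
  (forall l x, (l < N)%N -> q l < x <= q l.+1 -> `|f x - f (q l.+1)| <= e) ->
  `|\int[P]_x f x - \sum_(l < N) f (q l.+1) * (dfun P (q l.+1) - dfun P (q l))|
  <= e * (dfun P (q N) - dfun P (q 0)) + K * (dfun P (q 0) + (1 - dfun P (q N))).
Proof.
move=> mf fK qm qe.
have Ib D : measurable D -> P.-integrable D (EFin \o f).
  move=> mD; apply: (@integrable_of_bounded _ _ _ P (probability_setT P) _ _ K) => //.
  exact: measurable_funS mf.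
have H n : (n <= N)%N -> `|\int[P]_(x in `]-oo, q n]) f x -
    \sum_(l < n) f (q l.+1) * (dfun P (q l.+1) - dfun P (q l))|
    <= e * (dfun P (q n) - dfun P (q 0)) + K * dfun P (q 0).
  elim: n => [_|n IH nN].
    rewrite big_ord0 subrr mulr0 add0r subr0; apply: normr_Rintegral_le_cst => //; first exact: probability_setT.
    exact: measurable_funS mf.
  have := IH (ltnW nN); rewrite big_ord_recr/=.
  have -> : `]-oo, q n.+1]%classic = `]-oo, q n] `|` `]q n, q n.+1] :> set R.
    by rewrite -itv_bndbnd_setU// bnd_simp qm.
  rewrite Rintegral_setU//; last 2 first.
  - exact/Ib/measurableU.
  - by apply: lt_disjoint => x y; rewrite !in_itv/= => xq /andP[qy _]; exact: le_lt_trans qy.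
  have := @Rintegral_ocitv_approx P f (q n) (q n.+1) e K (f (q n.+1)) mf (qm _ nN) fK.
  move=> /(_ (fun x => qe n x nN)); rewrite fine_prob_ocitv ?qm//.
  move=> h1 h2.
  rewrite (_ : _ - _ = (\int[P]_(x in `]-oo, q n]) f x -
    \sum_(l < n) f (q l.+1) * (dfun P (q l.+1) - dfun P (q l))) +
   (\int[P]_(x in `]q n, q n.+1]) f x - f (q n.+1) * (dfun P (q n.+1) - dfun P (q n)))); last ring.
  by apply: (le_trans (ler_normD _ _)); apply: (le_trans (lerD h2 h1)); lra.
have -> : \int[P]_x f x = \int[P]_(x in `]-oo, q N]) f x + \int[P]_(x in `]q N, +oo[) f x.
  rewrite -Rintegral_setU//.
  - by rewrite -itv_bndbnd_setU ?bnd_simp// set_itvNyy.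
  - exact/Ib/measurableU.
  - by apply: lt_disjoint => x y; rewrite !in_itv/= andbT => xq; exact: le_lt_trans.
have h3 : `|\int[P]_(x in `]q N, +oo[) f x| <= K * (1 - dfun P (q N)).
  have <- : fine (P `]q N, +oo[%classic) = 1 - dfun P (q N).
    rewrite -(@fine_prob_setT _ _ _ P (probability_setT P)) /dfun -fineB ?fin_num_measure//; congr fine.
    have -> : `]q N, +oo[%classic = [set: R] `\` `]-oo, q N].
      by rewrite setTD setCitvl.
    rewrite measureD ?setTI//.
    by rewrite -ge0_fin_numE// fin_num_measure.
  apply: normr_Rintegral_le_cst => //; first exact: probability_setT.
  exact: measurable_funS mf.
rewrite addrAC; apply: (le_trans (ler_normD _ _)).
by have := H N (leqnn N); lra.
Qed.

End stieltjes_sums.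

Section right_regularization.
Context {R : realType}.
Context (F : R -> R) (Fm : forall x y, x <= y -> F x <= F y)
  (F0 : forall x, 0 <= F x) (F1 : forall x, F x <= 1)
  (Ftight : forall e : R, 0 < e -> exists A : R, F (- A) <= e /\ 1 - F A <= e).

(** A pointwise limit of distribution functions is monotone but need not be right continuous. The
    right limit is squeezed between [F x] and the values of [F] at later points, so regularizing
    shifts mass by less than any grid cell. *)
Definition rreg (x : R) : R := inf [set F y | y in [set y | x < y]].

Let lbF x : has_lbound [set F y | y in [set y | x < y]].
Proof. by exists 0 => _ [y _ <-]. Qed.

Let neF x : [set F y | y in [set y | x < y]] !=set0.
Proof. by exists (F (x + 1)), (x + 1) => //=; rewrite ltrDl. Qed.

Lemma rreg_le x y : x < y -> rreg x <= F y.
Proof. by move=> xy; apply: ge_inf => //; exists y. Qed.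

Lemma le_rreg x : F x <= rreg x.
Proof. by apply: lb_le_inf => // _ [y /= xy <-]; exact/Fm/ltW. Qed.

Lemma rreg_nd : nondecreasing rreg.
Proof.
move=> x y xy; apply: lb_le_inf => // _ [z /= yz <-].
by apply: rreg_le; exact: le_lt_trans yz.
Qed.

Lemma rreg_rc (x : R) : rreg y @[y --> x^'+] --> rreg x.
Proof.
apply/(@cvgrPdist_lt _ R^o) => e e0.
have [_ [y /= xy <-] Fy] := inf_adherent e0 (conj (neF x) (lbF x)).
exists (y - x) => /=; first by rewrite subr_gt0.
move=> z /= zy xz; rewrite distrC ger0_norm; last by rewrite subr_ge0 rreg_nd// ltW.
rewrite ltrBlDl; apply: le_lt_trans Fy; apply: rreg_le.
by move: zy; rewrite distrC ger0_norm ?subr_ge0 ?(ltW xz)// ltrD2r.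
Qed.

Lemma rreg_Ny : rreg @ -oo --> (0 : R).
Proof.
apply/(@cvgrPdist_lt _ R^o) => e e0.
have [|A [FA _]] := Ftight (e := e / 2); first by rewrite divr_gt0.
exists (- A); split; first exact: num_real.
move=> x xA; rewrite sub0r normrN ger0_norm; last exact: le_trans (le_rreg _).
by apply: le_lt_trans (rreg_le xA) _; apply: le_lt_trans FA _; rewrite ltr_pdivrMr// ltr_pMr// ltrDl.
Qed.

Lemma rreg_y : rreg @ +oo --> (1 : R).
Proof.
apply/(@cvgrPdist_lt _ R^o) => e e0.
have [|A [_ FA]] := Ftight (e := e / 2); first by rewrite divr_gt0.
exists A; split; first exact: num_real.
move=> x xA; rewrite ger0_norm; last first.
  by rewrite subr_ge0; apply: (le_trans (rreg_le _) (F1 (x + 1))); rewrite ltrDl.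
apply: le_lt_trans (_ : 1 - F A < _); first by rewrite lerD2l lerN2; apply: (le_trans _ (le_rreg _)); exact/Fm/ltW.
by apply: le_lt_trans FA _; rewrite ltr_pdivrMr// ltr_pMr// ltrDl.
Qed.

HB.instance Definition _ := isCumulative.Build R _ R rreg rreg_nd rreg_rc.
HB.instance Definition _ := isCumulativeBounded.Build R 0 1 rreg rreg_Ny rreg_y.

(* [lebesgue_stieltjes_measure] lives on [measurableTypeR R], whose display differs from the canonical one of [R]. *)
Definition rreg_measure (A : set R) : \bar R := lebesgue_stieltjes_measure rreg A.

Let rm0 : rreg_measure set0 = 0%E. Proof. exact: measure0. Qed.
Let rm_ge0 A : (0 <= rreg_measure A)%E. Proof. exact: measure_ge0. Qed.
Let rm_sigma : semi_sigma_additive (rreg_measure : set R -> \bar R).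
Proof. exact: (@measure_semi_sigma_additive _ _ _ (lebesgue_stieltjes_measure rreg)). Qed.

HB.instance Definition _ := isMeasure.Build _ _ _ rreg_measure rm0 rm_ge0 rm_sigma.

Let rmT : rreg_measure setT = 1%E.
Proof. exact: (@probability_setT _ _ _ (lebesgue_stieltjes_measure rreg : probability _ _)). Qed.

HB.instance Definition _ := Measure_isProbability.Build _ _ _ rreg_measure rmT.

Lemma dfun_rreg x : dfun rreg_measure x = rreg x.
Proof.
by have := @cdf_lebesgue_stieltjes_id R rreg x; rewrite /cdf /distribution /pushforward preimage_id /dfun => ->.
Qed.

Lemma exists_probability_rreg :
  exists xi : probability R R, forall x, dfun xi x = rreg x.
Proof. by exists rreg_measure; exact: dfun_rreg. Qed.

End right_regularization.

Lemma filter_forall_le_nat (U : set_system nat) (FU : Filter U) (Q : nat -> set nat) :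
  (forall c, U (Q c)) -> forall k, U [set n | forall c, (c <= k)%N -> Q c n].
Proof.
move=> UQ k; have := @filter_forall _ 'I_k.+1 (fun i => Q i) U FU (fun i => UQ i).
apply: filterS => n h c ck; exact: (h (Ordinal (ck : (c < k.+1)%N))).
Qed.

(** Diagonal extraction: the [k]-th index is taken beyond the previous one and in the intersection
    of the first [k + 1] conditions with tolerance [1 / (k + 1)]. This finite intersection belongs
    to [U], hence is not empty. *)
Lemma ultra_subsequence (R : realType) (U : set_system nat) (UU : UltraFilter U) (a : nat -> nat -> R)
    (p : nat -> R) : \oo `<=` U -> (forall c, a c @ U --> p c) ->
  exists phi : nat -> nat, (forall k, (phi k < phi k.+1)%N) /\
    forall c, (fun k => a c (phi k)) @ \oo --> p c.
Proof.
move=> ooU acv; have PU : ProperFilter U by exact: (@ultra_proper _ U UU).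
have FU : Filter U by exact: filter_filter.
have ex (km : nat * nat) : exists n, (km.2 < n)%N /\
    forall c, (c <= km.1)%N -> `|p c - a c n| < km.1.+1%:R^-1.
  have h c : U [set n | `|p c - a c n| < km.1.+1%:R^-1].
    by have /(@cvgrPdist_lt _ R^o) := acv c; apply; rewrite invr_gt0.
  have hm : U [set n | (km.2 < n)%N].
    by apply: ooU; exists km.2.+1.
  have [n [? ?]] := @filter_ex _ U PU _ (@filterI _ U FU _ _ hm (filter_forall_le_nat FU h km.1)).
  by exists n.
have [f fP] := choice ex.
pose phi := fix phi k := if k is k'.+1 then f (k, phi k') else f (0, 0)%N.
have phiP k c : (c <= k)%N -> `|p c - a c (phi k)| < k.+1%:R^-1.
  by case: k => [|k] ck; [case: (fP (0, 0)%N)|case: (fP (k.+1, phi k))] => _; apply.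
exists phi; split => [k|c]; first by case: (fP (k.+1, phi k)).
apply/(@cvgrPdist_lt _ R^o) => e e0; near=> k.
apply: (lt_trans (phiP k c _)); first by near: k; exact: nbhs_infty_ge.
by near: k; exact: (near_infty_natSinv_lt (PosNum e0)).
Unshelve. all: by end_near. Qed.

Section helly.
Context {R : realType}.

(** The limit [F] is taken at all reals along an ultrafilter, the subsequence only at countably many
    grid points. Continuity points of the limit law are avoided: sums against [F] and against
    [rreg F] over a fine grid are compared by Abel summation. *)
Theorem helly_selection (mu : nat -> probability R R) :
  (forall e : R, 0 < e -> exists A : R, forall n,
     dfun (mu n) (- A) <= e /\ 1 - dfun (mu n) A <= e) ->
  exists (phi : nat -> nat) (xi : probability R R),
    (forall k, (phi k < phi k.+1)%N) /\
    forall f : R -> R, bounded_continuous f ->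
      (fun k => \int[mu (phi k)]_x f x) @ \oo --> \int[xi]_x f x.
Proof.
move=> tight.
have [U [UU ooU]] := @ultraFilterLemma nat \oo _.
have PU : ProperFilter U by exact: (@ultra_proper _ U UU).
have FU : Filter U by exact: filter_filter.
have ex x : exists p : R, (fun n => dfun (mu n) x) @ U --> p.
  apply: (@ultra_bounded_cvg _ U UU _ 1) => n.
  by rewrite ger0_norm ?dfun_ge0 ?dfun_le1.
have [F FP] := choice ex.
have Fm x y : x <= y -> F x <= F y.
  move=> xy; apply: (ler_cvg_to (FP x) (FP y)).
  by apply: nearW => n; exact: dfun_le.
have F0 x : 0 <= F x.
  by apply: (cvgr_to_ge (FP x)); apply: nearW => n; exact: dfun_ge0.
have F1 x : F x <= 1.
  by apply: (cvgr_to_le (FP x)); apply: nearW => n; exact: dfun_le1.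
have Ft (e : R) : 0 < e -> exists A : R, F (- A) <= e /\ 1 - F A <= e.
  move=> /tight[A hA]; exists A; split.
    by apply: (cvgr_to_le (FP _)); apply: nearW => n; case: (hA n).
  rewrite lerBlDr -lerBlDl.
  by apply: (cvgr_to_ge (FP _)); apply: nearW => n; case: (hA n); lra.
have [xi xiE] := exists_probability_rreg Fm F0 F1 Ft.
(* The triple [(A, m, l)] encodes the grid point [- A + l / (m + 1)]. Being countable, all grids are
   served by one subsequence. *)
pose pt (i : nat * nat * nat) : R := - i.1.1%:R + i.2%:R / i.1.2.+1%:R.
pose qq c : R := if unpickle c is Some i then pt i else 0.
have [phi [phim phic]] := @ultra_subsequence R U UU (fun c n => dfun (mu n) (qq c))
  (fun c => F (qq c)) ooU (fun c => FP (qq c)).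
have phiF i : (fun k => dfun (mu (phi k)) (pt i)) @ \oo --> F (pt i).
  by have := phic (pickle i); rewrite /qq pickleK.
exists phi, xi; split=> // f [cf [K fK]].
have K0 : 0 <= K by apply: le_trans (fK 0).
have mf : measurable_fun setT f by exact: continuous_measurable_fun.
apply/(@cvgrPdist_lt _ R^o) => e0 e00.
(* The errors below add up to at most [(7 * K + 3) * e]: two Riemann-Stieltjes approximations, the
   Abel comparison, and the convergence at grid points. *)
pose e := e0 / (8 * K + 6).
have e_gt0 : 0 < e by rewrite divr_gt0//; lra.
have eE : e * (8 * K + 6) = e0 by rewrite /e mulfVK// gt_eqF//; lra.
have [A0 hA0] := tight e e_gt0.
(* One unit of room beyond [A0]: [rreg F] at an end of the grid is bounded by [F] only at a strictly
   later point. *)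
pose A := (Num.truncn `|A0|).+2.
have AA0 : A0 <= A%:R - 1.
  have := truncnS_gt `|A0|; have := ler_norm A0; rewrite /A -natr1; lra.
have [del del0 unif] := segment_uniform_continuity A%:R cf e_gt0.
pose m := Num.truncn del^-1.
have mdel : m.+1%:R^-1 < del.
  by rewrite -[ltRHS]invrK ltf_pV2 ?posrE ?invr_gt0// truncnS_gt.
pose N := (2 * A * m.+1)%N.
pose q l : R := pt (A, m, l).
have q0E : q 0%N = - A%:R by rewrite /q /pt/= mul0r addr0.
have qNE : q N = A%:R.
  rewrite /q /pt/= /N natrM mulfK ?pnatr_eq0// natrM; ring.
have qS l : q l.+1 - q l = m.+1%:R^-1.
  by rewrite /q /pt/= -natr1; ring.
have qle l : q l <= q l.+1 by rewrite -subr_ge0 qS invr_ge0.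
have qmono i j : (i <= j)%N -> q i <= q j.
  by move=> /subnK <-; elim: (j - i)%N => // k IH; apply: (le_trans IH); rewrite addSn.
have qA l : (l <= N)%N -> - A%:R <= q l <= A%:R.
  by move=> lN; rewrite -{1}q0E -qNE !qmono.
have qosc l x : (l < N)%N -> q l < x <= q l.+1 -> `|f x - f (q l.+1)| <= e.
  move=> lN /andP[ql qx]; rewrite distrC; apply/ltW/unif; first exact: qA.
  rewrite ger0_norm ?subr_ge0//; apply: le_lt_trans mdel.
  by rewrite -(qS l) lerD2l lerN2 ltW.
have qosc' l : (l < N)%N -> `|f (q l.+1) - f (q l)| <= e.
  move=> lN; apply/ltW/unif; first exact: qA.
  by rewrite qS ger0_norm ?invr_ge0.
have FA : F (q 0%N) <= e /\ rreg F (q 0%N) <= e /\ F (q N) >= 1 - e /\ rreg F (q N) >= 1 - e.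
  have h1 : F (- A0) <= e.
    by apply: (cvgr_to_le (FP _)); apply: nearW => n; case: (hA0 n).
  have h2 : F (q N) >= 1 - e.
    apply: le_trans (Fm A0 _ _); last by rewrite qNE; lra.
    by apply: (cvgr_to_ge (FP _)); apply: nearW => n; case: (hA0 n); lra.
  split; first by apply: le_trans h1; apply: Fm; rewrite q0E; lra.
  split; first by apply: le_trans h1; apply: rreg_le => //; rewrite q0E; lra.
  by split => //; apply: (le_trans h2); exact: le_rreg.
case: FA => FA0 [rFA0 [FAN rFAN]].
have hxi := @stieltjes_approx R xi f q N K e mf fK (fun l _ => qle l) qosc.
rewrite !xiE in hxi; rewrite (eq_bigr (fun l : 'I_N => f (q l.+1) * (rreg F (q l.+1) - rreg F (q l)))) in hxi; last first.
  by move=> l _; rewrite !xiE.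
have qlt l : q l < q l.+1 by rewrite -subr_gt0 qS invr_gt0.
(* Each [rreg F (q l)] is at most [F (q l.+1)], so the gaps telescope although there are [N] of
   them. *)
have h3 n : \sum_(l < n) (rreg F (q l) - F (q l)) <= F (q n) - F (q 0%N).
  elim: n => [|n IH]; first by rewrite big_ord0 subrr.
  by rewrite big_ord_recr/=; have := rreg_le F0 (qlt n); lra.
have habel : `|\sum_(l < N) f (q l.+1) * (rreg F (q l.+1) - rreg F (q l)) -
     \sum_(l < N) f (q l.+1) * (F (q l.+1) - F (q l))| <= K * e + K * e + e.
  rewrite -sumrB.
  rewrite (eq_bigr (fun l : 'I_N => f (q l.+1) * ((rreg F (q l.+1) - F (q l.+1)) -
     (rreg F (q l) - F (q l))))); last by move=> l _; ring.
  have := @abel_bound R (f \o q) (fun l => rreg F (q l) - F (q l)) N K e.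
  move=> /(_ (fun l _ => fK (q l)) _ qosc') /= h.
  apply: le_trans (h _) _; first by move=> l _; rewrite subr_ge0 le_rreg.
  apply: lerD; first apply: lerD.
  - rewrite ler_wpM2l//; have : rreg F (q N) <= 1.
      by apply: le_trans (rreg_le F0 (qlt N)) _.
    lra.
  - by rewrite ler_wpM2l//; have := F0 (q 0%N); lra.
  - rewrite -[leRHS]mulr1; apply: ler_wpM2l; first exact: ltW.
    apply: (le_trans (h3 N)).
    by have := F0 (q 0%N); have := F1 (q N); lra.
(* Each of the [N] cells carries the errors at its two endpoints. *)
pose e' := e / (2 * N.+1%:R).
have e'0 : 0 < e' by rewrite divr_gt0// mulr_gt0.
have near_q : \forall k \near \oo, forall l : 'I_N.+1, `|F (q l) - dfun (mu (phi k)) (q l)| < e'.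
  apply: filter_forall => l.
  by have /(@cvgrPdist_lt _ R^o) := phiF (A, m, nat_of_ord l); exact.
near=> k.
have hk : forall l, (l <= N)%N -> `|F (q l) - dfun (mu (phi k)) (q l)| < e'.
  have hk : forall l : 'I_N.+1, `|F (q l) - dfun (mu (phi k)) (q l)| < e' by near: k.
  by move=> l lN; exact: (hk (Ordinal (lN : (l < N.+1)%N))).
have hmu := @stieltjes_approx R (mu (phi k)) f q N K e mf fK (fun l _ => qle l) qosc.
have hmu' : K * (dfun (mu (phi k)) (q 0%N) + (1 - dfun (mu (phi k)) (q N))) <= K * (e + e).
  rewrite ler_wpM2l// lerD//; case: (hA0 (phi k)) => h1 h2.
    by apply: le_trans h1; apply: dfun_le; rewrite q0E; lra.
  by apply: le_trans h2; rewrite lerD2l lerN2; apply: dfun_le; rewrite qNE; lra.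
have hsum : `|\sum_(l < N) f (q l.+1) * (F (q l.+1) - F (q l)) -
  \sum_(l < N) f (q l.+1) * (dfun (mu (phi k)) (q l.+1) - dfun (mu (phi k)) (q l))| <= K * e.
  rewrite -sumrB; apply: (le_trans (ler_norm_sum _ _ _)).
  apply: le_trans (_ : \sum_(l < N) K * (e' + e') <= _).
    apply: ler_sum => l _; rewrite -mulrBr normrM ler_pM//.
    rewrite (_ : _ - _ = (F (q l.+1) - dfun (mu (phi k)) (q l.+1)) -
      (F (q l) - dfun (mu (phi k)) (q l))); last ring.
    by apply: (le_trans (ler_normB _ _)); rewrite lerD// ltW// hk// ltnW.
  rewrite sumr_const card_ord -mulr_natr -mulrA ler_wpM2l//.
  rewrite /e' (_ : _ + _ = e / N.+1%:R); last by field; rewrite gt_eqF//= ?ltr0n.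
  rewrite mulrAC ler_pdivrMr//; apply: ler_wpM2l; first exact: ltW.
  by rewrite ler_nat.
have hd1 : e * (rreg F (q N) - rreg F (q 0%N)) <= e.
  rewrite -[leRHS]mulr1; apply: ler_wpM2l; first exact: ltW.
  have := le_rreg Fm (q 0%N); have := F0 (q 0%N).
  by have := le_trans (rreg_le F0 (qlt N)) (F1 _); lra.
have hd2 : e * (dfun (mu (phi k)) (q N) - dfun (mu (phi k)) (q 0%N)) <= e.
  rewrite -[leRHS]mulr1; apply: ler_wpM2l; first exact: ltW.
  by have := dfun_ge0 (mu (phi k)) (q 0%N); have := dfun_le1 (mu (phi k)) (q N); lra.
have hd3 : K * (rreg F (q 0%N) + (1 - rreg F (q N))) <= K * (e + e).
  by rewrite ler_wpM2l// lerD//; lra.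
move: hxi hmu hsum habel; set I1 := \int[xi]_x _; set I2 := \int[_]_x _.
set s1 := \sum_(l < N) _; set s2 := \sum_(l < N) _; set s3 := \sum_(l < N) _.
move=> hxi hmu hsum habel.
move: hxi hmu hsum habel; rewrite !ler_norml ltr_norml => /andP[? ?] /andP[? ?] /andP[? ?] /andP[? ?].
by apply/andP; split; lra.
Unshelve. all: by end_near. Qed.

End helly.

(** * Smoothed occupation probabilities *)

Section trapezoid.
Context {R : realType}.

(** It never exceeds the indicator of [0 < t < s], and it is [1 / h]-Lipschitz in [s] as well, so
    that it is an admissible test function for the law of the holding time. *)
Definition trap (h t s : R) : R :=
  Num.max 0 (Num.min 1 (Num.min (t / h) ((s - t) / h))).

Lemma trap_ge0 h t s : 0 <= trap h t s.
Proof. by rewrite le_max lexx. Qed.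

Lemma trap_le1 h t s : trap h t s <= 1.
Proof. by rewrite ge_max ler01 ge_min lexx. Qed.

Lemma trap_eq0 h t s : 0 < h -> t <= 0 \/ s <= t -> trap h t s = 0.
Proof.
move=> h0 ts; apply/max_idPl; rewrite 2!ge_min.
case: ts => ts.
  by rewrite (_ : t / h <= 0) ?orbT// pmulr_lle0 ?invr_gt0.
by rewrite (_ : (s - t) / h <= 0) ?orbT// pmulr_lle0 ?invr_gt0// subr_le0.
Qed.

Lemma trap_eq1 h t s : 0 < h -> h <= t -> t <= s - h -> trap h t s = 1.
Proof.
move=> h0 ht ts; rewrite /trap (_ : Num.min 1 _ = 1) ?(max_idPr _)//.
by apply/min_idPl; rewrite le_min !ler_pdivlMr//; lra.
Qed.

Lemma normr_max_le (a b c d e : R) :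
  `|a - c| <= e -> `|b - d| <= e -> `|Num.max a b - Num.max c d| <= e.
Proof.
rewrite !ler_norml => /andP[? ?] /andP[? ?].
by apply/andP; split; rewrite /Num.max; case: ltP => ?; case: ltP => ?; lra.
Qed.

Lemma normr_min_le (a b c d e : R) :
  `|a - c| <= e -> `|b - d| <= e -> `|Num.min a b - Num.min c d| <= e.
Proof.
rewrite !ler_norml => /andP[? ?] /andP[? ?].
by apply/andP; split; rewrite /Num.min; case: ltP => ?; case: ltP => ?; lra.
Qed.

Lemma trap_lip_l h t t' s : 0 < h -> `|trap h t s - trap h t' s| <= `|t - t'| / h.
Proof.
move=> h0; have e0 : 0 <= `|t - t'| / h by rewrite divr_ge0 ?normr_ge0// ltW.
apply: normr_max_le; first by rewrite subrr normr0.
apply: normr_min_le; first by rewrite subrr normr0.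
apply: normr_min_le; rewrite -mulrBl normrM (gtr0_norm (_ : 0 < h^-1)) ?invr_gt0//.
by rewrite (_ : s - t - (s - t') = t' - t) 1?distrC//; ring.
Qed.

Lemma trap_lip_r h t s s' : 0 < h -> `|trap h t s - trap h t s'| <= `|s - s'| / h.
Proof.
move=> h0; have e0 : 0 <= `|s - s'| / h by rewrite divr_ge0 ?normr_ge0// ltW.
apply: normr_max_le; first by rewrite subrr normr0.
apply: normr_min_le; first by rewrite subrr normr0.
apply: normr_min_le; first by rewrite subrr normr0.
rewrite -mulrBl normrM (gtr0_norm (_ : 0 < h^-1)) ?invr_gt0//.
by rewrite (_ : s - t - (s' - t) = s - s')//; ring.
Qed.

Lemma trap_prob h t s : 0 < h -> trap h t s <= ((0 < t) && (t < s))%:R.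
Proof.
move=> h0; have [t0|t0] := ltP 0 t; last by rewrite trap_eq0//; left.
by have [ts|ts] := ltP t s; [exact: trap_le1|rewrite trap_eq0//; right].
Qed.

(* Along one trajectory the reward is carried by [0, s] and the continuation by [s, oo); both vanish at s. *)
Lemma trap_concat (h s : R) (c : R) (u : R -> R) : 0 < h -> 0 <= s ->
  0 <= c <= 1 -> (forall t, 0 <= u t <= 1) -> (forall t, t <= 0 -> u t = 0) ->
  (forall t t', `|u t - u t'| <= `|t - t'| / h) ->
  let w t := c * trap h t s + u (t - s) in
  [/\ forall t, 0 <= w t <= 1, forall t, t <= 0 -> w t = 0
    & forall t t', `|w t - w t'| <= `|t - t'| / h].
Proof.
move=> h0 s0 /andP[c0 c1] u01 u0 ulip w.
have wl t : t <= s -> w t = c * trap h t s.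
  by move=> ts; rewrite /w u0 ?addr0// subr_le0.
have wr t : s <= t -> w t = u (t - s).
  by move=> ts; rewrite /w trap_eq0 ?mulr0 ?add0r//; right.
have liple t t' : t <= t' -> `|w t - w t'| <= `|t - t'| / h.
  move=> tt'.
  have L1 a b : `|c * trap h a s - c * trap h b s| <= `|a - b| / h.
    rewrite -mulrBr normrM (ger0_norm c0); apply: (le_trans _ (trap_lip_l a b s h0)).
    by rewrite ler_piMl.
  have [t's|st'] := leP t' s; first by rewrite !wl// (le_trans tt').
  have [st|ts] := leP s t.
    rewrite (wr _ st) (wr _ (ltW st')); apply: (le_trans (ulip _ _)).
    by rewrite (_ : t - s - (t' - s) = t - t')//; ring.
  rewrite -(subrKA (w s)); apply: (le_trans (ler_normD _ _)).
  apply: le_trans (_ : `|t - s| / h + `|s - t'| / h <= _).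
    apply: lerD; first by rewrite (wl _ (ltW ts)) (wl _ (lexx s)).
    rewrite (wr _ (lexx s)) (wr _ (ltW st')); apply: (le_trans (ulip _ _)).
    by rewrite (_ : s - s - (t' - s) = s - t')//; ring.
  rewrite -mulrDl ler_pM2r ?invr_gt0// !ler0_norm; lra.
split=> [t|t t0|t t'].
- have [ts|st] := leP t s; last by rewrite (wr _ (ltW st)).
  rewrite wl// mulr_ge0 ?trap_ge0//= -[leRHS]mulr1 ler_pM ?trap_ge0 ?trap_le1//.
- by rewrite wl ?(le_trans t0)// trap_eq0 ?mulr0//; left.
- have [/liple//|/ltW/liple] := leP t t'.
  by rewrite distrC (distrC t).
Qed.

End trapezoid.

(** The kernels live on [T * R] and charge negative times only on null sets; truncation at 0 makes
    nonnegativity hold everywhere, not merely almost everywhere. *)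
Definition holding {R : realType} {T : Type} (p : T * R) : R := Num.max p.2 0.

(** * Measurability of integrals against a kernel *)

Section joint_kernel.
Context {d : measure_display} {R : realType} {T : measurableType d}
  (k : R.-pker T ~> (T * R)%type).

(** The kernel is lifted to state-time pairs, so that integrals whose integrand also depends on the
    time are measurable in state and time jointly. *)
Definition kfst (z : T * R) : {measure set (T * R) -> \bar R} := k z.1.

Let mkfst U : measurable U -> measurable_fun [set: T * R] (kfst ^~ U).
Proof.
move=> mU; rewrite /kfst.
exact: (measurableT_comp (measurable_kernel k U mU) measurable_fst).
Qed.

HB.instance Definition _ := isKernel.Build _ _ _ _ _ kfst mkfst.

Let kfst1 z : kfst z setT = 1%E.
Proof. exact: prob_kernel. Qed.

HB.instance Definition _ := Kernel_isProbability.Build _ _ _ _ _ kfst kfst1.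

Lemma measurable_integral_kfst (f : (T * R) * (T * R) -> \bar R) :
  (forall z, (0 <= f z)%E) -> measurable_fun setT f ->
  measurable_fun setT (fun z : T * R => (\int[k z.1]_p f (z, p))%E).
Proof.
move=> f0 mf.
exact: (measurable_fun_integral_finite_kernel f kfst).
Qed.

End joint_kernel.
Lemma measurable_holding {d} {R : realType} {T : measurableType d} :
  measurable_fun setT (@holding R T).
Proof. by apply: measurable_maxr => //; exact: measurable_snd. Qed.

Lemma measurable_trap {R : realType} d (T : measurableType d) (h : R) (f g : T -> R) :
  measurable_fun setT f -> measurable_fun setT g ->
  measurable_fun setT (fun x => trap h (f x) (g x)).
Proof.
move=> mf mg; apply: measurable_maxr => //; apply: measurable_minr => //.
apply: measurable_minr; apply: measurable_funM => //.
exact: measurable_funB.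
Qed.

(** * The smoothed renewal equation *)

Section kernel_value.
Context {d : measure_display} {R : realType} {T : measurableType d}
  (k : R.-pker T ~> (T * R)%type) (A : set T) (mA : measurable A)
  (h : R) (h0 : 0 < h).

(** The second component of [z] is the time still to elapse; the recursion collects the smoothed
    reward of the first [n] sojourns. *)
Fixpoint valueN (n : nat) (z : T * R) : R :=
  if n is n'.+1 then
    \int[k z.1]_p (\1_A z.1 * trap h z.2 (holding p) + valueN n' (p.1, z.2 - holding p))
  else 0.

Let g n (z : T * R) (p : T * R) : R :=
  \1_A z.1 * trap h z.2 (holding p) + valueN n (p.1, z.2 - holding p).

Let mg n : measurable_fun setT (valueN n) ->
  measurable_fun setT (fun zp : (T * R) * (T * R) => g n zp.1 zp.2).
Proof.
move=> mv; apply: measurable_funD.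
  apply: measurable_funM.
    apply: (@measurableT_comp _ _ _ _ _ _ (\1_A : T -> R)) => //.
    exact: (measurableT_comp measurable_fst).
  apply: measurable_trap; first exact: (measurableT_comp measurable_snd).
  exact: (measurableT_comp measurable_holding).
apply: (measurableT_comp mv); apply: measurable_fun_pair.
  exact: (measurableT_comp measurable_fst).
apply: measurable_funB; first exact: (measurableT_comp measurable_snd).
exact: (measurableT_comp measurable_holding).
Qed.

(** The four properties are proved in one induction: [trap_concat] passes the bounds, the vanishing
    at nonpositive times and the Lipschitz constant through one sojourn only jointly, and
    measurability is what makes the next integral meaningful. *)
Lemma valueN_props n :
  [/\ measurable_fun setT (valueN n),
     forall z, 0 <= valueN n z <= 1,
     forall x t, t <= 0 -> valueN n (x, t) = 0 &
     forall x t t', `|valueN n (x, t) - valueN n (x, t')| <= `|t - t'| / h].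
Proof.
elim: n => [|n [mv v01 v0 vlip]].
  split=> //=; first by move=> _; rewrite lexx ler01.
  by move=> _ t t'; rewrite subrr normr0 divr_ge0// ltW.
have gP x p := @trap_concat R h (holding p) (\1_A x) (fun t => valueN n (p.1, t)) h0.
have {}gP x p : [/\ forall t, 0 <= g n (x, t) p <= 1,
    forall t, t <= 0 -> g n (x, t) p = 0 &
    forall t t', `|g n (x, t) p - g n (x, t') p| <= `|t - t'| / h].
  apply: gP => [|||t t0|t t']; [|by rewrite indicE; case: (_ \in _); rewrite ?lexx ?ler01|..] => //.
    by rewrite le_max lexx orbT.
  exact: v0.
have mgp z : measurable_fun setT (g n z).
  exact: (measurableT_comp (mg mv) (pair1_measurable z)).
have Ig z : (k z.1).-integrable setT (EFin \o g n z).
  apply: (@integrable_of_bounded _ _ _ (k z.1) (prob_kernel z.1) setT (g n z) 1) => //.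
  by case: z => x t p _; have [/(_ t)/andP[? ?] _ _] := gP x p; rewrite ger0_norm.
split => /=.
- rewrite [X in measurable_fun _ X](_ : _ = fine \o (fun z => \int[k z.1]_p (g n z p)%:E)%E)//.
  apply: measurableT_comp; first exact: fine_measurable.
  apply: (@measurable_integral_kfst _ _ _ k (fun zp => (g n zp.1 zp.2)%:E)).
    move=> [[x t] p]; rewrite lee_fin/=.
    by have [/(_ t)/andP[? ?] _ _] := gP x p.
  by apply/measurable_EFinP; exact: mg.
- move=> [x t]; apply/andP; split.
    by apply: Rintegral_ge0 => p _; have [/(_ t)/andP[? ?] _ _] := gP x p.
  apply: (le_RintegralT (prob_kernel x)); first exact: (Ig (x, t)).
  by move=> p; have [/(_ t)/andP[? ?] _ _] := gP x p.
- move=> x t t0; rewrite [LHS](_ : _ = \int[k x]_p 0).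
    by rewrite Rintegral_cst// mul0r.
  by apply: eq_Rintegral => p _; have [_ /(_ t t0) ? _] := gP x p.
- move=> x t t'; rewrite -RintegralB//; [|exact: (Ig (x, t))|exact: (Ig (x, t'))].
  apply: (normr_RintegralT (prob_kernel x)).
    apply: measurable_funB; [exact: (mgp (x, t))|exact: (mgp (x, t'))].
  by move=> p; have [_ _ /(_ t t')] := gP x p.
Qed.

Let mgz n z : measurable_fun setT (g n z).
Proof.
have [mv _ _ _] := valueN_props n.
exact: (measurableT_comp (mg mv) (pair1_measurable z)).
Qed.

Let g01 n z p : 0 <= g n z p <= 1.
Proof.
have [_ v01 v0 vlip] := valueN_props n; case: z => x t.
have := @trap_concat R h (holding p) (\1_A x) (fun t => valueN n (p.1, t)) h0.
case.
- by rewrite le_max lexx orbT.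
- by rewrite indicE; case: (_ \in _); rewrite ?lexx ?ler01.
- by [].
- by move=> t'; exact: v0.
- exact: vlip.
- by move=> /(_ t).
Qed.

Let Ig n z : (k z.1).-integrable setT (EFin \o g n z).
Proof.
apply: (@integrable_of_bounded _ _ _ (k z.1) (prob_kernel z.1) _ _ 1) => //.
by move=> p _; have /andP[? ?] := g01 n z p; rewrite ger0_norm.
Qed.

Lemma measurable_valueN_step n x t : measurable_fun setT (fun p : T * R =>
  \1_A x * trap h t (holding p) + valueN n (p.1, t - holding p)).
Proof. exact: (mgz n (x, t)). Qed.

Lemma valueNSE n x t : (valueN n.+1 (x, t))%:E =
  (\int[k x]_p (\1_A x * trap h t (holding p) + valueN n (p.1, t - holding p))%:E)%E.
Proof. by rewrite /= /Rintegral fineK// (integrable_fin_num _ (Ig n (x, t))). Qed.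

Lemma valueN_nd n z : valueN n z <= valueN n.+1 z.
Proof.
elim: n z => [|n IH] z.
  by have [_ /(_ z)/andP[]] := valueN_props 1.
by apply: le_Rintegral => //; [exact: (Ig n z)|exact: (Ig n.+1 z)|move=> p _; rewrite lerD2l].
Qed.

Definition value (z : T * R) : R := limn (valueN ^~ z).

Lemma cvg_valueN z : valueN n z @[n --> \oo] --> value z.
Proof.
apply: nondecreasing_is_cvgn; first by apply/nondecreasing_seqP => n; exact: valueN_nd.
by exists 1 => _ [n _ <-]; have [_ /(_ z)/andP[]] := valueN_props n.
Qed.

Arguments cvg_valueN : clear implicits.

Lemma valueN_le_value n z : valueN n z <= value z.
Proof.
apply: nondecreasing_cvgn_le; last by apply/cvg_ex; exists (value z); exact: cvg_valueN.
by apply/nondecreasing_seqP => m; exact: valueN_nd.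
Qed.

Lemma measurable_value : measurable_fun setT value.
Proof.
apply: (@measurable_fun_cvg _ _ _ _ valueN); last by move=> z _; exact: cvg_valueN.
by move=> n; have [] := valueN_props n.
Qed.

Lemma value_ge0 z : 0 <= value z.
Proof. by apply: le_trans (valueN_le_value 0 z). Qed.

Lemma value_le1 z : value z <= 1.
Proof.
apply: (cvgr_to_le (cvg_valueN z)); apply: nearW => n.
by have [_ /(_ z)/andP[]] := valueN_props n.
Qed.

Lemma value_lip x t t' : `|value (x, t) - value (x, t')| <= `|t - t'| / h.
Proof.
apply: (cvgr_to_le (cvg_norm (cvgB (cvg_valueN (x, t)) (cvg_valueN (x, t'))))).
apply: nearW => n.
by have [_ _ _] := valueN_props n; exact.
Qed.

Lemma measurable_value_shift t : measurable_fun setT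
  (fun p : T * R => value (p.1, t - holding p)).
Proof.
apply: (measurableT_comp measurable_value); apply: measurable_fun_pair => //.
by apply: measurable_funB => //; exact: measurable_holding.
Qed.

(** The integrals of the approximating integrands are the values [valueN n.+1], all below [value];
    they converge by dominated convergence, with the constant 1 as dominating function. *)
Lemma value_superharmonic x t :
  \int[k x]_p (\1_A x * trap h t (holding p) + value (p.1, t - holding p))
  <= value (x, t).
Proof.
pose f p := \1_A x * trap h t (holding p) + value (p.1, t - holding p).
have fcvg p : g n (x, t) p @[n --> \oo] --> f p.
  by apply: cvgD; [exact: cvg_cst|exact: cvg_valueN].
have mf : measurable_fun setT f.
  by apply: (@measurable_fun_cvg _ _ _ _ (fun n => g n (x, t))) => [n|p _]; [exact: mgz|exact: fcvg].
have cvE p : (EFin \o g n (x, t)) p @[n --> \oo] --> (f p)%:E.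
  by apply/cvg_EFin; [exact: nearW|exact: fcvg].
have [||If _ cvI] := @dominated_convergence _ _ _ (k x) setT measurableT
  (fun n => EFin \o g n (x, t)) (EFin \o f) (cst 1%E)
  (fun n => (measurable_EFinP _ _).2 (mgz n (x, t))) ((measurable_EFinP _ _).2 mf)
  (aeW _ (fun p _ => cvE p)).
- by apply: (@integrable_of_bounded _ _ _ (k x) (prob_kernel x) _ (cst 1) 1) => // p _ /=; rewrite normr1.
- by apply: aeW => p n _ /=; rewrite lee_fin; have /andP[? ?] := g01 n (x, t) p; rewrite ger0_norm.
have fI : (\int[k x]_p (f p)%:E)%E = (\int[k x]_p f p)%:E.
  by rewrite /Rintegral fineK// integrable_fin_num.
rewrite fI in cvI.
apply: (cvgr_to_le (fine_cvg cvI)); apply: nearW => n.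
exact: (valueN_le_value n.+1 (x, t)).
Qed.

End kernel_value.

(** * Comparison with the occupation probabilities *)

Section occupation_probability.
Context {d : measure_display} {R : realType} {T : measurableType d}
  (k : R.-pker T ~> (T * R)%type).

Lemma indic_section_integral (x : T) (D : set (T * R)) (c : R) : 0 <= c ->
  measurable D -> (\int[k x]_p (c * \1_D p)%:E)%E = (c%:E * k x D)%E.
Proof.
move=> c0 mD; rewrite -[D in RHS]setIT -integral_indic// -ge0_integralZl//.
by apply/measurable_EFinP; exact: measurable_indic.
Qed.

Lemma measurable_jump_after (t s : R) : measurable [set p : T * R | t < s + p.2].
Proof.
rewrite (_ : [set p | _] = snd @^-1` `]t - s, +oo[%classic).
  by rewrite -[X in measurable X]setTI; exact: measurable_snd.
by apply/seteqP; split => p /=; rewrite in_itv/= andbT ltrBlDl.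
Qed.

(** As an integral of a product of indicators, the base case falls under the joint measurability of
    kernel integrals. *)
Lemma G0E (t : R) (A : set T) (x : T) (s : R) :
  G k t A 0 x s = (\int[k x]_p
    (\1_A x * \1_(`]-oo, t]%classic) s * \1_(`]t, +oo[%classic) (s + p.2))%:E)%E.
Proof.
rewrite /= (eq_integral (fun p => (\1_A x * \1_(`]-oo, t]%classic : set R) s *
    \1_[set p : T * R | t < s + p.2] p)%:E)); last first.
  move=> p _; congr (_ * _)%:E; rewrite !indicE; congr (_%:R); congr nat_of_bool.
  by apply/idP/idP; rewrite !inE/= in_itv/= andbT.
rewrite indic_section_integral//; last exact: measurable_jump_after.
case: asboolP => [[Ax st]|nAt].
  by rewrite !indicE !mem_set ?mulr1 ?mul1e//= in_itv.
rewrite !indicE; case: (boolP (x \in A)) => [/set_mem Ax|_]; last by rewrite mul0r mul0e.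
case: (boolP (s \in _)) => [/set_mem /=|_]; last by rewrite mulr0 mul0e.
by rewrite in_itv/= => st; exfalso; exact: nAt.
Qed.

Lemma G_ge0 (t : R) (A : set T) n x s : (0 <= G k t A n x s)%E.
Proof.
elim: n x s => [x s|n IH x s /=]; last by apply: integral_ge0.
by rewrite /=; case: ifP => // _; exact: measure_ge0.
Qed.

Lemma measurable_G (t : R) (A : set T) n : measurable A ->
  measurable_fun setT (fun z : T * R => G k t A n z.1 z.2).
Proof.
move=> mA; elim: n => [|n IH].
  under eq_fun do rewrite G0E.
  apply: (@measurable_integral_kfst _ _ _ k (fun zp =>
    (\1_A zp.1.1 * \1_(`]-oo, t]%classic) zp.1.2 *
      \1_(`]t, +oo[%classic) (zp.1.2 + zp.2.2))%:E)).
    by move=> z; rewrite lee_fin !mulr_ge0.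
  apply/measurable_EFinP; apply: measurable_funM; first apply: measurable_funM.
  - apply: (@measurableT_comp _ _ _ _ _ _ (\1_A : T -> R)) => //.
    exact: (measurableT_comp measurable_fst).
  - apply: (@measurableT_comp _ _ _ _ _ _ (\1_(`]-oo, t]%classic) : R -> R)) => //.
    exact: (measurableT_comp measurable_snd).
  - apply: (@measurableT_comp _ _ _ _ _ _ (\1_(`]t, +oo[%classic) : R -> R)) => //.
    apply: measurable_funD; first exact: (measurableT_comp measurable_snd).
    exact: (measurableT_comp measurable_snd).
apply: (@measurable_integral_kfst _ _ _ k (fun zp =>
    G k t A n zp.2.1 (zp.1.2 + zp.2.2))).
  by move=> z; exact: G_ge0.
apply: (measurableT_comp (g := fun zp : (T * R) * (T * R) => (zp.2.1, zp.1.2 + zp.2.2)) IH).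
apply: measurable_fun_pair => /=.
  exact: (measurableT_comp measurable_fst).
apply: measurable_funD; first exact: (measurableT_comp measurable_snd).
exact: (measurableT_comp measurable_snd).
Qed.

Lemma measurable_G_step (t : R) (A : set T) n s : measurable A ->
  measurable_fun setT (fun p : T * R => G k t A n p.1 (s + p.2)).
Proof.
move=> mA.
apply: (measurableT_comp (g := fun p : T * R => (p.1, s + p.2)) (measurable_G t n mA)).
by apply: measurable_fun_pair => //; exact: measurable_funD.
Qed.

Lemma measurable_G0_step (t s c : R) : measurable_fun setT
  (fun p : T * R => (c * \1_(`]t, +oo[%classic) (s + p.2))%:E).
Proof.
apply/measurable_EFinP; apply: measurable_funM => //.
apply: (@measurableT_comp _ _ _ _ _ _ (\1_(`]t, +oo[%classic) : R -> R)) => //.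
exact: measurable_funD.
Qed.

Context (k_ge0 : forall x, k x [set p | p.2 < 0] = 0%E).

Lemma ae_holding x : {ae k x, forall p, holding p = p.2}.
Proof.
exists [set p | p.2 < 0]; split => //.
  rewrite (_ : [set p | _] = snd @^-1` `]-oo, 0[%classic).
    by rewrite -[X in measurable X]setTI; exact: measurable_snd.
  by apply/seteqP; split => p /=; rewrite in_itv.
move=> p /=; rewrite /holding; case: (ltP p.2 0) => // p0 []; exact/max_idPl.
Qed.

(** The elapsed clock [s] of [G] corresponds to the remaining time [t - s] of [valueN], and sojourn
    by sojourn the trapezoid lies below the indicator that [t] is covered. *)
Lemma value_le_G (h : R) (h0 : 0 < h) (A : set T) (mA : measurable A) n x t s :
  ((valueN k A h n (x, t - s))%:E <= \sum_(0 <= m < n) G k t A m x s)%E.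
Proof.
elim: n x s => [x s|n IH x s]; first by rewrite big_geq.
rewrite big_nat_recl// [G _ _ _ 0 _ _]G0E.
under eq_bigr do rewrite /=.
rewrite -ge0_integral_sum//; last 2 first.
- by move=> m; exact: measurable_G_step.
- by move=> m p _; exact: G_ge0.
have mS : measurable_fun setT (fun p : T * R => (\sum_(0 <= m < n) G k t A m p.1 (s + p.2))%E).
  by apply: emeasurable_sum => m; exact: measurable_G_step.
have S0 (p : T * R) : (0 <= \sum_(0 <= m < n) G k t A m p.1 (s + p.2))%E.
  by apply: sume_ge0 => m _; exact: G_ge0.
rewrite -ge0_integralD//; last exact: measurable_G0_step.
rewrite (valueNSE k mA h0); apply: ae_ge0_le_integral => //.
- move=> p _; rewrite lee_fin addr_ge0 ?mulr_ge0 ?trap_ge0//.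
  by have [_ /(_ (p.1, t - s - holding p))/andP[]] := valueN_props k mA h0 n.
- by apply/measurable_EFinP; exact: (measurable_valueN_step k mA h0).
- by move=> p _; rewrite adde_ge0 ?lee_fin ?mulr_ge0.
- by apply: emeasurable_funD => //; exact: measurable_G0_step.
apply: filterS (ae_holding x) => p hp _; rewrite EFinD leeD//.
  rewrite lee_fin -mulrA ler_wpM2l// hp; apply: (le_trans (trap_prob _ _ h0)).
  rewrite !indicE -natrM ler_nat; case: ltP => // ts; case: ltP => //= sp.
  rewrite !mem_set//= in_itv/=; lra.
by rewrite hp -(_ : t - (s + p.2) = t - s - p.2)//; ring.
Qed.

Lemma value_le_probX (h : R) (h0 : 0 < h) (A : set T) (mA : measurable A) x t :
  ((value k A h (x, t))%:E <= probX k x t A)%E.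
Proof.
have vle n : ((valueN k A h n (x, t))%:E <= probX k x t A)%E.
  rewrite -[t in leLHS]subr0; apply: (le_trans (value_le_G h0 mA n x t 0)).
  by apply: nneseries_lim_ge => m _ _; exact: G_ge0.
case: (probX k x t A) vle => [r| |] vle; last 2 first.
- exact: leey.
- by have := vle 0.
rewrite lee_fin; apply: (cvgr_to_le (@cvg_valueN _ _ _ k A mA h h0 (x, t))).
by apply: nearW => n; rewrite -lee_fin.
Qed.

Context (M : nat) (Sp : 'I_M -> set T) (mSp : forall i, measurable (Sp i))
  (disjSp : forall i j, i != j -> Sp i `&` Sp j = set0).

(** The indicator on the right strengthens the induction: after the first jump only arrivals no
    later than [t] contribute, and this event is complementary to the first sojourn covering [t],
    which counts for at most one class by disjointness. *)
Lemma sum_G_le1 (t : R) n x s :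
  (\sum_(i < M) \sum_(0 <= m < n) G k t (Sp i) m x s <= (s <= t)%R%:R%:E)%E.
Proof.
elim: n x s => [x s|n IH x s].
  by rewrite big1 ?lee_fin// => i _; rewrite big_geq.
have mS i : measurable_fun setT (fun p : T * R => (\sum_(0 <= m < n) G k t (Sp i) m p.1 (s + p.2))%E).
  by apply: emeasurable_sum => m; exact: measurable_G_step.
have S0 i (p : T * R) : (0 <= \sum_(0 <= m < n) G k t (Sp i) m p.1 (s + p.2))%E.
  by apply: sume_ge0 => m _; exact: G_ge0.
under eq_bigr => i _.
  rewrite big_nat_recl//=.
  rewrite -ge0_integral_sum//; last 2 first.
  - by move=> m; exact: measurable_G_step.
  - by move=> m p _; exact: G_ge0.
  over.
rewrite big_split/= -ge0_integral_sum//.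
pose D := [set p : T * R | s + p.2 <= t].
have DE : D = ~` [set p : T * R | t < s + p.2].
  apply/seteqP; split => p; rewrite /D/=; last by move/negP; rewrite -leNgt.
  by move=> st; rewrite ltNge st.
have mD : measurable D by rewrite DE; apply: measurableC; exact: measurable_jump_after.
have h1 : (\int[k x]_p (\sum_(i < M) \sum_(0 <= m < n) G k t (Sp i) m p.1 (s + p.2)%R) <=
    k x D)%E.
  rewrite -[leRHS]mul1e -indic_section_integral//.
  apply: ge0_le_integral => //.
  - by move=> p _; apply: sume_ge0 => i _; exact: S0.
  - by apply: emeasurable_sum => i.
  - apply/measurable_EFinP; apply: measurable_funM => //; exact: measurable_indic.
  - move=> p _; apply: (le_trans (IH p.1 (s + p.2))).
    by rewrite lee_fin mul1r indicE; case: (boolP (_ <= t)) => // st; rewrite mem_set.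
(* If the clock is already past [t], only a negative holding time could bring it back, and that has
   probability zero. *)
have [st|ts] := leP s t; last first.
  rewrite big1 ?add0e; last first.
    by move=> i _; case: asboolP => // -[].
  apply: (le_trans h1); apply: (@le_trans _ _ (k x [set p | p.2 < 0])); last by rewrite k_ge0.
  rewrite le_measure ?inE//.
    rewrite (_ : [set p | _] = snd @^-1` `]-oo, 0[%classic).
      by rewrite -[X in measurable X]setTI; exact: measurable_snd.
    by apply/seteqP; split => p /=; rewrite in_itv.
  by move=> p; rewrite /D/=; lra.
have h2 : ((\sum_(i < M)
       (if `[< Sp i x /\ true >] then k x [set p | (t < s + p.2)%R] else 0)) <= k x (~` D))%E.
  rewrite DE setCK.
  have [[i0 i0x]|ni] := pselect (exists i, Sp i x); last first.
    by rewrite big1// => i _; case: asboolP => // -[ix]; exfalso; apply: ni; exists i.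
  rewrite (bigD1 i0)//= big1 ?adde0; first by case: ifP.
  move=> i ii0; case: asboolP => // -[ix _].
  have : (Sp i `&` Sp i0) x by [].
  by rewrite disjSp.
apply: (le_trans (leeD h2 h1)).
rewrite -measureU//; [|exact: measurableC|by rewrite setICl].
exact: (le_prob1 (prob_kernel (s := k) x) (measurableU _ _ (measurableC mD) mD)).
Qed.

Lemma sum_probX_le1 (t : R) x : (\sum_(i < M) probX k x t (Sp i) <= 1)%E.
Proof.
rewrite /probX -nneseries_sum; last by move=> i n _; exact: G_ge0.
apply: lime_le; first by apply: is_cvg_nneseries => n _ _; apply: sume_ge0 => i _; exact: G_ge0.
apply: nearW => n; rewrite exchange_big/=; apply: (le_trans (sum_G_le1 t n x 0)).
by rewrite lee_fin; case: (0 <= t)%R.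
Qed.

End occupation_probability.

(** * The maximum principle *)

Section lyapunov.
Context {R : realType}.
Implicit Types c K s : R.

(** It jumps by [c / K] at 0 and then increases with slope [c / (s + K) ^+ 2]. This slope is
    integrable, so the function stays below [2 * c / K], yet it has the order at which a second
    moment bounds the chance of a step longer than [s + K]. *)
Definition lyap c K s : R := if 0 <= s then 2 * c / K - c / (s + K) else 0.

Lemma lyap_bounds c K s : 0 < c -> 0 < K -> 0 <= lyap c K s <= 2 * c / K.
Proof.
move=> c0 K0.
have cK : 0 < c / K by rewrite divr_gt0.
rewrite /lyap; case: ifPn => s0; last by rewrite lexx/=; rewrite -mulrA; lra.
have : 0 <= c / (s + K) by rewrite divr_ge0// ?ltW// ltr_wpDl.
have : c / (s + K) <= c / K.
  by rewrite ler_pM2l// lef_pV2 ?posrE ?ltr_wpDl// lerDr.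
by rewrite -mulrA; lra.
Qed.

Lemma lyap_ge c K s : 0 < c -> 0 < K -> 0 <= s -> c / K <= lyap c K s.
Proof.
move=> c0 K0 s0; rewrite /lyap s0.
have : c / (s + K) <= c / K.
  by rewrite ler_pM2l// lef_pV2 ?posrE ?ltr_wpDl// lerDr.
by rewrite -mulrA; lra.
Qed.

(** For steps that stay at nonnegative [s] the decrease is at least the slope times the step; for
    steps that cross 0 the jump [c / K] pays. In expectation the left side needs first and second
    moments only. *)
Lemma lyap_drift c K s (tau : R) : 0 < c -> 0 < K -> 0 <= s -> 0 <= tau ->
  (c * tau - (c / K + 1) * tau ^+ 2) / (s + K) ^+ 2
  <= lyap c K s - lyap c K (s - tau) - (s + K < tau)%R%:R.
Proof.
move=> c0 K0 s0 t0; have sK : 0 < s + K by rewrite ltr_wpDl.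
have sK2 : 0 < (s + K) ^+ 2 by rewrite exprn_gt0.
have cK : 0 < c / K by rewrite divr_gt0.
have [ts|st] := leP tau s.
  rewrite ltNge (le_trans ts) ?lerDl ?(ltW K0)//= subr0.
  rewrite /lyap s0 subr_ge0 ts.
  have stK : 0 < s - tau + K by lra.
  apply: le_trans (_ : c * tau / (s + K) ^+ 2 <= _).
    rewrite ler_pM2r ?invr_gt0// lerBlDr lerDl mulr_ge0 ?sqr_ge0//; lra.
  rewrite (_ : _ - _ = c * tau / ((s - tau + K) * (s + K))); last first.
    by field; rewrite !gt_eqF.
  rewrite ler_wpM2l ?mulr_ge0 ?(ltW c0)// lef_pV2 ?posrE ?mulr_gt0//.
  by rewrite expr2 ler_pM2r//; lra.
have h1 := lyap_ge c0 K0 s0.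
rewrite (_ : lyap c K (s - tau) = 0); last by rewrite /lyap subr_ge0 leNgt st.
(* Completing the square; together with [s + K >= K] it bounds the drift of a crossing step by the
   jump [c / K]. *)
have h2 : c * tau - c / K * tau ^+ 2 <= c * K.
  have : 0 <= c / K * ((tau - K / 2) ^+ 2 + 3 / 4 * K ^+ 2).
    by rewrite mulr_ge0 ?(ltW cK)// addr_ge0 ?sqr_ge0// mulr_ge0 ?sqr_ge0.
  rewrite (_ : c / K * _ = c * K - (c * tau - c / K * tau ^+ 2)); first lra.
  by field; rewrite gt_eqF.
have h3 : (c * tau - c / K * tau ^+ 2) / (s + K) ^+ 2 <= c / K.
  rewrite ler_pdivrMr//; apply: (le_trans h2).
  apply: le_trans (_ : c / K * K ^+ 2 <= _).
    by rewrite (_ : c / K * _ = c * K)//; field; rewrite gt_eqF.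
  by rewrite ler_pM2l// ler_pXn2r ?nnegrE ?(ltW K0) ?(ltW sK)//; lra.
(* The pointwise form of Chebyshev's inequality accounts for the [1] in the factor [c / K + 1]. *)
have h4 : (s + K < tau)%R%:R <= tau ^+ 2 / (s + K) ^+ 2.
  case: ltP => h5; last by rewrite divr_ge0 ?sqr_ge0.
  rewrite ler_pdivlMr// mul1r ler_pXn2r ?nnegrE ?(ltW sK)//; exact: ltW.
rewrite (_ : (c * tau - (c / K + 1) * tau ^+ 2) / _ =
  (c * tau - c / K * tau ^+ 2) / (s + K) ^+ 2 - tau ^+ 2 / (s + K) ^+ 2); last ring.
lra.
Qed.

End lyapunov.

Section maximum_principle.
Context {d : measure_display} {R : realType} {T : measurableType d}
  (k : R.-pker T ~> (T * R)%type) (A : set T) (mA : measurable A)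
  (h : R) (h0 : 0 < h).

Lemma holding_ge0 (p : T * R) : 0 <= holding p.
Proof. by rewrite le_max lexx orbT. Qed.

Lemma integrable_value_shift x t :
  (k x).-integrable setT (EFin \o (fun p => value k A h (p.1, t - holding p))).
Proof.
apply: (@integrable_of_bounded _ _ _ (k x) (prob_kernel (s := k) x) _ _ 1) => //.
  exact: measurable_value_shift.
by move=> p _; rewrite ger0_norm ?value_ge0 ?value_le1.
Qed.

Lemma value_superharmonic0 x t :
  \int[k x]_p value k A h (p.1, t - holding p) <= value k A h (x, t).
Proof.
apply: le_trans (value_superharmonic k mA h0 x t); apply: le_Rintegral => //.
- exact: integrable_value_shift.
- apply: integrable_addr => //; last exact: integrable_value_shift.
  apply: (@integrable_of_bounded _ _ _ (k x) (prob_kernel (s := k) x) _ _ 1) => //.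
    apply: measurable_funM => //; apply: measurable_trap => //; exact: measurable_holding.
  move=> p _; rewrite ger0_norm ?mulr_ge0 ?trap_ge0// -[leRHS]mulr1.
  by rewrite ler_pM ?trap_ge0 ?trap_le1// indicE; case: (_ \in _).
- by move=> p _; rewrite lerDr mulr_ge0 ?trap_ge0.
Qed.

(* Away from the window [T0, T0 + K] the defect b - value - lyap would strictly decrease its own supremum, because the Lyapunov drift dominates the probability of jumping over the window. *)
Lemma maximum_principle (c K kap b T0 : R) : 0 < c -> 0 < K -> 0 < kap ->
  b <= 1 ->
  (forall x, (k x).-integrable setT (EFin \o @holding R T)) ->
  (forall x, (k x).-integrable setT (EFin \o (fun p => holding p ^+ 2))) ->
  (forall x, kap <= c * \int[k x]_p holding p - (c / K + 1) * \int[k x]_p (holding p ^+ 2)) ->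
  (forall x t, T0 <= t <= T0 + K -> b <= value k A h (x, t)) ->
  forall x t, T0 + K <= t -> b - 2 * c / K <= value k A h (x, t).
Proof.
move=> c0 K0 kap0 b1 I1 I2 mom bwin x0 tm T1tm.
set T1 := T0 + K in T1tm *.
pose D x s := b - value k A h (x, s) - lyap c K (s - T1).
pose S := [set D z.1 z.2 | z in [set z : T * R | T1 <= z.2 <= tm]].
have DS x s : T1 <= s <= tm -> S (D x s) by move=> sT; exists (x, s).
have S0 : S !=set0 by exists (D x0 tm); apply: DS; rewrite T1tm lexx.
have ubS : has_ubound S.
  exists 1 => _ [[x s] _ <-]; rewrite /D/=.
  have /andP[? _] := lyap_bounds (s - T1) c0 K0.
  by have := value_ge0 k mA h0 (x, s); lra.
have /andP[_ lK] := lyap_bounds (tm - T1) c0 K0.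
have [D0|D0] := leP (sup S) 0.
  have : D x0 tm <= 0.
    by apply: (le_trans _ D0); apply: ub_le_sup => //; apply: DS; rewrite T1tm lexx.
  rewrite /D; lra.
exfalso.
(* The drift decays with time, so times are confined to [[T1, tm]], where its value at the last time
   is a uniform gain. *)
pose kap1 := kap / (tm - T1 + K) ^+ 2.
have tmK : 0 < (tm - T1 + K) ^+ 2 by rewrite exprn_gt0//; lra.
have kap10 : 0 < kap1 by rewrite divr_gt0.
suff : sup S <= sup S - kap1 by lra.
apply: ge_sup => // _ [[x s] /= /andP[T1s stm] <-].
have s'0 : 0 <= s - T1 by rewrite subr_ge0.
pose q (p : T * R) := (c * holding p - (c / K + 1) * holding p ^+ 2) / (s - T1 + K) ^+ 2.
have sK2 : 0 < (s - T1 + K) ^+ 2 by rewrite exprn_gt0//; lra.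
have Iq0 : (k x).-integrable setT (EFin \o (fun p : T * R => c * holding p - (c / K + 1) * holding p ^+ 2)).
  by apply: integrable_subr => //; exact: integrable_mulrl.
have Iq : (k x).-integrable setT (EFin \o q).
  rewrite (_ : q = (fun p => (s - T1 + K) ^- 2 *
    (c * holding p - (c / K + 1) * holding p ^+ 2))); last by apply/funext => p; rewrite /q mulrC.
  exact: integrable_mulrl.
(* Going back by the holding time lands in [[T1, s]], where the defect is at most [sup S]; or in the
   window, where the defect has no positive part; or before [T0], where the step exceeds
   [s - T1 + K] and the unit paid by the indicator covers [b <= 1]. *)
have vq p : b - sup S - lyap c K (s - T1) + q p <= value k A h (p.1, s - holding p).
  have := lyap_drift c0 K0 s'0 (holding_ge0 p); rewrite -/(q p).
  have v0 := value_ge0 k mA h0 (p.1, s - holding p).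
  have /andP[l0 _] := lyap_bounds (s - T1 - holding p) c0 K0.
  have hp := holding_ge0 p.
  have [sT1|sT1] := leP T1 (s - holding p).
    have : D p.1 (s - holding p) <= sup S.
      by apply: ub_le_sup => //; apply: DS; rewrite sT1/=; lra.
    rewrite /D (_ : s - holding p - T1 = s - T1 - holding p); last ring.
    by case: ltP => _ /=; lra.
  have [sT0|sT0] := leP T0 (s - holding p).
    have /bwin := ltac:(rewrite sT0 ltW//; exact: sT1) : T0 <= s - holding p <= T0 + K.
    by move=> /(_ p.1); case: ltP => _ /=; lra.
  rewrite (_ : (_ < _) = true)/=; first lra.
  by rewrite /T1; lra.
have : b - sup S - lyap c K (s - T1) + kap1 <= value k A h (x, s).
  apply: le_trans (value_superharmonic0 x s).
  apply: le_trans (_ : \int[k x]_p (b - sup S - lyap c K (s - T1) + q p) <= _); last first.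
    apply: le_Rintegral => //; last exact: integrable_value_shift.
    by apply: integrable_addr => //; exact: (integrable_cstr (prob_kernel (s := k) x)).
  rewrite RintegralD//; last exact: (integrable_cstr (prob_kernel (s := k) x)).
  rewrite Rintegral_cst// (fine_prob_setT (prob_kernel (s := k) x)) mulr1 lerD2l.
  rewrite /q RintegralZr//.
  rewrite RintegralB//; last 2 first.
    exact: integrable_mulrl.
    exact: integrable_mulrl.
  rewrite !RintegralZl// /kap1.
  apply: le_trans (_ : kap / (s - T1 + K) ^+ 2 <= _).
    rewrite ler_pM2l// lef_pV2 ?posrE// ler_pXn2r ?nnegrE//; lra.
  by rewrite ler_pM2r ?invr_gt0.
rewrite /D; lra.
Qed.

End maximum_principle.

(** * Conservation of the stationary flow *)

Section riemann_sums.
Context {R : realType}.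
Implicit Types (t del tau h : R) (N : nat).

(** The trapezoid has a plateau of length [tau - 2 * h]; when [tau <= t] the grid going back from
    [t] meets it in about [(tau - 2 * h) / del] points. A sojourn longer than [t] is paid by
    [tau ^+ 2 / t], which is then at least [tau]. *)
Lemma riemann_trap_ge t del tau h N : 0 < h -> 0 < del -> 0 < t -> 0 <= tau ->
  t <= del * N%:R ->
  tau - 2 * h - 2 * del - tau ^+ 2 / t <= del * \sum_(l < N) trap h (t - l%:R * del) tau.
Proof.
move=> h0 del0 t0 tau0 tN.
have S0 : 0 <= del * \sum_(l < N) trap h (t - l%:R * del) tau.
  by rewrite mulr_ge0 ?(ltW del0)// sumr_ge0// => l _; exact: trap_ge0.
have tau2 : 0 <= tau ^+ 2 / t by rewrite divr_ge0 ?sqr_ge0 ?(ltW t0).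
have [taut|ttau] := leP tau t; last first.
  have : tau <= tau ^+ 2 / t.
    by rewrite ler_pdivlMr// expr2 ler_wpM2l// ltW.
  lra.
have [small|big] := leP (tau - 2 * h) 0; first lra.
(* The grid point of index [p] is the first one chosen below the upper end [tau - h] of the plateau,
   and [q] successive points stay above its lower end [h]. *)
pose p := (Num.truncn ((t - tau + h) / del)).+1.
pose q := Num.truncn ((tau - 2 * h) / del).
have hp1 : (t - tau + h) / del < p%:R by exact: truncnS_gt.
have hp2 : p%:R <= (t - tau + h) / del + 1.
  rewrite /p -natr1 lerD2r truncn_le// divr_ge0 ?(ltW del0)//; lra.
have hq1 : q%:R <= (tau - 2 * h) / del.
  by rewrite truncn_le// divr_ge0 ?(ltW del0) ?(ltW big).
have hq2 : (tau - 2 * h) / del < q%:R + 1 by rewrite natr1; exact: truncnS_gt.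
have {}hp1 : t - tau + h < p%:R * del by rewrite -ltr_pdivrMr.
have {}hp2 : p%:R * del <= t - tau + h + del.
  by rewrite -ler_pdivlMr// mulrDl mulfV ?gt_eqF.
have {}hq1 : q%:R * del <= tau - 2 * h by rewrite -ler_pdivlMr.
have {}hq2 : tau - 2 * h < q%:R * del + del.
  by have := hq2; rewrite ltr_pdivrMr//; lra.
have pqN : (p + q <= N)%N.
  rewrite -ltnS -(ltr_nat R) -(ltr_pM2r del0) -natr1 natrD !mulrDl mul1r.
  by rewrite [N%:R * _]mulrC; lra.
apply: (@le_trans _ _ (del * q%:R)); first by rewrite mulrC; lra.
rewrite ler_pM2l// -(big_mkord xpredT (fun l => trap h (t - l%:R * del) tau)).
rewrite (big_cat_nat (n := p))//=; last by rewrite (leq_trans _ pqN)// leq_addr.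
rewrite (big_cat_nat (n := (p + q)%N) (m := p))//=; last exact: leq_addr.
rewrite [X in _ <= _ + (X + _)](_ : _ = q%:R).
  by rewrite addrCA lerDl addr_ge0// sumr_ge0// => l _; exact: trap_ge0.
rewrite (eq_big_nat _ _ (F2 := fun=> 1)).
  by rewrite big_const_nat iter_addr_0 addKn.
move=> l /andP[pl lpq]; apply: trap_eq1 => //.
  have : l.+1%:R * del <= (p + q)%:R * del by rewrite ler_pM2r// ler_nat.
  by rewrite -natr1 natrD !mulrDl mul1r; lra.
have : p%:R * del <= l%:R * del by rewrite ler_pM2r// ler_nat.
lra.
Qed.

Lemma telescope_shift (a : nat -> R) N q : (forall l, 0 <= a l) ->
  \sum_(l < N) (a l - a (l + q)%N) <= \sum_(l < q) a l.
Proof.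
move=> a0; rewrite sumrB lerBlDr.
have -> : \sum_(l < q) a l + \sum_(l < N) a (l + q)%N = \sum_(l < q + N) a l.
  by rewrite big_split_ord/=; congr (_ + _); apply: eq_bigr => l _; rewrite addnC.
by rewrite addnC big_split_ord/= lerDl sumr_ge0.
Qed.

(** Rounding the shift [tau] to [q] grid steps costs [L * del] per term, and the rounded sum
    telescopes to its first [q] terms. They lie in the window if [tau <= W]; otherwise [f <= 1]
    suffices, since then [tau <= tau ^+ 2 / W]. *)
Lemma riemann_shift_le (f : R -> R) t del tau N (L beta W : R) :
  0 < del -> 0 <= tau -> 0 < W -> 0 <= L -> 0 <= beta ->
  (forall s, 0 <= f s <= 1) -> (forall s s', `|f s - f s'| <= L * `|s - s'|) ->
  (forall s, t - W <= s <= t -> f s <= beta) ->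
  del * \sum_(l < N) (f (t - l%:R * del) - f (t - l%:R * del - tau))
  <= beta * tau + tau ^+ 2 / W + L * del * (del * N%:R).
Proof.
move=> del0 tau0 W0 L0 b0 f01 fL fb.
pose q := Num.truncn (tau / del).
have hq1 : q%:R <= tau / del by rewrite truncn_le// divr_ge0 ?(ltW del0).
have hq2 : tau / del < q%:R + 1 by rewrite natr1; exact: truncnS_gt.
have {}hq1 : q%:R * del <= tau by rewrite -ler_pdivlMr.
have {}hq2 : tau < q%:R * del + del.
  by have := hq2; rewrite ltr_pdivrMr//; lra.
pose a l := f (t - l%:R * del).
apply: (@le_trans _ _ (del * \sum_(l < N) (a l - a (l + q)%N + L * del))).
  rewrite ler_pM2l//; apply: ler_sum => l _.
  have : `|a (l + q)%N - f (t - l%:R * del - tau)| <= L * del.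
    apply: (le_trans (fL _ _)); rewrite ler_wpM2l// natrD ler_norml.
    by apply/andP; split; lra.
  rewrite ler_norml => /andP[_]; rewrite /a; lra.
rewrite big_split/= mulrDr lerD//; last first.
  by rewrite sumr_const card_ord -mulr_natr; lra.
apply: (@le_trans _ _ (del * \sum_(l < q) a l)).
  by rewrite ler_pM2l//; apply: telescope_shift => l; case/andP: (f01 (t - l%:R * del)).
have t2 : 0 <= tau ^+ 2 / W by rewrite divr_ge0 ?sqr_ge0 ?(ltW W0).
have [tW|Wt] := leP tau W.
  apply: (@le_trans _ _ (del * \sum_(l < q) beta)).
    rewrite ler_pM2l//; apply: ler_sum => l _; apply: fb.
    have : l%:R * del <= q%:R * del by rewrite ler_pM2r// ler_nat ltnW.
    have : 0 <= l%:R * del by rewrite mulr_ge0 ?(ltW del0).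
    by move=> ? ?; apply/andP; split; lra.
  rewrite sumr_const card_ord -mulr_natr mulrCA.
  have : beta * (del * q%:R) <= beta * tau by rewrite ler_wpM2l// mulrC.
  lra.
apply: (@le_trans _ _ (del * \sum_(l < q) 1)).
  by rewrite ler_pM2l//; apply: ler_sum => l _; case/andP: (f01 (t - l%:R * del)).
rewrite sumr_const card_ord.
have : tau <= tau ^+ 2 / W by rewrite ler_pdivlMr// expr2 ler_wpM2l// ltW.
have : 0 <= beta * tau by rewrite mulr_ge0.
rewrite mulrC; lra.
Qed.

End riemann_sums.

Lemma lipschitz_measurable {R : realType} (f : R -> R) (L : R) :
  (forall s s', `|f s - f s'| <= L * `|s - s'|) -> measurable_fun setT f.
Proof.
move=> fL; apply: continuous_measurable_fun => x.
apply/(@cvgrPdist_lt _ R^o) => e e0.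
exists (e / (`|L| + 1)); first by rewrite /= divr_gt0// ltr_wpDl.
move=> y /= xy; apply: (le_lt_trans (fL _ _)).
apply: (@le_lt_trans _ _ ((`|L| + 1) * `|x - y|)).
  by rewrite ler_wpM2r//; have := ler_norm L; lra.
by rewrite mulrC -ltr_pdivlMr// ltr_wpDl.
Qed.

Section conservation.
Context {d : measure_display} {Om : measurableType d} {R : realType}
  (th : Om -> R) (mth : measurable_fun setT th) (th0 : forall o, 0 <= th o)
  (M : nat) (nu : 'I_M -> {measure set Om -> \bar R}) (nu1 : forall j, nu j setT = 1%E)
  (Ith : forall j, (nu j).-integrable setT (EFin \o th))
  (Ith2 : forall j, (nu j).-integrable setT (EFin \o (fun o => th o ^+ 2)))
  (P0 : 'I_M -> 'I_M -> R) (P0ge0 : forall i j, 0 <= P0 i j)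
  (P0sum : forall i, \sum_j P0 i j = 1)
  (lam : 'I_M -> R) (lam0 : forall j, 0 <= lam j) (lam1 : \sum_j lam j = 1)
  (lamP : forall j, lam j = \sum_i lam i * P0 i j)
  (m : 'I_M -> R -> R) (L : R) (L0 : 0 < L)
  (m01 : forall j s, 0 <= m j s <= 1)
  (mL : forall j s s', `|m j s - m j s'| <= L * `|s - s'|)
  (h : R) (h0 : 0 < h) (i : 'I_M) (eta : R).

Lemma measurable_shift (f : R -> R) (s : R) :
  (forall s s', `|f s - f s'| <= L * `|s - s'|) ->
  measurable_fun setT (fun o => f (s - th o)).
Proof.
move=> fL; apply: (measurableT_comp (lipschitz_measurable fL)).
exact: measurable_funB.
Qed.

Lemma integrable_shift j k s : (nu j).-integrable setT (EFin \o (fun o => m k (s - th o))).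
Proof.
apply: (@integrable_of_bounded _ _ _ _ (nu1 j) _ _ 1) => //; first exact: measurable_shift.
by move=> o _; case/andP: (m01 k (s - th o)) => ? ?; rewrite ger0_norm.
Qed.

Lemma integrable_trap j s : (nu j).-integrable setT (EFin \o (fun o => trap h s (th o))).
Proof.
apply: (@integrable_of_bounded _ _ _ _ (nu1 j) _ _ 1) => //; first exact: measurable_trap.
by move=> o _; rewrite ger0_norm ?trap_ge0 ?trap_le1.
Qed.

(* Summing the superharmonicity inequality over the stationary weights and over the grid t - l del telescopes: only the window [t - W, t] survives on the right. *)
Lemma conservation (t del beta W : R) N :
  (forall j s, (j == i)%:R * \int[nu i]_o trap h s (th o) +
     \sum_k P0 j k * \int[nu j]_o m k (s - th o) - eta <= m j s) ->
  0 < del -> 0 < t -> 0 < W -> 0 <= beta -> t <= del * N%:R ->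
  (forall k s, t - W <= s <= t -> m k s <= beta) ->
  lam i * (\int[nu i]_o th o - 2 * h - 2 * del - (\int[nu i]_o (th o ^+ 2)) / t)
    - eta * (del * N%:R)
  <= beta * (\sum_j lam j * \int[nu j]_o th o)
     + (\sum_j lam j * \int[nu j]_o (th o ^+ 2)) / W + L * del * (del * N%:R).
Proof.
move=> super del0 t0 W0 b0 tN mb.
pose E j (f : Om -> R) := \int[nu j]_o f o.
have step s : lam i * E i (fun o => trap h s (th o)) <= eta +
    \sum_j \sum_k lam j * P0 j k * E j (fun o => m k s - m k (s - th o)).
  have : \sum_j lam j * ((j == i)%:R * \int[nu i]_o trap h s (th o) +
       \sum_k P0 j k * \int[nu j]_o m k (s - th o) - eta) <= \sum_j lam j * m j s.
    by apply: ler_sum => j _; rewrite ler_wpM2l.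
  (* Invariance of [lam] puts both sides over the common weights [lam j * P0 j k], so that only time
     increments of each [m k] remain. *)
  have -> : \sum_j lam j * m j s = \sum_j \sum_k lam j * P0 j k * m k s.
    rewrite exchange_big/=; apply: eq_bigr => k _.
    by rewrite {1}lamP mulr_suml.
  have -> : \sum_j \sum_k lam j * P0 j k * E j (fun o => m k s - m k (s - th o)) =
     \sum_j \sum_k lam j * P0 j k * m k s -
     \sum_j \sum_k lam j * P0 j k * E j (fun o => m k (s - th o)).
    rewrite -sumrB; apply: eq_bigr => j _; rewrite -sumrB; apply: eq_bigr => k _.
    rewrite /E RintegralB//; last 2 first.
      exact: integrable_cstr (nu1 j) _.
      exact: integrable_shift.
    by rewrite Rintegral_cst// (fine_prob_setT (nu1 j)) mulr1 mulrBr.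
  have -> : \sum_j lam j * ((j == i)%:R * \int[nu i]_o trap h s (th o) +
       \sum_k P0 j k * \int[nu j]_o m k (s - th o) - eta) =
     lam i * E i (fun o => trap h s (th o)) +
     \sum_j \sum_k lam j * P0 j k * E j (fun o => m k (s - th o)) - eta.
    have etaE : eta = \sum_j lam j * eta by rewrite -mulr_suml lam1 mul1r.
    rewrite [X in _ = _ - X]etaE.
    have -> : lam i * E i (fun o => trap h s (th o)) =
        \sum_j lam j * ((j == i)%:R * \int[nu i]_o trap h s (th o)).
      rewrite (bigD1 i)//= eqxx mul1r big1 ?addr0// => j /negbTE->.
      by rewrite mul0r mulr0.
    rewrite -big_split/= -sumrB; apply: eq_bigr => j _; rewrite mulrBr mulrDr.
    by congr (_ + _ - _); rewrite mulr_sumr; apply: eq_bigr => k _; rewrite mulrA.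
  lra.
pose sl (l : 'I_N) : R := t - l%:R * del.
have lhs : lam i * (E i th - 2 * h - 2 * del - E i (fun o => th o ^+ 2) / t) <=
    del * \sum_(l < N) lam i * E i (fun o => trap h (sl l) (th o)).
  rewrite -mulr_sumr mulrCA ler_wpM2l//.
  rewrite /E -(Rintegral_sum (nu1 i)); last by move=> l; exact: integrable_trap.
  rewrite -RintegralZl//; last by apply: (integrable_sumr (nu1 i)) => l; exact: integrable_trap.
  have I1 : (nu i).-integrable setT (EFin \o (fun o => th o - (2 * h + 2 * del))).
    by apply: integrable_subr => //; exact: integrable_cstr (nu1 i) _.
  have I2 : (nu i).-integrable setT (EFin \o (fun o => t^-1 * th o ^+ 2)).
    exact: integrable_mulrl.
  have -> : \int[nu i]_o th o - 2 * h - 2 * del - \int[nu i]_o (th o ^+ 2) / t =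
     \int[nu i]_o (th o - (2 * h + 2 * del) - t^-1 * th o ^+ 2).
    rewrite RintegralB// RintegralB//; last exact: integrable_cstr (nu1 i) _.
    rewrite RintegralZl// Rintegral_cst// (fine_prob_setT (nu1 i)); ring.
  apply: le_Rintegral => //.
  - exact: integrable_subr.
  - apply: integrable_mulrl => //; apply: (integrable_sumr (nu1 i)) => l; exact: integrable_trap.
  - move=> o _; apply: le_trans (riemann_trap_ge h0 del0 t0 (th0 o) tN).
    by rewrite [t^-1 * _]mulrC; lra.
have rhs : del * \sum_(l < N) \sum_j \sum_k lam j * P0 j k *
      E j (fun o => m k (sl l) - m k (sl l - th o)) <=
    beta * (\sum_j lam j * E j th) + (\sum_j lam j * E j (fun o => th o ^+ 2)) / W
     + L * del * (del * N%:R).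
  pose B j := beta * E j th + E j (fun o => th o ^+ 2) / W + L * del * (del * N%:R).
  have -> : beta * (\sum_j lam j * E j th) + (\sum_j lam j * E j (fun o => th o ^+ 2)) / W
     + L * del * (del * N%:R) = \sum_j \sum_k lam j * P0 j k * B j.
    transitivity (\sum_j lam j * B j); last first.
      apply: eq_bigr => j _; rewrite -[LHS]mul1r -(P0sum j) mulr_suml.
      by apply: eq_bigr => k _; ring.
    have cE (c : R) : c = \sum_j lam j * c by rewrite -mulr_suml lam1 mul1r.
    rewrite [X in _ + X]cE mulr_sumr mulr_suml -!big_split/=.
    by apply: eq_bigr => j _; rewrite /B; ring.
  rewrite exchange_big/= mulr_sumr; apply: ler_sum => j _.
  rewrite exchange_big/= mulr_sumr; apply: ler_sum => k _.
  have If l : (nu j).-integrable setT (EFin \o (fun o => m k (sl l) - m k (sl l - th o))).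
    apply: integrable_subr => //; first exact: integrable_cstr (nu1 j) _.
    exact: integrable_shift.
  rewrite -mulr_sumr mulrCA ler_wpM2l ?mulr_ge0//.
  rewrite /E -(Rintegral_sum (nu1 j))// -RintegralZl//; last exact: (integrable_sumr (nu1 j)).
  have -> : B j = \int[nu j]_o (beta * th o + W^-1 * th o ^+ 2 + L * del * (del * N%:R)).
    have I1 := integrable_mulrl beta measurableT (Ith j).
    have I2 := integrable_mulrl W^-1 measurableT (Ith2 j).
    rewrite RintegralD//; [|exact: integrable_addr|exact: integrable_cstr (nu1 j) _].
    rewrite [X in _ + X]Rintegral_cst// (fine_prob_setT (nu1 j)) RintegralD// !RintegralZl//.
    rewrite /B /E; ring.
  apply: le_Rintegral => //.
  - by apply: integrable_mulrl => //; exact: (integrable_sumr (nu1 j)).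
  - apply: integrable_addr => //; last exact: integrable_cstr (nu1 j) _.
    by apply: integrable_addr => //; exact: integrable_mulrl.
  - move=> o _; rewrite [W^-1 * _]mulrC.
    exact: (riemann_shift_le N del0 (th0 o) W0 (ltW L0) b0 (m01 k) (mL k) (mb k)).
have all : \sum_(l < N) lam i * E i (fun o => trap h (sl l) (th o)) <=
    \sum_(l < N) (eta + \sum_j \sum_k lam j * P0 j k * E j (fun o => m k (sl l) - m k (sl l - th o))).
  by apply: ler_sum => l _; exact: step.
have {all} := ler_wpM2l (ltW del0) all.
rewrite big_split/= mulrDr sumr_const card_ord -[eta *+ N]mulr_natr => all.
have := le_trans lhs all; rewrite -/(E i th) /E in rhs *; lra.
Qed.

End conservation.

(** * The limit argument along an ultrafilter *)

(** Sums of [n] terms equal to [a] or [a'] divide the interval from [n * a] to [n * a'] with spacing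
    [a' - a], and for large [n] consecutive intervals overlap. *)
Lemma semigroup_dense {R : realType} (a a' : R) : 0 <= a -> a < a' ->
  exists Y : R, forall y, Y <= y ->
    exists p q : nat, y - (a' - a) <= p%:R * a + q%:R * a' <= y.
Proof.
move=> a0 aa'; have a'0 : 0 < a' by exact: le_lt_trans aa'.
pose gap := a' - a; have gap0 : 0 < gap by rewrite subr_gt0.
(* From [n0] terms on, the interval is longer than [a'], so the interval of [N + 1] terms reaches
   down below [N * a'], hence below [y]. *)
pose n0 := (Num.truncn (a' / gap)).+1.
have n0P : a' < n0%:R * gap by rewrite -ltr_pdivrMr// truncnS_gt.
exists (n0%:R * a') => y Yy.
have y0 : 0 <= y by rewrite (le_trans _ Yy)// mulr_ge0// ltW.
pose N := Num.truncn (y / a').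
have N1 : N%:R * a' <= y by rewrite -ler_pdivlMr// truncn_le// divr_ge0// ltW.
have N2 : y < N.+1%:R * a' by rewrite -ltr_pdivrMr// truncnS_gt.
have n0N : (n0 <= N.+1)%N.
  rewrite -(ler_nat R) -(ler_pM2r a'0); exact: (le_trans Yy (ltW N2)).
have Ka : N.+1%:R * a <= y.
  have : n0%:R * gap <= N.+1%:R * gap by rewrite ler_pM2r// ler_nat.
  have : N.+1%:R * a = N.+1%:R * a' - N.+1%:R * gap by rewrite /gap; ring.
  have : N.+1%:R * a' = N%:R * a' + a' by rewrite -natr1; ring.
  lra.
pose q := Num.truncn ((y - N.+1%:R * a) / gap).
have q1 : q%:R * gap <= y - N.+1%:R * a.
  by rewrite -ler_pdivlMr// truncn_le// divr_ge0 ?subr_ge0// ltW.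
have q2 : y - N.+1%:R * a < q.+1%:R * gap by rewrite -ltr_pdivrMr// truncnS_gt.
have qN : (q <= N.+1)%N.
  rewrite -(ler_nat R) -(ler_pM2r gap0).
  have : N.+1%:R * a = N.+1%:R * a' - N.+1%:R * gap by rewrite /gap; ring.
  lra.
exists (N.+1 - q)%N, q; rewrite natrB//.
have -> : (N.+1%:R - q%:R) * a + q%:R * a' = N.+1%:R * a + q%:R * gap by rewrite /gap; ring.
rewrite -/gap; move: q2; rewrite -natr1 mulrDl mul1r; lra.
Qed.

Section finite_subadditivity.
Context {d : measure_display} {T : measurableType d} {R : realType}
  (P : {measure set T -> \bar R}) (P1 : P setT = 1%E).

Lemma fine_prob_le (A B : set T) : measurable A -> measurable B -> A `<=` B ->
  fine (P A) <= fine (P B).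
Proof.
by move=> mA mB AB; apply: fine_le; rewrite ?fin_num_prob// le_measure ?inE.
Qed.

Lemma fine_prob_subU (A B C : set T) : measurable A -> measurable B -> measurable C ->
  A `<=` B `|` C -> fine (P A) <= fine (P B) + fine (P C).
Proof.
move=> mA mB mC ABC; rewrite -fineD ?fin_num_prob//; apply: fine_le.
- by rewrite fin_num_prob.
- by rewrite fin_numD !fin_num_prob.
- apply: (@le_trans _ _ (P (B `|` C))); last exact: measureU2.
  by rewrite le_measure ?inE//; exact: measurableU.
Qed.

End finite_subadditivity.

Lemma touching_contradiction {R : realType} (b mm sm tr i1 i2 kx ke eta : R) :
  mm <= b + eta -> i1 <= eta -> i2 <= i1 -> tr + sm - i2 <= mm ->
  b - eta - eta + kx <= sm -> 0 <= tr -> 4 * eta + ke <= kx -> 0 < ke -> False.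
Proof. lra. Qed.

(** * Propagation of near-minimality to a whole window *)

Section limit_argument.
Context {d : measure_display} {Om : measurableType d} {R : realType}
  (th : Om -> R) (mth : measurable_fun setT th) (th0 : forall o, 0 <= th o)
  (M : nat) (mu : nat -> 'I_M -> {measure set Om -> \bar R})
  (mu1 : forall n j, mu n j setT = 1%E)
  (Ith : forall n j, (mu n j).-integrable setT (EFin \o th))
  (Ith2 : forall n j, (mu n j).-integrable setT (EFin \o (fun o => th o ^+ 2)))
  (C2 : R) (C2P : forall n j, \int[mu n j]_o (th o ^+ 2) <= C2)
  (tau0 : 'I_M -> R)
  (tauP : forall j, (fun n => \int[mu n j]_o th o) @ \oo --> tau0 j)
  (P0 : 'I_M -> 'I_M -> R) (P0ge0 : forall i j, 0 <= P0 i j)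
  (P0sum : forall i, \sum_j P0 i j = 1)
  (P0conn : forall i j, connect (fun a b => 0 < P0 a b) i j)
  (lam : 'I_M -> R) (lam0 : forall j, 0 <= lam j) (lam1 : \sum_j lam j = 1)
  (lamP : forall j, lam j = \sum_i lam i * P0 i j)
  (m : nat -> 'I_M -> R -> R) (L : R) (L0 : 0 < L)
  (m01 : forall n j s, 0 <= m n j s <= 1)
  (mL : forall n j s s', `|m n j s - m n j s'| <= L * `|s - s'|)
  (h : R) (h0 : 0 < h) (i : 'I_M)
  (tn : nat -> R) (tnP : forall n, n%:R <= tn n)
  (super : forall n j s, (j == i)%:R * \int[mu n i]_o trap h s (th o) +
     \sum_k P0 j k * \int[mu n j]_o m n k (s - th o) - (n.+1%:R * (tn n + 1))^-1
     <= m n j s)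
  (b : R) (b1 : b <= 1) (b0 : 0 <= b)
  (lowb : forall e : R, 0 < e -> exists (S : R) (N : nat), forall n j s,
     (N <= n)%N -> S <= s -> b - e <= m n j s)
  (touch : forall n, exists j, m n j (tn n) <= b + 2 / n.+1%:R)
  (i0 : 'I_M)
  (noatom : forall a c : R, 0 < c -> exists2 del : R, 0 < del &
     \forall n \near \oo, fine (mu n i0 [set o | `|th o - a| < del]) < c)
  (U : set_system nat) (UU : UltraFilter U) (ooU : \oo `<=` U).

Let PU : ProperFilter U. Proof. exact: (@ultra_proper _ U UU). Qed.
Let FU : Filter U. Proof. exact: filter_filter. Qed.

(** Since [lowb] gives the opposite inequality far away in time, this says that the limit along [U],
    at lag [s] before [tn n], is exactly [b]. *)
Definition touching (j : 'I_M) (s : R) :=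
  forall e : R, 0 < e -> U [set n | m n j (tn n - s) <= b + e].

(** The support of the limit along [U] of the laws of [th], expressed without forming that limit
    law. *)
Definition ultra_support (j : 'I_M) (r : R) :=
  forall del : R, 0 < del -> exists2 c : R, 0 < c &
    U [set n | c <= fine (mu n j [set o | `|th o - r| < del])].

Let mball (a r : R) : measurable [set o | `|th o - a| < r].
Proof.
rewrite (_ : [set o | _] = th @^-1` (ball a r)); last first.
  by apply/seteqP; split => o /=; rewrite /ball/= distrC.
by rewrite -[X in measurable X]setTI; apply: mth => //; exact: measurable_ball.
Qed.

(** A value near [b] dominates an average of values that are all at least about [b]; an excess on a
    set of holding times near [r], of mass at least [c], followed by a transition of weight
    [P0 j k], would lift the average above it. *)
Lemma touching_step j k s r : touching j s -> 0 < P0 j k -> ultra_support j r ->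
  touching k (s + r).
Proof.
move=> tj Pjk sr e e0.
pose del := e / (2 * L); have del0 : 0 < del by rewrite divr_gt0// mulr_gt0.
have [c c0 Uc] := sr _ del0.
pose kap := P0 j k * c; have kap0 : 0 < kap by rewrite mulr_gt0.
(* Four errors [eta] enter: nearness of the value to [b], the lower bound, long holding times, and
   superharmonicity. Their sum equals [kap * e / 2], the excess that survives moving by [del]. *)
pose eta := kap * e / 8; have eta0 : 0 < eta by rewrite divr_gt0// mulr_gt0.
have [S [N SN]] := lowb eta0.
have U1 := tj _ eta0.
have U2 : U [set n | (N <= n)%N] by apply: ooU; exact: nbhs_infty_ge.
have U3 : U [set n | n.+1%:R^-1 <= eta].
  apply: ooU; apply: filterS (near_infty_natSinv_lt (PosNum eta0)) => n /=; exact: ltW.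
have U4 : U [set n | `|S| + `|s| + 1 + `|C2| / eta <= n%:R].
  by apply: ooU; exact: nbhs_infty_ger.
apply: filterS (filterI Uc (filterI U1 (filterI U2 (filterI U3 U4)))) => n /=.
move=> [cn [m1 [Nn [etan bign]]]].
rewrite leNgt; apply/negP => mk.
pose t := tn n - s; pose u := t - S.
have u1 : 1 + `|C2| / eta <= u.
  by rewrite /u /t; have := tnP n; have := ler_norm S; have := ler_norm s; lra.
have q0 : 0 <= `|C2| / eta by rewrite divr_ge0 ?(ltW eta0).
have u0 : 0 < u by lra.
have cheb (j' : 'I_M) : \int[mu n j']_o (u ^- 2 * th o ^+ 2) <= eta.
  rewrite RintegralZl// mulrC ler_pdivrMr ?exprn_gt0//.
  apply: (le_trans (C2P n j')); apply: (le_trans (ler_norm C2)).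
  rewrite -ler_pdivrMl// mulrC.
  have : u <= u ^+ 2 by rewrite expr2 ler_peMl; lra.
  lra.
have It2 (j' : 'I_M) : (mu n j').-integrable setT (EFin \o (fun o => u ^- 2 * th o ^+ 2)).
  exact: integrable_mulrl.
have Is (j' k' : 'I_M) := integrable_shift mth (mu1 n) (m01 n) (mL n) j' k' t.
(* The lower bound [b - eta] is available only after time [S]. A holding time longer than [u] goes
   back beyond [S]; there the quadratic term exceeds 1, and nonnegativity suffices. *)
have base o k' : b - eta - u ^- 2 * th o ^+ 2 <= m n k' (t - th o).
  have m0 : 0 <= m n k' (t - th o) by case/andP: (m01 n k' (t - th o)).
  have [thu|uth] := leP (th o) u.
    have : b - eta <= m n k' (t - th o) by apply: SN => //; rewrite /u in thu; lra.
    have : 0 <= u ^- 2 * th o ^+ 2 by rewrite mulr_ge0 ?invr_ge0 ?sqr_ge0.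
    lra.
  have : 1 <= u ^- 2 * th o ^+ 2.
    rewrite mulrC ler_pdivlMr ?exprn_gt0// mul1r ler_pXn2r ?nnegrE ?(ltW u0)//.
    exact: ltW.
  by have := b1; lra.
pose D := [set o | `|th o - r| < del].
have mD : measurable D by exact: mball.
pose x := m n k (t - r) - L * del.
have xb : b + e / 2 < x.
  rewrite /x (_ : L * del = e / 2); last by rewrite /del; field; rewrite gt_eqF.
  by rewrite /t (_ : tn n - s - r = tn n - (s + r)); [lra|ring].
have basek o : b - eta - u ^- 2 * th o ^+ 2 + \1_D o * (x - (b - eta)) <= m n k (t - th o).
  rewrite indicE; case: (boolP (o \in D)) => [/set_mem oD|_]; last first.
    by rewrite mul0r addr0; exact: base.
  rewrite mul1r.
  have : 0 <= u ^- 2 * th o ^+ 2 by rewrite mulr_ge0 ?invr_ge0 ?sqr_ge0.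
  have : `|m n k (t - r) - m n k (t - th o)| <= L * del.
    apply: (le_trans (mL n k _ _)); rewrite ler_wpM2l ?(ltW L0)//.
    by rewrite (_ : t - r - (t - th o) = th o - r); [exact: ltW|ring].
  by rewrite ler_norml => /andP[_]; rewrite /x; lra.
have E1 k' : b - eta - eta <= \int[mu n j]_o m n k' (t - th o).
  apply: le_trans (_ : \int[mu n j]_o (b - eta - u ^- 2 * th o ^+ 2) <= _).
    rewrite RintegralB//; last exact: integrable_cstr (mu1 n j) _.
    rewrite Rintegral_cst// (fine_prob_setT (mu1 n j)) mulr1.
    by have := cheb j; lra.
  apply: le_Rintegral => //.
  by apply: integrable_subr => //; exact: integrable_cstr (mu1 n j) _.
have ID : (mu n j).-integrable setT (EFin \o (fun o => \1_D o * (x - (b - eta)))).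
  apply: (@integrable_of_bounded _ _ _ _ (mu1 n j) _ _ `|x - (b - eta)|) => //.
    by apply: measurable_funM.
  by move=> o _; rewrite normrM ler_piMl// ger0_norm// indicE; case: (_ \in _).
have Ib : (mu n j).-integrable setT (EFin \o (fun o => b - eta - u ^- 2 * th o ^+ 2)).
  by apply: integrable_subr => //; exact: integrable_cstr (mu1 n j) _.
have I1D : (mu n j).-integrable setT (EFin \o (\1_D : Om -> R)).
  apply: (@integrable_of_bounded _ _ _ _ (mu1 n j) _ _ 1) => // o _.
  by rewrite ger0_norm// indicE; case: (_ \in _).
have Ek : b - eta - eta + c * (x - (b - eta)) <= \int[mu n j]_o m n k (t - th o).
  apply: le_trans (_ : \int[mu n j]_o (b - eta - u ^- 2 * th o ^+ 2 + \1_D o * (x - (b - eta))) <= _).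
    rewrite RintegralD// RintegralB//; last exact: integrable_cstr (mu1 n j) _.
    rewrite Rintegral_cst// (fine_prob_setT (mu1 n j)) mulr1.
    rewrite [X in _ <= _ + X]RintegralZr// fine_prob_indic//.
    apply: lerD; first by have := cheb j; lra.
    by rewrite ler_wpM2r//; lra.
  by apply: le_Rintegral => //; exact: integrable_addr.
have sumE : b - eta - eta + kap * (x - (b - eta)) <=
    \sum_k P0 j k * \int[mu n j]_o m n k (t - th o).
  rewrite (bigD1 k)//.
  have -> : b - eta - eta + kap * (x - (b - eta)) =
     P0 j k * (b - eta - eta + c * (x - (b - eta))) + \sum_(k' | k' != k) P0 j k' * (b - eta - eta).
    have PE : \sum_(k' | k' != k) P0 j k' = 1 - P0 j k.
      by rewrite -(P0sum j) [in RHS](bigD1 k)// addrAC subrr add0r.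
    by rewrite -mulr_suml PE /kap; move: (b - eta - eta) (x - _) => y1 y2; ring.
  by apply: lerD; [rewrite ler_wpM2l|apply: ler_sum => k' _; rewrite ler_wpM2l].
have sup := super n j t.
have trap0 : 0 <= (j == i)%:R * \int[mu n i]_o trap h t (th o).
  by rewrite mulr_ge0// Rintegral_ge0// => o _; exact: trap_ge0.
have etan' : (n.+1%:R * (tn n + 1))^-1 <= n.+1%:R^-1.
  have tn0 : 0 <= tn n by apply: le_trans (tnP n); exact: ler0n.
  rewrite lef_pV2 ?posrE ?mulr_gt0//; last by lra.
  by rewrite ler_peMr//; lra.
have kx2 : 0 < kap * eta by rewrite mulr_gt0.
have kx3 : 4 * eta + kap * eta <= kap * (x - (b - eta)).
  have -> : 4 * eta + kap * eta = kap * (e / 2 + eta) by rewrite /eta; field.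
  by rewrite ler_wpM2l ?(ltW kap0)//; lra.
exact: (touching_contradiction m1 etan etan' sup sumE trap0 kx3 kx2).
Qed.

Let mitv a r : measurable [set o | a <= th o <= r].
Proof.
rewrite (_ : [set o | _] = th @^-1` `[a, r]%classic); last first.
  by apply/seteqP; split => o /=; rewrite in_itv.
by rewrite -[X in measurable X]setTI; apply: mth => //; exact: measurable_itv.
Qed.

Lemma ultra_not (A : set nat) : ~ U A -> U (~` A).
Proof. by move=> nA; case: (in_ultra_setVsetC A UU). Qed.

Lemma not_ultra_support j a : ~ ultra_support j a -> exists2 del : R, 0 < del &
  forall c, 0 < c -> U [set n | fine (mu n j [set o | `|th o - a| < del]) < c].
Proof.
move=> na; apply: contrapT => nex; apply: na => del del0.
apply: contrapT => nc; apply: nex; exists del => // c c0.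
have : ~ U [set n | c <= fine (mu n j [set o | `|th o - a| < del])].
  by move=> Uc; apply: nc; exists c.
by move=> /ultra_not; apply: filterS => n /= /negP; rewrite -ltNge.
Qed.

(** A supremum argument: let [a] bound the points up to which the mass vanishes along [U]. Were [a]
    outside the support, a neighbourhood of it would be null and the null stretch would extend
    further. *)
Lemma ultra_support_itv j (al be c : R) : 0 < c -> al <= be ->
  U [set n | c <= fine (mu n j [set o | al <= th o <= be])] ->
  exists2 a, al <= a <= be & ultra_support j a.
Proof.
move=> c0 albe Uc.
pose null x := forall e, 0 < e -> U [set n | fine (mu n j [set o | al <= th o <= x]) < e].
pose Z := [set x | al <= x <= be /\ null x].
have nbe : ~ null be.
  move=> /(_ c c0) Ubc.
  have [n [/= ]] := @filter_ex _ U PU _ (@filterI _ U FU _ _ Uc Ubc).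
  by rewrite leNgt => /negP.
have [nal|nnal] := pselect (null al); last first.
  exists al; first by rewrite lexx.
  apply: contrapT => /not_ultra_support[del del0 Udel]; apply: nnal => e e0.
  apply: filterS (Udel e e0) => n /=; apply: le_lt_trans.
  apply: fine_prob_le => // o /= /andP[h1 h2].
  by rewrite (_ : th o = al) ?subrr ?normr0//; apply/eqP; rewrite eq_le h1 h2.
have Zal : Z al by split; rewrite ?lexx.
have supZ : has_sup Z by split; [exists al|exists be => x [/andP[]]].
pose a := sup Z.
have ala : al <= a by apply: ub_le_sup => //; case: supZ.
have abe : a <= be by apply: ge_sup; [exists al|move=> x [/andP[]]].
exists a; first by rewrite ala abe.
apply: contrapT => /not_ultra_support[del del0 Udel].
have [z [/andP[alz zbe] nz] az] := sup_adherent del0 supZ.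
pose x := Num.min (a + del / 2) be.
have xa : x < a + del by rewrite gt_min; apply/orP; left; lra.
have nx : null x.
  move=> e e0; have e20 : 0 < e / 2 by rewrite divr_gt0.
  apply: filterS (filterI (nz _ e20) (Udel _ e20)) => n /= [h1 h2].
  apply: le_lt_trans (_ : fine (mu n j [set o | al <= th o <= z]) +
    fine (mu n j [set o | `|th o - a| < del]) < e); last by lra.
  apply: fine_prob_subU => // o /= /andP[h3 h4].
  have [oz|zo] := leP (th o) z; first by left; rewrite h3.
  by right; rewrite ltr_norml; apply/andP; split; rewrite -/a in az; lra.
have [xbe|xbe] := eqVneq x be; first by apply: nbe; rewrite -xbe.
have xE : x = a + del / 2.
  by move: xbe; rewrite /x /Num.min; case: ifP => //; rewrite eqxx.
have : x <= a.
  apply: ub_le_sup; first by case: supZ.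
  split=> //; rewrite {1}xE ge_min lexx orbT andbT; lra.
rewrite xE; lra.
Qed.

Lemma ultra_support_exists j : exists2 a, 0 <= a & ultra_support j a.
Proof.
(* Markov's inequality for [th ^+ 2] leaves mass at least [1 / 2] on [[0, be]]; [be >= 1] ensures
   that [th ^+ 2] exceeds [be] as soon as [th] does. *)
pose be := Num.max 1 (2 * `|C2|).
have be1 : 1 <= be by rewrite le_max lexx.
have beC : 2 * `|C2| <= be by rewrite le_max lexx orbT.
have be0 : 0 < be by lra.
have [|||a /andP[a0 _] sa] := @ultra_support_itv j 0 be (1 / 2).
- lra.
- lra.
- apply: (@filterE _ U) => n /=.
  have ID : (mu n j).-integrable setT (EFin \o (\1_[set o | 0 <= th o <= be] : Om -> R)).
    apply: (@integrable_of_bounded _ _ _ _ (mu1 n j) _ _ 1) => // o _.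
    by rewrite ger0_norm// indicE; case: (_ \in _).
  have I2 := integrable_mulrl be^-1 measurableT (Ith2 n j).
  rewrite -fine_prob_indic//.
  apply: le_trans (_ : \int[mu n j]_o (1 - be^-1 * th o ^+ 2) <= _).
    rewrite RintegralB//; last exact: integrable_cstr (mu1 n j) _.
    rewrite Rintegral_cst// (fine_prob_setT (mu1 n j)) mulr1 RintegralZl//.
    have : be^-1 * \int[mu n j]_o th o ^+ 2 <= 1 / 2.
      rewrite ler_pdivrMl//; apply: (le_trans (C2P n j)).
      by have := ler_norm C2; lra.
    lra.
  apply: le_Rintegral => //.
    by apply: integrable_subr => //; exact: integrable_cstr (mu1 n j) _.
  move=> o _; rewrite indicE; case: (boolP (o \in _)) => [_|/negP no].
    by rewrite lerBlDr lerDl mulr_ge0 ?invr_ge0 ?sqr_ge0 ?(ltW be0).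
  have tho : be < th o.
    by rewrite ltNge; apply/negP => tho; apply: no; rewrite inE/= th0.
  rewrite subr_le0 ler_pdivlMl// mulr1.
  by apply: (le_trans (ltW tho)); rewrite expr2 ler_peMl//; lra.
by exists a.
Qed.

(** Around a support point [a], a ball of radius [gap / 2] has mass at least [c]. The absence of
    atoms allows a smaller ball of mass below [c / 2] to be removed, so one of the two remaining
    sides keeps mass [c / 4] along [U] and contains a second support point. *)
Lemma ultra_support_pair (gap : R) : 0 < gap -> exists a a' : R,
  [/\ 0 <= a, a < a', a' - a <= gap, ultra_support i0 a & ultra_support i0 a'].
Proof.
move=> gap0; have [a a0 sa] := ultra_support_exists i0.
have g20 : 0 < gap / 2 by rewrite divr_gt0.
have [c c0 Uc] := sa _ g20.
have c20 : 0 < c / 2 by rewrite divr_gt0.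
have [del del0 ndel] := noatom a c20.
have Udel := ooU ndel.
have c40 : 0 < c / 4 by rewrite divr_gt0.
pose I1 := [set o | Num.max 0 (a - gap / 2) <= th o <= a - del].
pose I2 := [set o | a + del <= th o <= a + gap / 2].
have mI1 : measurable I1 by exact: mitv.
have mI2 : measurable I2 by exact: mitv.
have Uor : U [set n | c / 4 <= fine (mu n i0 I1) \/ c / 4 <= fine (mu n i0 I2)].
  apply: filterS (filterI Uc Udel) => n /= [h1 h2].
  apply: contrapT => /not_orP[/negP + /negP]; rewrite -!ltNge => h3 h4.
  have : fine (mu n i0 [set o | `|th o - a| < gap / 2]) <=
      fine (mu n i0 [set o | `|th o - a| < del]) + fine (mu n i0 (I1 `|` I2)).
    apply: fine_prob_subU => //; first exact: measurableU.
    move=> o /=; rewrite ltr_norml => /andP[h5 h6].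
    have [h7|h7] := ltP `|th o - a| del; [by left|right].
    move: h7; rewrite lter_normr => /orP[h7|h7].
      by right; rewrite /I2/=; apply/andP; split; lra.
    left; rewrite /I1/= ge_max th0/=; apply/andP; split; lra.
  have : fine (mu n i0 (I1 `|` I2)) <= fine (mu n i0 I1) + fine (mu n i0 I2).
    by apply: fine_prob_subU => //; exact: measurableU.
  by have := c0; lra.
have UI : U [set n | c / 4 <= fine (mu n i0 I1)] \/ U [set n | c / 4 <= fine (mu n i0 I2)].
  have [|nU] := pselect (U [set n | c / 4 <= fine (mu n i0 I1)]); first by left.
  right; apply: filterS (filterI Uor (ultra_not nU)) => n /= [[]//].
have itv_ne (al be : R) : U [set n | c / 4 <= fine (mu n i0 [set o | al <= th o <= be])] -> al <= be.
  move=> Ui; have [n /= hn] := @filter_ex _ U PU _ Ui.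
  rewrite leNgt; apply/negP => beal; move: hn.
  rewrite (_ : [set o | _] = set0) ?measure0/=; first lra.
  by apply/seteqP; split => o //= /andP[h1 h2]; move: (le_trans h1 h2); rewrite leNgt beal.
case: UI => UI.
  have [a' /andP[h1 h2] sa'] := ultra_support_itv c40 (itv_ne _ _ UI) UI.
  have : a - gap / 2 <= a' by apply: le_trans h1; rewrite le_max lexx orbT.
  have : 0 <= a' by apply: le_trans h1; rewrite le_max lexx.
  by exists a', a; split => //; lra.
have [a' /andP[h1 h2] sa'] := ultra_support_itv c40 (itv_ne _ _ UI) UI.
by exists a, a'; split => //; lra.
Qed.

(** The lag is the sum of one support point per class along a path, hence it does not depend on
    [s]. *)
Lemma touching_connect j k : exists2 c : R, 0 <= c &
  forall s, touching j s -> touching k (s + c).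
Proof.
have /connectP[p] := P0conn j k.
elim: p j => [j _ -> /=|j' p IH j /= /andP[Pjj' pp] kE].
  by exists 0 => // s; rewrite addr0.
have [c c0 cP] := IH j' pp kE; have [r r0 sr] := ultra_support_exists j.
exists (r + c); first exact: addr_ge0.
by move=> s ts; rewrite addrA; apply: cP; exact: touching_step sr.
Qed.

(** The touching class may vary with [n], but there are finitely many classes and the ultrafilter
    selects one of them. *)
Lemma touching_start : exists j, touching j 0.
Proof.
have [jn jnP] := choice touch.
have [j Uj] : exists j, U [set n | jn n = j].
  apply: contrapT => nj.
  have : U [set n | forall j, jn n <> j].
    apply: (@filter_forall _ _ (fun j => [set n | jn n <> j])) => j.
    by apply: ultra_not => Uj; apply: nj; exists j.
  by move=> /(@filter_ex _ U PU)[n /(_ (jn n))].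
exists j => e e0; have e20 : 0 < e / 2 by rewrite divr_gt0.
have U3 : U [set n | n.+1%:R^-1 < e / 2].
  by apply: ooU; exact: (near_infty_natSinv_lt (PosNum e20)).
apply: filterS (filterI Uj U3) => n /= [jE h1].
have h2 : 2 / n.+1%:R < 2 * (e / 2) by rewrite ltr_pM2l.
rewrite subr0 -{1}jE; apply: (le_trans (jnP n)); rewrite lerD2l.
by rewrite (le_trans (ltW h2))// mulrC divfK.
Qed.

(** Loops at [i0] start with holding time [a] or [a'] and return with a common lag [c]; the two loop
    lengths differ by at most [gap], so their combinations become [gap]-dense. A last fixed lag
    leads from [i0] to each class. *)
Lemma touching_dense (gap : R) : 0 < gap -> exists2 S : R, 0 <= S &
  forall k s, S <= s -> exists2 g, s - gap <= g <= s & touching k g.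
Proof.
move=> gap0; have [a [a' [a0 aa' agap sa sa']]] := ultra_support_pair gap0.
have [k1 Pk1] : exists k, 0 < P0 i0 k.
  apply: contrapT => nk; have := P0sum i0; rewrite big1 => [/eqP|k _].
    by rewrite eq_sym oner_eq0.
  apply/eqP; rewrite eq_le P0ge0 andbT leNgt; apply/negP => Pk.
  by apply: nk; exists k.
have [c c0 cP] := touching_connect k1 i0.
have [j0 tj0] := touching_start.
have [s0 s00 s0P] := touching_connect j0 i0.
have ts0 : touching i0 s0 by have := s0P _ tj0; rewrite add0r.
have stepa s r : ultra_support i0 r -> touching i0 s -> touching i0 (s + (r + c)).
  by move=> sr ts; rewrite addrA; apply: cP; exact: touching_step sr.
have semi p q : touching i0 (s0 + (p%:R * (a + c) + q%:R * (a' + c))).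
  elim: p => [|p IHp].
    elim: q => [|q IHq]; first by rewrite !mul0r !addr0.
    have := stepa _ _ sa' IHq; congr touching; rewrite -natr1; ring.
  have := stepa _ _ sa IHp; congr touching; rewrite -natr1; ring.
have [Y YP] := @semigroup_dense R (a + c) (a' + c) (addr_ge0 a0 c0) (ltr_leD aa' (lexx c)).
have ex_ck k : exists x, 0 <= x /\ forall s, touching i0 s -> touching k (s + x).
  by have [x x0 xP] := touching_connect i0 k; exists x.
have [ck ckP] := choice ex_ck.
exists (s0 + `|Y| + \sum_k ck k).
  by rewrite !addr_ge0// sumr_ge0// => k _; case: (ckP k).
move=> k s sS.
have ckS : ck k <= \sum_k ck k.
  by rewrite (bigD1 k)//= lerDl sumr_ge0// => k' _; case: (ckP k').
have [|p [q /andP[h1 h2]]] := YP (s - s0 - ck k); first by have := ler_norm Y; lra.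
exists (s0 + (p%:R * (a + c) + q%:R * (a' + c)) + ck k).
  by apply/andP; split; lra.
by case: (ckP k) => _; apply.
Qed.

(** The ultrafilter intersects only finitely many conditions at once: touching is imposed at one lag
    per class and grid cell, and the Lipschitz bound fills in the rest. *)
Lemma touching_window (e W : R) : 0 < e -> 0 <= W -> exists2 S : R, 0 <= S &
  U [set n | forall k s, S <= s <= S + W -> m n k (tn n - s) <= b + e].
Proof.
move=> e0 W0.
(* A touching lag is found within [2 * gap] of any given lag, which costs at most
   [L * (2 * gap) = e / 2]. *)
pose gap := e / (4 * L); have gap0 : 0 < gap by rewrite divr_gt0// mulr_gt0.
have [S S0 SP] := touching_dense gap0.
pose N := (Num.truncn (W / gap)).+1.
have ex_g (kl : 'I_M * 'I_N) : exists x : R,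
    S + kl.2%:R * gap - gap <= x <= S + kl.2%:R * gap /\ touching kl.1 x.
  case: kl => k l /=; have [|x xP tx] := SP k (S + l%:R * gap); last by exists x.
  by rewrite lerDl mulr_ge0// ltW.
have [g gP] := choice ex_g.
exists S => //.
have e20 : 0 < e / 2 by rewrite divr_gt0.
have Ug : U [set n | forall kl : 'I_M * 'I_N, m n kl.1 (tn n - g kl) <= b + e / 2].
  apply: (@filter_forall _ _ (fun kl => [set n | m n kl.1 (tn n - g kl) <= b + e / 2])) => kl.
  by case: (gP kl) => _; exact.
apply: filterS Ug => n /= Ug k s /andP[Ss sW].
pose l := Num.truncn ((s - S) / gap).
have l1 : l%:R * gap <= s - S.
  by rewrite -ler_pdivlMr// truncn_le// divr_ge0 ?subr_ge0 ?(ltW gap0).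
have l2 : s - S < l%:R * gap + gap.
  have : s - S < l.+1%:R * gap by rewrite -ltr_pdivrMr// truncnS_gt.
  by rewrite -natr1 mulrDl mul1r.
have lN : (l < N)%N.
  rewrite /N ltnS; apply: le_truncn; rewrite ler_pM2r ?invr_gt0//; lra.
have := Ug (k, Ordinal lN); have /= [/andP[h1 h2] _] := gP (k, Ordinal lN).
set gg := g _ in h1 h2 * => hm.
have : `|m n k (tn n - s) - m n k (tn n - gg)| <= e / 2.
  apply: (le_trans (mL n k _ _)); apply: le_trans (_ : L * (2 * gap) <= _).
    rewrite ler_wpM2l ?(ltW L0)// ler_norml; apply/andP; split; lra.
  rewrite le_eqVlt; apply/orP; left; apply/eqP.
  by rewrite /gap; field; rewrite gt_eqF.
by rewrite ler_norml => /andP[_]; lra.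
Qed.

(** A single large index [n] in the ultrafilter suffices for each [e]: near-minimality on the
    window, the means and the size of [n] are all conditions of [U]. *)
Lemma limit_lower_bound : lam i * (tau0 i - 2 * h) <= b * \sum_j lam j * tau0 j.
Proof.
have C20 : 0 <= C2.
  by apply: le_trans (C2P 0 i); apply: Rintegral_ge0 => o _; exact: sqr_ge0.
have lami1 : lam i <= 1.
  by rewrite -lam1 (bigD1 i)//= lerDl sumr_ge0.
pose Sg := \sum_j lam j * tau0 j.
have tau00 j : 0 <= tau0 j.
  apply: (cvgr_to_ge (@tauP j)); apply: nearW => n; apply: Rintegral_ge0 => o _; exact: th0.
have Sg0 : 0 <= Sg by rewrite sumr_ge0// => j _; rewrite mulr_ge0.
suff H e : 0 < e -> e <= 1 -> lam i * (tau0 i - 2 * h) <= b * Sg + e * (10 + Sg).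
  apply/ler_addgt0Pr => e e0.
  pose e1 := Num.min 1 (e / (10 + Sg)).
  have e10 : 0 < e1 by rewrite lt_min ltr01 divr_gt0//; lra.
  have e11 : e1 <= 1 by rewrite ge_min lexx.
  apply: (le_trans (H e1 e10 e11)); rewrite lerD2l -ler_pdivlMr; last by lra.
  by rewrite ge_min lexx orbT.
move=> e0 e1.
(* Long enough for the sojourns that overshoot the window to contribute at most [C2 / W <= e]. *)
pose W := (C2 + 1) / e; have W0 : 0 < W by rewrite divr_gt0//; lra.
have [S S0 US] := touching_window e0 (ltW W0).
have Utau : U [set n | forall j, `|tau0 j - \int[mu n j]_o th o| < e].
  apply: (@filter_forall _ _ (fun j => [set n | `|tau0 j - \int[mu n j]_o th o| < e])) => j.
  by apply: ooU; have /(@cvgrPdist_lt _ R^o) := @tauP j; apply.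
have Un : U [set n | S + (C2 + L + 1) / e + 1 <= n%:R] by apply: ooU; exact: nbhs_infty_ger.
have [n [hS [ht hn]]] := @filter_ex _ U PU _ (filterI US (filterI Utau Un)).
rewrite /= in hS ht hn.
have CLe : 0 < (C2 + L + 1) / e by rewrite divr_gt0//; have := L0; lra.
have nn := tnP n.
pose t := tn n - S; have t0 : 0 < t by rewrite /t; lra.
(* The mesh equals the superharmonicity error. Multiplied by the length of the grid, which is at
   most [tn n + 1], either one contributes at most [1 / (n + 1)]. *)
pose del := (n.+1%:R * (tn n + 1))^-1.
have tn1 : 0 < tn n + 1 by lra.
have del0 : 0 < del by rewrite invr_gt0 mulr_gt0.
have n1 : n.+1%:R^-1 * (C2 + L + 1) <= e.
  rewrite ler_pdivrMl// -ler_pdivrMr// -natr1; lra.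
have nC : n.+1%:R^-1 <= e.
  apply: le_trans n1; rewrite ler_peMr//; have := L0; lra.
have nL : L * n.+1%:R^-1 <= e.
  apply: le_trans n1; rewrite mulrC ler_wpM2l//; lra.
have deln : del * (tn n + 1) = n.+1%:R^-1.
  by rewrite /del; field; rewrite ?gt_eqF// ltr0n.
have del_e : del <= e.
  apply: le_trans nC; rewrite -deln ler_peMr ?(ltW del0)//; lra.
pose N := (Num.truncn (t / del)).+1.
have N1 : t <= del * N%:R.
  by rewrite mulrC -ler_pdivrMr//; exact/ltW/truncnS_gt.
have N2 : del * N%:R <= tn n + 1.
  have : N%:R <= t / del + 1.
    by rewrite /N -natr1 lerD2r truncn_le// divr_ge0// ltW.
  move=> /(ler_wpM2l (ltW del0)) h1; apply: (le_trans h1).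
  rewrite mulrDr mulr1 mulrCA mulfV ?gt_eqF// mulr1 /t; lra.
have delN : del * (del * N%:R) <= n.+1%:R^-1 by rewrite -deln ler_pM2l.
have winS : forall k s, t - W <= s <= t -> m n k s <= b + e.
  move=> k s /andP[s1 s2]; rewrite (_ : s = tn n - (tn n - s)); last ring.
  by apply: hS; rewrite /t in s1 s2; apply/andP; split; lra.
have be0 : 0 <= b + e by rewrite addr_ge0 ?(ltW e0).
have := @conservation _ _ _ th mth th0 M (mu n) (mu1 n) (Ith n) (Ith2 n) P0 P0ge0 P0sum
  lam lam0 lam1 lamP (m n) L L0 (m01 n) (mL n) h h0 i del t del (b + e) W N
  (super n) del0 t0 W0 be0 N1 winS.
pose E j := \int[mu n j]_o th o; pose E2 j := \int[mu n j]_o (th o ^+ 2).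
have EiP : tau0 i - e <= E i by have := ht i; rewrite ltr_norml /E => /andP[_]; lra.
have E2t : E2 i / t <= e.
  rewrite ler_pdivrMr//; apply: (le_trans (C2P n i)).
  rewrite mulrC -ler_pdivrMr//; apply: le_trans (_ : (C2 + L + 1) / e <= _).
    by rewrite ler_pM2r ?invr_gt0//; have := L0; lra.
  by rewrite /t; lra.
have sumE : \sum_j lam j * E j <= Sg + e.
  rewrite -[X in _ + X]mul1r -[X in _ + X * e]lam1 mulr_suml -big_split/=.
  apply: ler_sum => j _; rewrite -mulrDr ler_wpM2l//.
  by have := ht j; rewrite ltr_norml /E => /andP[+ _]; lra.
have sumE2 : (\sum_j lam j * E2 j) / W <= e.
  rewrite ler_pdivrMr// /W mulrCA mulfV ?gt_eqF// mulr1.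
  apply: le_trans (_ : \sum_j lam j * C2 <= _).
    by apply: ler_sum => j _; rewrite ler_wpM2l//; exact: C2P.
  by rewrite -mulr_suml lam1 mul1r; lra.
rewrite -!/(E _) -!/(E2 _) => main.
have h1 : lam i * (tau0 i - 2 * h) - 4 * e <=
    lam i * (E i - 2 * h - 2 * del - E2 i / t).
  have : lam i * (tau0 i - 2 * h - 4 * e) <= lam i * (E i - 2 * h - 2 * del - E2 i / t).
    by rewrite ler_wpM2l//; lra.
  have : lam i * (4 * e) <= 1 * (4 * e) by rewrite ler_wpM2r//; lra.
  lra.
have h2 : (b + e) * (\sum_j lam j * E j) <= b * Sg + e * (2 + Sg).
  apply: le_trans (_ : (b + e) * (Sg + e) <= _); first by rewrite ler_wpM2l.
  have : e * e <= e * 1 by rewrite ler_wpM2l// ltW.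
  have : b * e <= 1 * e by rewrite ler_wpM2r// ltW.
  lra.
have h3 : L * del * (del * N%:R) <= e.
  by rewrite -mulrA; apply: le_trans nL; rewrite ler_wpM2l// ltW.
have h4 : 0 <= e * Sg by rewrite mulr_ge0// ltW.
move: main h1 h2 h3 sumE2 delN nC.
set x1 := lam i * (tau0 i - _); set x2 := lam i * (E i - _ - _ - _).
set x3 := (b + e) * _; set x4 := L * _ * _; set x5 := del * (_ * _); set x6 := _ / W; set x7 := n.+1%:R^-1.
lra.
Qed.

End limit_argument.

(** * Uniformity over Lipschitz test functions *)

Section interpolation.
Context {R : realType}.
Implicit Types (g x : R) (l : nat).

Definition ramp g l x : R := Num.max 0 (Num.min 1 (x / g - l%:R)).

Lemma ramp01 g l x : 0 <= ramp g l x <= 1.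
Proof. by rewrite le_max lexx/= ge_max ler01 ge_min lexx. Qed.

Lemma ramp_bounded_continuous g l : bounded_continuous (ramp g l).
Proof.
split; last first.
  by exists 1 => r; have /andP[? ?] := ramp01 g l r; rewrite ger0_norm.
move=> x; apply: (@continuous_max _ R^o (fun=> 0) (fun x => Num.min 1 (x / g - l%:R))).
  exact: cvg_cst.
apply: (@continuous_min _ R^o (fun=> 1) (fun x => (x / g - l%:R))); first exact: cvg_cst.
by apply: cvgB; [apply: cvgMl; exact: cvg_id|exact: cvg_cst].
Qed.

Lemma ramp_max0 g l x : 0 < g -> ramp g l (Num.max x 0) = ramp g l x.
Proof.
move=> g0; case: (leP x 0) => // x0; rewrite /ramp.
have l0 : 0 <= l%:R :> R by [].
have xg : x / g <= 0 by rewrite pmulr_lle0 ?invr_gt0.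
rewrite (min_idPr _); last by rewrite mul0r; lra.
rewrite (min_idPr _); last by lra.
by rewrite !(max_idPl _)//; [lra|rewrite mul0r; lra].
Qed.

Lemma ramp_eq0 g l x : 0 < g -> x <= l%:R * g -> ramp g l x = 0.
Proof.
move=> g0 xl; apply/max_idPl; rewrite ge_min; apply/orP; right.
by rewrite subr_le0 ler_pdivrMr.
Qed.

Lemma ramp_eq1 g l x : 0 < g -> l.+1%:R * g <= x -> ramp g l x = 1.
Proof.
move=> g0 xl; rewrite /ramp (min_idPl _) ?(max_idPr _)//.
by rewrite lerBrDr addrC natr1 ler_pdivlMr.
Qed.

(** Piecewise linear interpolation at the multiples of [g], constant beyond [N * g]. Written this
    way, [f] enters only through coefficients, and the test functions are a fixed finite family. *)
Definition interpolant (f : R -> R) g N x : R :=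
  f 0 + \sum_(l < N) (f (l.+1%:R * g) - f (l%:R * g)) * ramp g l x.

Lemma interpolant_near (f : R -> R) (L g : R) N x : 0 < g -> 0 <= L ->
  (forall s s', `|f s - f s'| <= L * `|s - s'|) -> 0 <= x ->
  (x <= N%:R * g -> `|f x - interpolant f g N x| <= 2 * L * g) /\
  (N%:R * g <= x -> interpolant f g N x = f (N%:R * g)).
Proof.
move=> g0 L0 fL x0; have Lg : 0 <= L * g by rewrite mulr_ge0// ltW.
elim: N => [|N [IH1 IH2]]; rewrite /interpolant.
  rewrite big_ord0 mul0r addr0; split=> // x1.
  by rewrite (_ : x = 0) ?subrr ?normr0; lra.
rewrite big_ord_recr/= addrA -/(interpolant f g N x).
have g1 : N.+1%:R * g = N%:R * g + g by rewrite -natr1 mulrDl mul1r.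
have [xN|Nx] := leP x (N%:R * g).
  rewrite ramp_eq0// mulr0 addr0; split=> [_|]; first exact: IH1.
  by rewrite g1 => ?; have : False by lra.
rewrite (IH2 (ltW Nx)); split=> [xN1|xN1]; last by rewrite ramp_eq1//; ring.
have /andP[r0 r1] := ramp01 g N x.
rewrite opprD addrA; apply: (le_trans (ler_normB _ _)).
have h1 : `|f x - f (N%:R * g)| <= L * g.
  apply: (le_trans (fL _ _)); rewrite ler_wpM2l// gtr0_norm; lra.
have h2 : `|f (N.+1%:R * g) - f (N%:R * g)| <= L * g.
  apply: (le_trans (fL _ _)); rewrite ler_wpM2l// gtr0_norm; lra.
rewrite normrM (ger0_norm r0).
have : `|f (N.+1%:R * g) - f (N%:R * g)| * ramp g N x <= L * g * 1.
  by rewrite ler_pM.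
lra.
Qed.

(** Beyond the last node the error is at most 2, which [x ^+ 2 / (N * g) ^+ 2 >= 1] turns into a
    quantity controlled by second moments. *)
Lemma interpolant_le (f : R -> R) (L g : R) N x : 0 < g -> 0 <= L -> (0 < N)%N ->
  (forall s s', `|f s - f s'| <= L * `|s - s'|) -> (forall s, `|f s| <= 1) -> 0 <= x ->
  `|f x - interpolant f g N x| <= 2 * L * g + 2 / (N%:R * g) ^+ 2 * x ^+ 2.
Proof.
move=> g0 L0 N0 fL f1 x0; have [h1 h2] := interpolant_near N g0 L0 fL x0.
have A0 : 0 < N%:R * g by rewrite mulr_gt0// ltr0n.
have Lg : 0 <= 2 * L * g by rewrite !mulr_ge0// ltW.
have q0 : 0 <= 2 / (N%:R * g) ^+ 2 * x ^+ 2 by rewrite mulr_ge0 ?sqr_ge0// divr_ge0 ?sqr_ge0.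
have [xN|Nx] := leP x (N%:R * g); first by have := h1 xN; lra.
rewrite (h2 (ltW Nx)); apply: (le_trans (ler_normB _ _)).
have := f1 x; have := f1 (N%:R * g).
have : 2 <= 2 / (N%:R * g) ^+ 2 * x ^+ 2.
  rewrite mulrAC ler_pdivlMr ?exprn_gt0// ler_wpM2l//.
  by rewrite ler_pXn2r// ?nnegrE// ltW.
lra.
Qed.

End interpolation.

Section interpolation_error.
Context {d : measure_display} {T : measurableType d} {R : realType}
  (P : {measure set T -> \bar R}) (P1 : P setT = 1%E).

Lemma Rintegral_affine (D : set T) N (a : R) (c : nat -> R) (f : nat -> T -> R) :
  measurable D -> (forall l, measurable_fun setT (f l)) -> (forall l p, `|f l p| <= 1) ->
  \int[P]_(p in D) (a + \sum_(l < N) c l * f l p)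
    = a * fine (P D) + \sum_(l < N) c l * \int[P]_(p in D) f l p.
Proof.
move=> mD mf f1.
have If l : P.-integrable D (EFin \o f l).
  by apply: (integrable_of_bounded P1 (K := 1)) => //; exact: measurable_funTS.
have Is n : P.-integrable D (EFin \o (fun p => a + \sum_(l < n) c l * f l p)).
  elim: n => [|n IH].
    under [X in EFin \o X]eq_fun do rewrite big_ord0 addr0.
    by apply: (integrable_of_bounded P1 (K := `|a|)).
  under [X in EFin \o X]eq_fun do rewrite big_ord_recr/= addrA.
  by apply: integrable_addr => //; exact: integrable_mulrl.
elim: N => [|N IH].
  under eq_Rintegral do rewrite big_ord0 addr0.
  by rewrite big_ord0 addr0 Rintegral_cst.
under eq_Rintegral do rewrite big_ord_recr/= addrA.
rewrite RintegralD//; [|exact: Is|exact: integrable_mulrl].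
by rewrite IH RintegralZl// big_ord_recr/= addrA.
Qed.

Lemma normr_Rintegral_le_moment (D : set T) (G Y : T -> R) (a b C : R) :
  measurable D -> P.-integrable setT (EFin \o G) ->
  P.-integrable setT (EFin \o (fun p => Y p ^+ 2)) ->
  0 <= a -> 0 <= b -> \int[P]_p (Y p ^+ 2) <= C ->
  (forall p, `|G p| <= a + b * Y p ^+ 2) -> `|\int[P]_(p in D) G p| <= a + b * C.
Proof.
move=> mD IG IY a0 b0 YC GY.
have Ib : P.-integrable setT (EFin \o (fun p => a + b * Y p ^+ 2)).
  by apply: integrable_addr => //; [exact: integrable_cstr|exact: integrable_mulrl].
have IG' : P.-integrable D (EFin \o G) by exact: integrableS IG.
have bE : \int[P]_p (a + b * Y p ^+ 2) <= a + b * C.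
  rewrite RintegralD//; [|exact: integrable_cstr|exact: integrable_mulrl].
  rewrite Rintegral_cst// (fine_prob_setT P1) mulr1 RintegralZl// lerD2l.
  exact: ler_wpM2l.
apply: le_trans bE; rewrite Rintegral_mkcond.
have IGD : P.-integrable setT (EFin \o (G \_ D)).
  rewrite -restrict_EFin; apply/integrable_restrict => //.
  by rewrite setTI.
have GD p : `|(G \_ D) p| <= a + b * Y p ^+ 2.
  rewrite patchE; case: ifP => _; first exact: GY.
  by rewrite normr0 addr_ge0// mulr_ge0// sqr_ge0.
rewrite ler_norml; apply/andP; split; last first.
  by apply: le_Rintegral => // p _; apply: le_trans (GD p); exact: ler_norm.
rewrite lerNl -mulN1r -RintegralZl//; apply: le_Rintegral => //.
  exact: integrable_mulrl.
by move=> p _; apply: le_trans (GD p); rewrite mulN1r -normrN ler_norm.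
Qed.

End interpolation_error.

(** * Atoms of limit laws *)

Section law.
Context {d : measure_display} {T : measurableType d} {R : realType}
  (P : {measure set T -> \bar R}) (P1 : P setT = 1%E) (Y : T -> R)
  (mY : measurable_fun setT Y).

Let mpre B : measurable B -> measurable (Y @^-1` B).
Proof. by move=> mB; rewrite -[X in measurable X]setTI; exact: mY. Qed.

Definition law : set R -> \bar R := pushforward P Y.

Let law0 : law set0 = 0%E. Proof. by rewrite /law /pushforward preimage_set0 measure0. Qed.

Let law_ge0 B : (0 <= law B)%E. Proof. exact: measure_ge0. Qed.

Let law_sigma : semi_sigma_additive law.
Proof.
move=> F mF tF mUF; rewrite /law /pushforward preimage_bigcup.
apply: measure_semi_sigma_additive => [n||]; first exact: mpre.
- apply/trivIsetP => /= i j _ _ ij; rewrite -preimage_setI.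
  by move/trivIsetP : tF => /(_ _ _ _ _ ij) ->//; rewrite preimage_set0.
- by rewrite -preimage_bigcup; exact: mpre.
Qed.

HB.instance Definition _ := isMeasure.Build _ _ _ law law0 law_ge0 law_sigma.

Let law1 : law setT = 1%E. Proof. by rewrite /law /pushforward preimage_setT. Qed.

HB.instance Definition _ := Measure_isProbability.Build _ _ _ law law1.

Lemma exists_law : exists mu : probability R R,
  (forall B, measurable B -> mu B = P (Y @^-1` B)) /\
  (forall f : R -> R, measurable_fun setT f -> (exists K, forall r, `|f r| <= K) ->
    \int[mu]_r f r = \int[P]_p f (Y p)).
Proof.
exists law; split=> // f mf [K fK].
rewrite /Rintegral; congr fine.
rewrite (_ : (\int[law]_r (f r)%:E = \int[pushforward P Y]_r (f r)%:E)%E)//.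
rewrite (integral_pushforward mY)//; first exact/measurable_EFinP.
rewrite preimage_setT; apply: (integrable_of_bounded P1 (K := K)) => //.
exact: measurableT_comp.
Qed.

End law.

Section atoms.
Context {d : measure_display} {T : measurableType d} {R : realType}
  (P : nat -> {measure set T -> \bar R}) (P1 : forall n, P n setT = 1%E)
  (Y : nat -> T -> R) (mY : forall n, measurable_fun setT (Y n)) (C a c : R)
  (IY : forall n, (P n).-integrable setT (EFin \o (fun p => Y n p ^+ 2)))
  (YC : forall n, \int[P n]_p (Y n p ^+ 2) <= C)
  (conc : forall del, 0 < del -> \forall n \near \oo,
     c <= fine (P n [set p | `|Y n p - a| <= del])).

(** A continuous function between the indicators of the closed balls of radii [del] and [2 * del]
    around [a], by which weak convergence sees the mass near a point. *)
Definition hat (del x : R) : R := Num.max 0 (Num.min 1 (2 - `|x - a| / del)).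

Lemma hat01 del x : 0 <= hat del x <= 1.
Proof. by rewrite le_max lexx/= ge_max ler01 ge_min lexx. Qed.

Lemma hat_bounded_continuous del : bounded_continuous (hat del).
Proof.
split; last first.
  by exists 1 => r; have /andP[? ?] := hat01 del r; rewrite ger0_norm.
move=> x; apply: (@continuous_max _ R^o (fun=> 0) (fun x => Num.min 1 (2 - `|x - a| / del))).
  exact: cvg_cst.
apply: (@continuous_min _ R^o (fun=> 1) (fun x => (2 - `|x - a| / del))); first exact: cvg_cst.
apply: cvgB; first exact: cvg_cst.
apply: cvgMl; apply: (@cvg_norm _ R^o); apply: cvgB; [exact: cvg_id|exact: cvg_cst].
Qed.

Lemma hat_ge_indic del x : 0 < del -> \1_[set x | `|x - a| <= del] x <= hat del x.
Proof.
move=> d0; rewrite indicE; case: (boolP (x \in _)) => [|_]; last by have /andP[] := hat01 del x.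
rewrite inE /= => xa; rewrite /hat (min_idPl _) ?(max_idPr _)//.
by rewrite lerBrDr -lerBrDl ler_pdivrMr//; lra.
Qed.

Lemma hat_le_indic del x : 0 < del -> hat del x <= \1_[set x | `|x - a| <= 2 * del] x.
Proof.
move=> d0; rewrite indicE; case: (boolP (x \in _)) => [_|]; first by have /andP[] := hat01 del x.
rewrite notin_setE /= => /negP; rewrite -ltNge => xa.
rewrite /hat ge_max lexx/= ge_min; apply/orP; right.
by rewrite subr_le0 ler_pdivlMr// ltW.
Qed.

Let mcball r : measurable [set x : R | `|x - a| <= r].
Proof.
rewrite (_ : [set x | _] = `[a - r, a + r]%classic)//.
by apply/seteqP; split => x /=; rewrite in_itv/= ler_norml lerBlDl lerNl -lerBlDr => /andP[? ?]; apply/andP; split; lra.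
Qed.

(** Bounded second moments give tightness, so a weak limit exists along a subsequence. Hat functions
    transfer the mass [c] to every closed ball around [a], and continuity from above concentrates it
    on the point. *)
Lemma atom_of_concentration : exists (phi : nat -> nat) (xi : probability R R),
  [/\ forall k, (phi k < phi k.+1)%N,
   forall f, bounded_continuous f ->
     (fun k => \int[P (phi k)]_p f (Y (phi k) p)) @ \oo --> \int[xi]_x f x &
   (c%:E <= xi [set a])%E].
Proof.
have /choice[mu muP] n := exists_law (P1 n) (mY n).
have C0 : 0 <= C.
  by apply: le_trans (YC 0%N); apply: Rintegral_ge0 => p _; exact: sqr_ge0.
have cheb n A : 0 < A -> measurable (Y n @^-1` [set r | A <= `|r|]) ->
    fine (P n (Y n @^-1` [set r | A <= `|r|])) <= C / A ^+ 2.
  move=> A0 mA; rewrite -(fine_prob_indic (P n) mA).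
  apply: le_trans (_ : \int[P n]_p (A ^- 2 * Y n p ^+ 2) <= _).
    apply: le_Rintegral => //.
    - apply: (integrable_of_bounded (P1 n) (K := 1)) => // p _.
      by rewrite indicE; case: (_ \in _); rewrite ?normr1 ?normr0.
    - exact: integrable_mulrl.
    - move=> p _; rewrite indicE; case: (boolP (p \in _)) => [|_].
        rewrite inE /= => Ap; rewrite mulrC ler_pdivlMr ?exprn_gt0// mul1r.
        by rewrite -[leRHS]real_normK ?num_real// ler_pXn2r// nnegrE// ltW.
      by rewrite mulr_ge0 ?sqr_ge0// invr_ge0 sqr_ge0.
  by rewrite RintegralZl// mulrC ler_wpM2r// invr_ge0 sqr_ge0.
have tight (e : R) : 0 < e -> exists A : R, forall n,
    dfun (mu n) (- A) <= e /\ 1 - dfun (mu n) A <= e.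
  (* Since [A >= 1] and [e * A = C + e], Chebyshev's bound [C / A ^+ 2] is at most [e]. *)
  move=> e0; pose A := C / e + 1; have A1 : 1 <= A by rewrite lerDr divr_ge0 ?(ltW e0).
  exists A => n.
  have mA : measurable (Y n @^-1` [set r | A <= `|r|]).
    rewrite -[X in measurable X]setTI; apply: mY => //.
    rewrite (_ : [set r | _] = setT `&` Num.norm @^-1` `[A, +oo[%classic).
      exact: (@normr_measurable R setT measurableT _ (measurable_itv _)).
    by apply/seteqP; split => r /=; rewrite in_itv/= andbT// => -[].
  have Ae : fine (P n (Y n @^-1` [set r | A <= `|r|])) <= e.
    apply: (le_trans (cheb n A _ mA)); first by lra.
    rewrite ler_pdivrMr ?exprn_gt0//; last by lra.
    have : A <= A ^+ 2 by rewrite expr2 ler_peMl; lra.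
    have : e * A = C + e by rewrite /A; field; rewrite gt_eqF.
    move=> h1 h2; have : e * A <= e * A ^+ 2 by rewrite ler_wpM2l// ltW.
    lra.
  have mpre B : measurable B -> measurable (Y n @^-1` B).
    by move=> mB; rewrite -[X in measurable X]setTI; exact: mY.
  split; apply: le_trans Ae; rewrite /dfun (muP n).1//.
    apply: fine_le; rewrite ?(fin_num_prob (P1 n))//; first exact: mpre.
    apply: le_measure; rewrite ?inE//; first exact: mpre.
    by move=> p /=; rewrite in_itv/= => YA; rewrite ler_normr lerNr YA orbT.
  rewrite -(fine_prob_setT (P1 n)) lerBlDl -fineD ?(fin_num_prob (P1 n))//; last exact: mpre.
  apply: fine_le; rewrite ?fin_numD ?(fin_num_prob (P1 n))//; first exact: mpre.
  apply: le_trans (measureU2 _ _ _) => //; last exact: mpre.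
  apply: le_measure; rewrite ?inE//; first by apply: measurableU => //; exact: mpre.
  move=> p _ /=; rewrite in_itv/=; have [h|h] := leP (Y n p) A; first by left.
  by right; apply: (le_trans (ltW h)); exact: ler_norm.
have [phi [xi [phiS phixi]]] := helly_selection tight.
have phixi' f : bounded_continuous f ->
    (fun k => \int[P (phi k)]_p f (Y (phi k) p)) @ \oo --> \int[xi]_x f x.
  move=> bf; have [cf bK] := bf.
  rewrite (_ : (fun k => _) = (fun k => \int[mu (phi k)]_x f x)); first exact: phixi.
  apply/funext => k.
  by rewrite (muP (phi k)).2//; exact: continuous_measurable_fun.
exists phi, xi; split=> //.
have xi1 : xi setT = 1%E by exact: probability_setT.
have phin n : (n <= phi n)%N by elim: n => // n IH; exact: (leq_ltn_trans IH).
have ball_ge del : 0 < del -> c <= fine (xi [set x | `|x - a| <= 2 * del]).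
  move=> d0; have [ch [K hK]] := hat_bounded_continuous del.
  apply: le_trans (_ : \int[xi]_x hat del x <= _); last first.
    rewrite -(fine_prob_indic xi (mcball _)); apply: le_Rintegral => //.
    - apply: (integrable_of_bounded xi1 (K := K)) => //; exact: continuous_measurable_fun.
    - apply: (integrable_of_bounded xi1 (K := 1)) => //.
      by move=> x _; rewrite indicE; case: (_ \in _); rewrite ?normr1 ?normr0.
    - by move=> x _; exact: hat_le_indic.
  apply: (cvgr_to_ge (phixi' _ (hat_bounded_continuous del))).
  have [N _ hN] := conc d0; exists N => // k /= Nk.
  have {}hN := hN (phi k) (leq_trans Nk (phin k)); apply: (le_trans hN).
  have mD : measurable [set p | `|Y (phi k) p - a| <= del].
    by rewrite -[X in measurable X]setTI; exact: (mY (phi k) measurableT (mcball del)).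
  rewrite -(fine_prob_indic (P (phi k)) mD); apply: le_Rintegral => //.
  - apply: (integrable_of_bounded (P1 (phi k)) (K := 1)) => //.
    by move=> x _; rewrite indicE; case: (_ \in _); rewrite ?normr1 ?normr0.
  - apply: (integrable_of_bounded (P1 (phi k)) (K := K)) => //.
    by apply: measurableT_comp => //; exact: continuous_measurable_fun.
  - by move=> p _; exact: (hat_ge_indic _ d0).
pose F (n : nat) := [set x : R | `|x - a| <= 2 * n.+1%:R^-1].
have FE : \bigcap_n F n = [set a].
  apply/seteqP; split => [x Fx|x -> n _]; last by rewrite /F/= subrr normr0 mulr_ge0.
  apply/eqP; rewrite -subr_eq0 -normr_le0 leNgt; apply/negP => xa0.
  have xa2 : 0 < `|x - a| / 2 by rewrite divr_gt0.
  have [N _ /(_ N (leqnn N))/= hN] := near_infty_natSinv_lt (PosNum xa2).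
  have := Fx N I; rewrite /F/=; move: hN => /=.
  move: (N.+1%:R^-1) => z; lra.
have Fcv : xi \o F @ \oo --> xi (\bigcap_n F n).
  apply: nonincreasing_cvg_mu => //.
  - by apply: (@le_lt_trans _ _ 1%E); [exact: (le_prob1 xi1 (mcball _))|rewrite ltry].
  - by move=> n; exact: mcball.
  - by rewrite FE.
  - apply/nonincreasing_seqP => n; apply/subsetPset => x; rewrite /F/= => h.
    by apply: (le_trans h); rewrite ler_pM2l// lef_pV2 ?posrE// ler_nat.
rewrite -FE; rewrite -(cvg_lim _ Fcv)//; apply: lime_ge; first by apply/cvg_ex; eexists; exact: Fcv.
apply: nearW => n /=; have := @ball_ge n.+1%:R^-1; rewrite invr_gt0 ltr0n => /(_ isT).
by rewrite -lee_fin fineK//; apply: (fin_num_prob xi1); exact: mcball.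
Qed.

End atoms.

(** * Consequences of the asymptotic hypotheses *)

Lemma near_at_right0 {R : realType} (P : R -> Prop) :
  (\forall eps \near (0 : R)^'+, P eps) <->
  exists2 del : R, 0 < del & forall eps, 0 < eps < del -> P eps.
Proof.
split=> [[del /= del0 H]|[del del0 H]].
  exists del => // eps /andP[e0 ed]; apply: H => //=.
  by rewrite sub0r normrN gtr0_norm.
exists del => // eps /= ed e0; apply: H; rewrite e0/=.
by move: ed; rewrite sub0r normrN gtr0_norm.
Qed.

Lemma cvg_sum_ord {R : realType} {T : Type} (F : set_system T) (FF : Filter F) N
    (f : 'I_N -> T -> R) (l : 'I_N -> R) :
  (forall i, f i x @[x --> F] --> l i) ->
  (\sum_i f i x) @[x --> F] --> \sum_i l i.
Proof.
elim: N f l => [|N IH] f l fl.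
  under eq_cvg do rewrite big_ord0.
  by rewrite big_ord0; exact: cvg_cst.
under eq_cvg do rewrite big_ord_recr/=.
rewrite big_ord_recr/=; apply: cvgD; last exact: (@fl).
by apply: (IH (fun i => f (widen_ord (leqnSn N) i))) => i; exact: (@fl).
Qed.

Lemma near_forall2 {X : Type} {I : finType} (F : set_system X) (FF : Filter F)
    (P : X -> I -> I -> Prop) :
  (forall j k, \forall x \near F, P x j k) -> \forall x \near F, forall j k, P x j k.
Proof.
move=> H; have := @filter_forall _ (I * I)%type (fun jk => [set x | P x jk.1 jk.2]) F FF.
move=> /(_ (fun jk => H jk.1 jk.2)); apply: filterS => x h j k; exact: (h (j, k)).
Qed.

Lemma normrB_le2 {R : realType} (a b : R) : `|a| <= 1 -> `|b| <= 1 -> `|a - b| <= 2.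
Proof. by move=> a1 b1; apply: (le_trans (ler_normB _ _)); rewrite -[2]/(1 + 1) lerD. Qed.

Lemma ler_sum_sub {R : realType} N (f g : 'I_N -> R) (e1 e2 : R) :
  \sum_(k < N) e1 <= e2 -> (forall k, f k - e1 <= g k) ->
  \sum_k f k - e2 <= \sum_k g k.
Proof.
move=> e12 fg; apply: (@le_trans _ _ (\sum_k f k - \sum_(k < N) e1)).
  by rewrite lerD2l lerN2.
by rewrite -sumrB; apply: ler_sum => k _.
Qed.

(** * Decomposition according to the class of the next state *)

Section partition.
Context {d : measure_display} {R : realType} {T : measurableType d}
  (M : nat) (Sp : 'I_M -> set T) (HSmeas : forall i, measurable (Sp i))
  (HSdisj : forall i j, i != j -> Sp i `&` Sp j = set0)
  (HScover : \bigcup_i Sp i = setT)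
  (P : {measure set (T * R) -> \bar R}) (P1 : P setT = 1%E).

Definition cell (k : 'I_M) : set (T * R) := Sp k `*` setT.

Lemma measurable_cell k : measurable (cell k).
Proof. exact: measurableX. Qed.

Lemma class_exists (x : T) : exists k, Sp k x.
Proof. by have : [set: T] x by []; rewrite -HScover => -[k _ ?]; exists k. Qed.

Lemma sum_cell (f : T * R -> R) p : \sum_(k < M) (f \_ (cell k)) p = f p.
Proof.
have [k kp] := class_exists p.1.
rewrite (bigD1 k)//= big1 ?addr0.
  by rewrite patchE mem_set.
move=> l lk; rewrite patchE memNset// => -[/= lp _].
have : (Sp l `&` Sp k) p.1 by [].
by rewrite HSdisj.
Qed.

Lemma integrable_cells (f : T * R -> R) :
  (forall k, P.-integrable (cell k) (EFin \o f)) ->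
  P.-integrable setT (EFin \o f) /\ \int[P]_p f p = \sum_k \int[P]_(p in cell k) f p.
Proof.
move=> If.
have If' k : P.-integrable setT (EFin \o (f \_ (cell k))).
  rewrite -restrict_EFin; apply/integrable_restrict => //; first exact: measurable_cell.
  by rewrite setTI.
have fE : f = (fun p => \sum_(k < M) (f \_ (cell k)) p).
  by apply/funext => p; rewrite sum_cell.
split; first by rewrite [X in EFin \o X]fE; exact: (integrable_sumr P1).
rewrite [in LHS]fE (Rintegral_sum P1)//.
by apply: eq_bigr => k _; rewrite -Rintegral_mkcond.
Qed.

Lemma Rintegral_cells (f : T * R -> R) : P.-integrable setT (EFin \o f) ->
  \int[P]_p f p = \sum_k \int[P]_(p in cell k) f p.
Proof.
move=> If; apply: (integrable_cells _).2 => k.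
by apply: integrableS If => //; exact: measurable_cell.
Qed.

Lemma Rintegral_null (D : set (T * R)) (f : T * R -> R) : measurable D ->
  P D = 0%E -> P.-integrable D (EFin \o f) -> \int[P]_(p in D) f p = 0.
Proof.
move=> mD PD If; rewrite /Rintegral null_set_integral//.
by case/integrableP : If.
Qed.

Lemma integrable_null (D : set (T * R)) (f : T * R -> R) : measurable D ->
  measurable_fun D f -> P D = 0%E -> P.-integrable D (EFin \o f).
Proof.
move=> mD mf PD; apply/integrableP; split; first exact/measurable_EFinP.
rewrite null_set_integral//; apply/measurable_EFinP.
by apply: measurableT_comp => //.
Qed.

End partition.

(** * Asymptotics of transition probabilities and moments *)

Section asymptotics.
Context (d : measure_display) (R : realType) (T : measurableType d)
  (M : nat) (Sp : 'I_M -> set T)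
  (Q : R -> R.-pker T ~> (T * R)%type)
  (Pm : R -> 'I_M -> 'I_M -> R) (tau : R -> 'I_M -> R)
  (tau0 : 'I_M -> R) (P0 : 'I_M -> 'I_M -> R)
  (HSmeas : forall i, measurable (Sp i))
  (HSdisj : forall i j, i != j -> Sp i `&` Sp j = set0)
  (HScover : \bigcup_i Sp i = setT)
  (Hsupp : forall eps x, 0 < eps -> Q eps x [set p | p.2 < 0] = 0%E)
  (Ha_diag : forall eps i x, 0 < eps -> Sp i x -> Pk (Q eps) x (Sp i) = 0%E)
  (Ha_dich : forall i j, i != j ->
     ((forall eps x, 0 < eps -> Sp i x -> Pk (Q eps) x (Sp j) = 0%E) /\
      (forall eps, 0 < eps -> Pm eps i j = 0))
     \/
     ((forall eps, 0 < eps -> 0 < Pm eps i j) /\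
      (forall e : R, 0 < e -> exists2 delta : R, 0 < delta &
         forall eps x, 0 < eps < delta -> Sp i x ->
           `| fine (Pk (Q eps) x (Sp j)) / Pm eps i j - 1 | < e)))
  (Ha_diag0 : forall eps i, 0 < eps -> Pm eps i i = 0)
  (Ha_sum : forall eps i, 0 < eps -> \sum_j Pm eps i j = 1)
  (Hb_pos : forall eps i, 0 < eps -> 0 < tau eps i)
  (Hb : forall i j, (forall eps, 0 < eps -> 0 < Pm eps i j) ->
     forall e : R, 0 < e -> exists2 delta : R, 0 < delta &
       forall eps x, 0 < eps < delta -> Sp i x ->
         (`| ET (Q eps) x (Sp j) * ((tau eps i)^-1)%:E - 1 | < e%:E)%E)
  (Hc : exists C : R, exists2 eps0 : R, 0 < eps0 &
     forall eps i j x, 0 < eps <= eps0 ->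
       (forall eps', 0 < eps' -> 0 < Pm eps' i j) -> Sp i x ->
       (VarT (Q eps) x (Sp j) <= (C * (tau eps i) ^+ 2)%:E)%E)
  (Hd : forall (f : R -> R), bounded_continuous f ->
     forall i j1 j2,
       (forall eps, 0 < eps -> 0 < Pm eps i j1) ->
       (forall eps, 0 < eps -> 0 < Pm eps i j2) ->
     forall e : R, 0 < e -> exists2 delta : R, 0 < delta &
       forall eps x1 x2, 0 < eps < delta -> Sp i x1 -> Sp i x2 ->
         `| Ef (Q eps) f (tau eps i) x1 (Sp j1)
            - Ef (Q eps) f (tau eps i) x2 (Sp j2) | < e)
  (He : forall i j (xs : nat -> T) (epss : nat -> R) (xi : probability R R),
     (forall eps, 0 < eps -> 0 < Pm eps i j) ->
     (forall n, Sp i (xs n)) ->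
     (forall n, 0 < epss n) -> (forall n, epss n.+1 <= epss n) ->
     epss @ \oo --> 0 ->
     (forall f : R -> R, bounded_continuous f ->
        (fun n => Ef (Q (epss n)) f (tau (epss n) i) (xs n) (Sp j)) @ \oo
          --> fine (\int[xi]_r (f r)%:E)) ->
     forall r : R, xi [set r] = 0%E)
  (Htau : forall i, tau eps i @[eps --> 0^'+] --> tau0 i)
  (Htau_range : forall i, 0 <= tau0 i <= 1)
  (HP0 : forall i j, Pm eps i j @[eps --> 0^'+] --> P0 i j)
  (Herg : forall i j, connect (fun a b => 0 < P0 a b) i j).

(** By the dichotomy in (a), this is the condition that the transition probability from class [i] to
    class [j] is not identically zero. *)
Definition edge i j := forall eps, 0 < eps -> 0 < Pm eps i j.

Lemma near0_gt0 : \forall eps \near (0 : R)^'+, 0 < eps.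
Proof. exact: nbhs_right_gt. Qed.

Lemma edge_dec i j : edge i j \/
  ((forall eps x, 0 < eps -> Sp i x -> Pk (Q eps) x (Sp j) = 0%E) /\
   (forall eps, 0 < eps -> Pm eps i j = 0)).
Proof.
have [<-|ij] := eqVneq i j; last by case: (Ha_dich ij) => [?|[? _]]; [right|left].
by right; split=> [eps x|eps] e0; [exact: Ha_diag|exact: Ha_diag0].
Qed.

Lemma Pm_ge0 eps i j : 0 < eps -> 0 <= Pm eps i j.
Proof. by move=> e0; case: (edge_dec i j) => [/(_ eps e0)/ltW//|[_ ->]]. Qed.

Lemma Pm_le1 eps i j : 0 < eps -> Pm eps i j <= 1.
Proof.
move=> e0; rewrite -(Ha_sum i e0) (bigD1 j)//= lerDl sumr_ge0// => k _.
exact: Pm_ge0.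
Qed.

Lemma P0_ge0 i j : 0 <= P0 i j.
Proof.
apply: (cvgr_to_ge (@HP0 i j)); near=> eps; apply: Pm_ge0.
by near: eps; exact: near0_gt0.
Unshelve. all: by end_near. Qed.

Lemma P0_le1 i j : P0 i j <= 1.
Proof.
apply: (cvgr_to_le (@HP0 i j)); near=> eps; apply: Pm_le1.
by near: eps; exact: near0_gt0.
Unshelve. all: by end_near. Qed.

Lemma P0_nonedge i j : (forall eps, 0 < eps -> Pm eps i j = 0) -> P0 i j = 0.
Proof.
move=> Pm0; apply/eqP; rewrite eq_le P0_ge0 andbT.
apply: (cvgr_to_le (@HP0 i j)); by near=> eps; rewrite Pm0.
Unshelve. all: by end_near. Qed.

Lemma P0_sum i : \sum_j P0 i j = 1.
Proof.
have c : (\sum_j Pm eps i j) @[eps --> 0^'+] --> \sum_j P0 i j.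
  by apply: cvg_sum_ord => j; exact: (@HP0 i j).
apply/eqP; rewrite eq_le; apply/andP; split.
  by apply: (cvgr_to_le c); near=> eps; rewrite Ha_sum.
by apply: (cvgr_to_ge c); near=> eps; rewrite Ha_sum.
Unshelve. all: by end_near. Qed.

Lemma edge_of_P0 i j : 0 < P0 i j -> edge i j.
Proof. by case: (edge_dec i j) => // -[_ /P0_nonedge->]; rewrite ltxx. Qed.

Lemma exists_P0 i : exists j, 0 < P0 i j.
Proof.
apply: contrapT => nk; have := P0_sum i; rewrite big1 => [/eqP|k _].
  by rewrite eq_sym oner_eq0.
apply/eqP; rewrite eq_le P0_ge0 andbT leNgt; apply/negP => Pik.
by apply: nk; exists k.
Qed.

Lemma Pk_cvg (e : R) : 0 < e -> \forall eps \near (0 : R)^'+, forall j k x, Sp j x ->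
  (edge j k -> 0 < fine (Pk (Q eps) x (Sp k))) /\
  `|fine (Pk (Q eps) x (Sp k)) - P0 j k| < e.
Proof.
move=> e0.
apply: near_forall2 => j k.
case: (edge_dec j k) => [ejk|[Pk0 Pm0]]; last first.
  near=> eps => x jx; have eps0 : 0 < eps by near: eps; exact: near0_gt0.
  rewrite Pk0// (P0_nonedge Pm0) subrr normr0; split => // ejk.
  by have := ejk _ eps0; rewrite Pm0// ltxx.
have jk : j != k.
  by apply/eqP => jk; have := ejk 1 ltr01; rewrite jk Ha_diag0// ltxx.
case: (Ha_dich jk) => [[_ Pm0]|[_ H]].
  by have := ejk 1 ltr01; rewrite Pm0// ltxx.
(* The bound [1 / 2] keeps the ratio, hence [Pk], positive; the bound [e / 2] controls the distance
   to [Pm]. *)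
have e1 : 0 < Num.min (1 / 2) (e / 2) by rewrite lt_min !divr_gt0.
have H1 := (near_at_right0 (fun eps => forall x, Sp j x ->
  `|fine (Pk (Q eps) x (Sp k)) / Pm eps j k - 1| < Num.min (1 / 2) (e / 2))).2.
have {}H1 : \forall eps \near (0 : R)^'+, forall x, Sp j x ->
    `|fine (Pk (Q eps) x (Sp k)) / Pm eps j k - 1| < Num.min (1 / 2) (e / 2).
  by apply: H1; have [del del0 hdel] := H _ e1; exists del => // eps ed x; exact: hdel.
have H2 : \forall eps \near (0 : R)^'+, `|P0 j k - Pm eps j k| < e / 2.
  by have /(@cvgrPdist_lt _ R^o) := @HP0 j k; apply; rewrite divr_gt0.
near=> eps => x jx; have eps0 : 0 < eps by near: eps; exact: near0_gt0.
have Pme := ejk _ eps0; have Pm1 := Pm_le1 j k eps0.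
have h1 : forall x, Sp j x -> `|fine (Pk (Q eps) x (Sp k)) / Pm eps j k - 1| < Num.min (1 / 2) (e / 2).
  by near: eps.
have {}h1 := h1 x jx; have h2 : `|P0 j k - Pm eps j k| < e / 2 by near: eps.
set p := fine _ in h1 *.
have pE : p = p / Pm eps j k * Pm eps j k by rewrite divfK// gt_eqF.
move: h1; rewrite lt_min => /andP[h3 h4]; split=> [_|].
  rewrite pE mulr_gt0//; move: h3; rewrite ltr_norml => /andP[]; lra.
have : `|p - Pm eps j k| <= e / 2.
  rewrite pE -[X in _ - X]mul1r -mulrBl normrM (gtr0_norm Pme).
  by apply: (le_trans _ (ltW h4)); rewrite ler_piMr.
move: h2; rewrite ltr_norml !ler_norml => /andP[? ?] /andP[? ?].
by rewrite ltr_norml; apply/andP; split; lra.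
Unshelve. all: by end_near. Qed.

Let Q1 eps x : Q eps x setT = 1%E. Proof. exact: (prob_kernel (s := Q eps) x). Qed.

Let mcell k : measurable (@cell d R T M Sp k). Proof. exact: measurable_cell. Qed.

Let mhold : measurable_fun setT (@holding R T). Proof. exact: measurable_holding. Qed.

Let mhold2 : measurable_fun setT (fun p : T * R => holding p ^+ 2).
Proof. exact: measurable_funX. Qed.

Lemma sum_fine_Pk eps x : \sum_k fine (Pk (Q eps) x (Sp k)) = 1.
Proof.
have := Rintegral_cells HSmeas HSdisj HScover (Q1 eps x) (integrable_cstr (Q1 eps x) 1).
rewrite Rintegral_cst// fine_prob_setT// mulr1 => ->.
by apply: eq_bigr => k _; rewrite Rintegral_cst// mul1r.
Qed.

(** An infinite integral over the cell would survive multiplication by the positive factor [1 / Pk];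
    so finiteness of the extended-valued mean yields integrability. *)
Lemma ET_fin eps x k : 0 < eps -> 0 < fine (Pk (Q eps) x (Sp k)) ->
  ET (Q eps) x (Sp k) \is a fin_num ->
  (Q eps x).-integrable (cell Sp k) (EFin \o @holding R T) /\
  fine (ET (Q eps) x (Sp k)) * fine (Pk (Q eps) x (Sp k)) =
    \int[Q eps x]_(p in cell Sp k) holding p.
Proof.
move=> e0; set pk := fine _ => pk0.
have JE : (\int[Q eps x]_(p in cell Sp k) (p.2)%:E = \int[Q eps x]_(p in cell Sp k) (holding p)%:E)%E.
  apply: ae_eq_integral => //.
  - by apply/measurable_EFinP; exact: measurable_funTS measurable_snd.
  - by apply/measurable_EFinP; exact: measurable_funTS.
  - by apply: filterS (ae_holding (fun x => Hsupp x e0) x) => p -> _.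
rewrite /ET -/(cell Sp k) -/pk JE.
have J0 : (0 <= \int[Q eps x]_(p in cell Sp k) (holding p)%:E)%E.
  by apply: integral_ge0 => p _; rewrite lee_fin holding_ge0.
move=> Efin.
have Jfin : (\int[Q eps x]_(p in cell Sp k) (holding p)%:E < +oo)%E.
  rewrite ltey; apply/eqP => Joo; move: Efin.
  by rewrite Joo gt0_mulye ?lte_fin ?invr_gt0.
split.
  apply/integrableP; split; first by apply/measurable_EFinP; exact: measurable_funTS.
  rewrite (eq_integral (fun p => (holding p)%:E))// => p _.
  by rewrite /= ger0_norm// holding_ge0.
rewrite /Rintegral; set J := (\int[_]_(_ in _) _)%E in J0 Jfin *.
have Jf : J \is a fin_num by rewrite ge0_fin_numE.
by rewrite fineM// mulfVK// gt_eqF.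
Qed.

Lemma first_moment_cell (e : R) : 0 < e -> \forall eps \near (0 : R)^'+, forall j k x,
  Sp j x -> edge j k ->
  (Q eps x).-integrable (cell Sp k) (EFin \o @holding R T) /\
  `|\int[Q eps x]_(p in cell Sp k) holding p - fine (Pk (Q eps) x (Sp k)) * tau eps j|
    <= e * (fine (Pk (Q eps) x (Sp k)) * tau eps j).
Proof.
move=> e0.
have H : \forall eps \near (0 : R)^'+, forall j k, edge j k -> forall x, Sp j x ->
    (`| ET (Q eps) x (Sp k) * ((tau eps j)^-1)%:E - 1 | < e%:E)%E.
  apply: near_forall2 => j k.
  have [ejk|nejk] := pselect (edge j k); last by apply: nearW => eps /nejk.
  have [del del0 hdel] := Hb ejk e0.
  apply: (near_at_right0 (fun eps => edge j k -> forall x, Sp j x -> _)).2.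
  by exists del => // eps ed _ x; exact: hdel.
have H2 := Pk_cvg e0.
near=> eps => j k x jx ejk.
have eps0 : 0 < eps by near: eps; exact: near0_gt0.
have t0 := Hb_pos j eps0.
have h1 : (`| ET (Q eps) x (Sp k) * ((tau eps j)^-1)%:E - 1 | < e%:E)%E.
  by move: j k ejk x jx {t0}; near: eps.
have h2 : 0 < fine (Pk (Q eps) x (Sp k)).
  have : forall j k x, Sp j x -> (edge j k -> 0 < fine (Pk (Q eps) x (Sp k))) /\
    `|fine (Pk (Q eps) x (Sp k)) - P0 j k| < e by near: eps.
  by move=> /(_ j k x jx)[+ _]; exact.
have Efin : ET (Q eps) x (Sp k) \is a fin_num.
  move: h1; case: (ET _ _ _) => //.
    by rewrite gt0_mulye ?lte_fin ?invr_gt0.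
  by rewrite gt0_mulNye ?lte_fin ?invr_gt0.
have [Ih Eh] := ET_fin eps0 h2 Efin; split => //.
move: h1 Eh; rewrite -(fineK Efin) /=; set E := fine (ET _ _ _); set p := fine _ => h1 <-.
have {}h1 : `|E / tau eps j - 1| < e by move: h1; rewrite lte_fin.
rewrite (_ : E * p - p * tau eps j = (E / tau eps j - 1) * (p * tau eps j)); last first.
  by field; rewrite gt_eqF.
have pt : 0 < p * tau eps j by rewrite mulr_gt0.
by rewrite normrM (gtr0_norm pt) ler_wpM2r ?(ltW h1)// ltW.
Unshelve. all: by end_near. Qed.

Lemma second_moment_cell : exists2 C : R, 0 <= C & \forall eps \near (0 : R)^'+, forall j k x,
  Sp j x -> edge j k ->
  (Q eps x).-integrable (cell Sp k) (EFin \o (fun p => holding p ^+ 2)) /\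
  \int[Q eps x]_(p in cell Sp k) (holding p ^+ 2)
    <= C * (fine (Pk (Q eps) x (Sp k)) * tau eps j ^+ 2).
Proof.
have [C0 [eps1 eps10 HC]] := Hc.
(* From [p.2 ^+ 2 <= 2 * (p.2 - mm) ^+ 2 + 2 * mm ^+ 2]: condition (c) bounds the first term, and
   the conditional mean [mm] is at most [2 * tau eps j], which gives the 8. *)
exists (2 * `|C0| + 8); first by rewrite addr_ge0// mulr_ge0.
have H1 := first_moment_cell ltr01.
have H2 := Pk_cvg ltr01.
have H3 : \forall eps \near (0 : R)^'+, eps <= eps1.
  by apply: (near_at_right0 (fun eps => eps <= eps1)).2; exists eps1 => // eps /andP[_ /ltW].
near=> eps => j k x jx ejk.
have eps0 : 0 < eps by near: eps; exact: near0_gt0.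
have t0 := Hb_pos j eps0.
have [Ih h1] : (Q eps x).-integrable (cell Sp k) (EFin \o @holding R T) /\
  `|\int[Q eps x]_(p in cell Sp k) holding p - fine (Pk (Q eps) x (Sp k)) * tau eps j|
    <= 1 * (fine (Pk (Q eps) x (Sp k)) * tau eps j).
  by move: j k x jx ejk {t0}; near: eps.
have h2 : 0 < fine (Pk (Q eps) x (Sp k)).
  have : forall j k x, Sp j x -> (edge j k -> 0 < fine (Pk (Q eps) x (Sp k))) /\
    `|fine (Pk (Q eps) x (Sp k)) - P0 j k| < 1 by near: eps.
  by move=> /(_ j k x jx)[+ _]; exact.
have Vle : (VarT (Q eps) x (Sp k) <= (C0 * (tau eps j) ^+ 2)%:E)%E.
  by apply: HC => //; rewrite eps0/=; near: eps.
set pk := fine (Pk _ _ _) in h1 h2 Vle *.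
set J := \int[_]_(_ in _) _ in h1.
have JE : fine (ET (Q eps) x (Sp k)) = J / pk.
  rewrite /ET -/(cell Sp k) -/pk.
  have -> : (\int[Q eps x]_(p in cell Sp k) (p.2)%:E = J%:E)%E.
    rewrite /J /Rintegral fineK; last exact: integrable_fin_num.
    apply: ae_eq_integral => //.
    - by apply/measurable_EFinP; exact: measurable_funTS measurable_snd.
    - by apply/measurable_EFinP; exact: measurable_funTS.
    - by apply: filterS (ae_holding (fun x => Hsupp x eps0) x) => p -> _.
  by [].
pose mm := J / pk.
have mm2 : mm ^+ 2 <= 4 * tau eps j ^+ 2.
  have m1 : 0 <= mm <= 2 * tau eps j.
    move: h1; rewrite mul1r ler_norml => /andP[h3 h4]; apply/andP; split.
      by rewrite divr_ge0 ?(ltW h2)//; lra.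
    by rewrite ler_pdivrMr//; lra.
  case/andP: m1 => m1 m2; rewrite (_ : 4 * _ = (2 * tau eps j) ^+ 2); last by ring.
  by rewrite ler_pXn2r// nnegrE// mulr_ge0// ltW.
pose g (p : T * R) := (p.2 - mm) ^+ 2.
have mg : measurable_fun setT g.
  by apply: measurable_funX; apply: measurable_funB => //; exact: measurable_snd.
have V0 : (0 <= \int[Q eps x]_(p in cell Sp k) (g p)%:E)%E.
  by apply: integral_ge0 => p _; rewrite lee_fin sqr_ge0.
have Vle2 : (\int[Q eps x]_(p in cell Sp k) (g p)%:E <= (C0 * (tau eps j) ^+ 2 * pk)%:E)%E.
  move: Vle; rewrite /VarT -/(cell Sp k) -/pk JE -/mm => Vle.
  rewrite EFinM -lee_pdivrMr//.
have Ig : (Q eps x).-integrable (cell Sp k) (EFin \o g).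
  apply/integrableP; split; first by apply/measurable_EFinP; exact: measurable_funTS.
  rewrite (eq_integral (fun p => (g p)%:E)); last first.
    by move=> p _; rewrite /= ger0_norm// sqr_ge0.
  by apply: (le_lt_trans Vle2); rewrite ltry.
have Icst : (Q eps x).-integrable (cell Sp k) (EFin \o (fun=> 2 * mm ^+ 2)).
  exact: (@integrable_of_bounded _ _ _ _ (Q1 eps x) _ _ `|2 * mm ^+ 2|).
pose hh p := 2 * g p + 2 * mm ^+ 2.
have Ihh : (Q eps x).-integrable (cell Sp k) (EFin \o hh).
  by apply: integrable_addr => //; exact: integrable_mulrl.
have hh_ge p : holding p ^+ 2 <= hh p.
  have g0 := sqr_ge0 (p.2 - mm); have m0 := sqr_ge0 mm.
  rewrite /holding /hh /g; case: (leP p.2 0) => p0.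
    by rewrite expr0n/=; lra.
  have := sqr_ge0 (p.2 - 2 * mm).
  rewrite (_ : (p.2 - 2 * mm) ^+ 2 = 2 * (p.2 - mm) ^+ 2 + 2 * mm ^+ 2 - p.2 ^+ 2); [lra|ring].
have I2 : (Q eps x).-integrable (cell Sp k) (EFin \o (fun p => holding p ^+ 2)).
  apply: (le_integrable _ _ _ Ihh) => //.
    by apply/measurable_EFinP; exact: measurable_funTS.
  move=> p _; rewrite /= lee_fin !ger0_norm ?sqr_ge0//.
  by apply: le_trans (hh_ge p); exact: sqr_ge0.
split=> //.
apply: le_trans (_ : \int[Q eps x]_(p in cell Sp k) hh p <= _); first exact: le_Rintegral.
rewrite RintegralD//; last exact: integrable_mulrl.
rewrite RintegralZl// Rintegral_cst//.
have gle : \int[Q eps x]_(p in cell Sp k) g p <= C0 * tau eps j ^+ 2 * pk.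
  by rewrite -lee_fin /Rintegral fineK//; exact: integrable_fin_num.
rewrite -/(Pk (Q eps) x (Sp k)) -/pk.
have tp : 0 <= tau eps j ^+ 2 * pk by rewrite mulr_ge0 ?sqr_ge0// ltW.
have h5 : C0 * (tau eps j ^+ 2 * pk) <= `|C0| * (tau eps j ^+ 2 * pk).
  by rewrite ler_wpM2r// ler_norm.
have h6 : mm ^+ 2 * pk <= 4 * tau eps j ^+ 2 * pk by rewrite ler_wpM2r// ltW.
lra.
Unshelve. all: by end_near. Qed.

Lemma Pk_nonedge eps j k x : 0 < eps -> Sp j x -> ~ edge j k ->
  Q eps x (cell Sp k) = 0%E.
Proof. by move=> e0 jx nejk; case: (edge_dec j k) => // -[+ _]; exact. Qed.

(** The estimates on the cells are proportional to [Pk], whose sum over the classes is one, and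
    cells without an edge are null. *)
Lemma moments : exists2 C : R, 0 <= C & forall e, 0 < e ->
  \forall eps \near (0 : R)^'+, forall j x, Sp j x ->
  [/\ (Q eps x).-integrable setT (EFin \o @holding R T),
      (Q eps x).-integrable setT (EFin \o (fun p => holding p ^+ 2)),
      `|\int[Q eps x]_p holding p - tau eps j| <= e * tau eps j &
      \int[Q eps x]_p (holding p ^+ 2) <= C * tau eps j ^+ 2].
Proof.
have [C C0 HC] := second_moment_cell; exists C => // e e0.
have H1 := first_moment_cell e0.
near=> eps => j x jx; have eps0 : 0 < eps by near: eps; exact: near0_gt0.
have h1 : forall k, edge j k ->
  (Q eps x).-integrable (cell Sp k) (EFin \o @holding R T) /\
  `|\int[Q eps x]_(p in cell Sp k) holding p - fine (Pk (Q eps) x (Sp k)) * tau eps j|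
    <= e * (fine (Pk (Q eps) x (Sp k)) * tau eps j).
  by move=> k; move: j k x jx; near: eps.
have h2 : forall k, edge j k ->
  (Q eps x).-integrable (cell Sp k) (EFin \o (fun p => holding p ^+ 2)) /\
  \int[Q eps x]_(p in cell Sp k) (holding p ^+ 2)
    <= C * (fine (Pk (Q eps) x (Sp k)) * tau eps j ^+ 2).
  by move=> k; move: j k x jx {h1}; near: eps.
have nul k : ~ edge j k -> Q eps x (cell Sp k) = 0%E by exact: Pk_nonedge.
have I1 k : (Q eps x).-integrable (cell Sp k) (EFin \o @holding R T).
  have [/h1[]//|/nul n0] := pselect (edge j k).
  by apply: integrable_null => //; exact: measurable_funTS.
have I2 k : (Q eps x).-integrable (cell Sp k) (EFin \o (fun p => holding p ^+ 2)).
  have [/h2[]//|/nul n0] := pselect (edge j k).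
  by apply: integrable_null => //; exact: measurable_funTS.
have [J1 E1] := integrable_cells HSmeas HSdisj HScover (Q1 eps x) I1.
have [J2 E2] := integrable_cells HSmeas HSdisj HScover (Q1 eps x) I2.
split => //.
- rewrite E1 -[X in _ - X]mul1r -(sum_fine_Pk eps x) mulr_suml -sumrB.
  have -> : e * tau eps j = \sum_k e * (fine (Pk (Q eps) x (Sp k)) * tau eps j).
    by rewrite -mulr_sumr -mulr_suml sum_fine_Pk mul1r.
  apply: (le_trans (ler_norm_sum _ _ _)); apply: ler_sum => k _.
  have [/h1[]//|/nul n0] := pselect (edge j k).
  by rewrite Rintegral_null// /Pk n0/= !mul0r mulr0 subrr normr0.
- have -> : C * tau eps j ^+ 2 = \sum_k C * (fine (Pk (Q eps) x (Sp k)) * tau eps j ^+ 2).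
    by rewrite -mulr_sumr -mulr_suml sum_fine_Pk mul1r.
  rewrite E2; apply: ler_sum => k _.
  have [/h2[]//|/nul n0] := pselect (edge j k).
  by rewrite Rintegral_null// /Pk n0/= mul0r mulr0.
Unshelve. all: by end_near. Qed.

Lemma tau_near (e : R) : 0 < e -> \forall eps \near (0 : R)^'+, forall j,
  `|tau0 j - tau eps j| < e.
Proof.
move=> e0; apply: (@filter_forall _ _ (fun j => [set eps | `|tau0 j - tau eps j| < e])) => j.
by have /(@cvgrPdist_lt _ R^o) := @Htau j; apply.
Qed.

Lemma tau_le2 : \forall eps \near (0 : R)^'+, forall j, tau eps j <= 2.
Proof.
apply: filterS (tau_near ltr01) => eps h j.
by have := h j; have /andP[? ?] := Htau_range j; rewrite ltr_norml => /andP[? ?]; lra.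
Qed.

Lemma exists_edge j : exists k, edge j k.
Proof. by have [k /edge_of_P0 ?] := exists_P0 j; exists k. Qed.

(** Along a path of positive [P0], the transition probability into the next class is positive for
    some [eps], so that class cannot be empty. *)
Lemma class_nonempty (x0 : T) j : exists x, Sp j x.
Proof.
have [j0 j0x] := class_exists HScover x0.
have /connectP[p] := Herg j0 j.
elim: p j0 x0 j0x => [j0 x0 j0x _ ->|k p IH j0 x0 j0x /= /andP[Pk0 pp] jE]; first by exists x0.
have [eps epsP] := @filter_ex _ _ (at_right_proper_filter (0 : R)) _ (Pk_cvg ltr01).
have [/(_ (edge_of_P0 Pk0)) pk0 _] := epsP j0 k x0 j0x.
have [y ky] : exists y, Sp k y.
  apply: contrapT => nk; move: pk0; rewrite /Pk (_ : Sp k = set0) ?set0X ?measure0 ?ltxx//.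
  by apply/seteqP; split => // y ky; apply: nk; exists y.
exact: (IH k y ky pp jE).
Qed.

(** * Laws seen from one reference state per class *)

Context (ref : 'I_M -> T) (refP : forall j, Sp j (ref j)).

Lemma measurable_scaled (f : R -> R) (c : R) : continuous f ->
  measurable_fun setT (fun p : T * R => f (p.2 / c)).
Proof.
move=> cf; apply: (measurableT_comp (continuous_measurable_fun cf)).
by apply: measurable_funM => //; exact: measurable_snd.
Qed.

Lemma cell_Ef (f : R -> R) (c K : R) eps x k : continuous f ->
  (forall r, `|f r| <= K) -> 0 < fine (Pk (Q eps) x (Sp k)) ->
  \int[Q eps x]_(p in cell Sp k) f (p.2 / c) = fine (Pk (Q eps) x (Sp k)) * Ef (Q eps) f c x (Sp k)
  /\ `|Ef (Q eps) f c x (Sp k)| <= K.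
Proof.
move=> cf fK pk0; split; first by rewrite /Ef mulrC divfK// gt_eqF.
rewrite /Ef normrM normfV (gtr0_norm pk0) ler_pdivrMr//.
apply: (normr_Rintegral_le_cst (Q1 eps x)) => //; first exact: mcell.
exact: measurable_funTS (measurable_scaled _ cf).
Qed.

(** Condition (d) lets the conditional law given the target [k] be replaced by the one at the
    reference state given any fixed target [l]. If [k] is not reached from [j], both terms
    vanish. *)
Lemma law_cell_near (f : R -> R) (e : R) : bounded_continuous f -> 0 < e ->
  \forall eps \near (0 : R)^'+, forall j k l x, edge j l -> Sp j x ->
  `|\int[Q eps x]_(p in cell Sp k) f (p.2 / tau eps j)
    - P0 j k * Ef (Q eps) f (tau eps j) (ref j) (Sp l)| < e.
Proof.
move=> bf e0; have [cf [K fK]] := bf.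
have K0 : 0 <= K by apply: le_trans (fK 0).
(* The error in [Pk] is multiplied by at most [K], and the error in the conditional mean by at most
   1. *)
pose e1 := e / (K + 2).
have e10 : 0 < e1 by rewrite divr_gt0//; lra.
have eE : e1 * (K + 2) = e by rewrite divfK// gt_eqF//; lra.
have H1 := Pk_cvg e10.
have H2 l : \forall eps \near (0 : R)^'+, forall j k, edge j k -> edge j l -> forall x, Sp j x ->
    `|Ef (Q eps) f (tau eps j) x (Sp k) - Ef (Q eps) f (tau eps j) (ref j) (Sp l)| < e1.
  apply: near_forall2 => j k.
  have [ejk|nejk] := pselect (edge j k); last by apply: nearW => eps /nejk.
  have [ejl|nejl] := pselect (edge j l); last by apply: nearW => eps _ /nejl.
  have [del del0 hdel] := Hd bf ejk ejl e10.
  apply: (near_at_right0 (fun eps => edge j k -> edge j l -> forall x, Sp j x -> _)).2.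
  by exists del => // eps ed _ _ x jx; exact: hdel.
have {}H2 : \forall eps \near (0 : R)^'+, forall l j k, edge j k -> edge j l -> forall x, Sp j x ->
    `|Ef (Q eps) f (tau eps j) x (Sp k) - Ef (Q eps) f (tau eps j) (ref j) (Sp l)| < e1.
  exact: (@filter_forall _ _ (fun l => [set eps | forall j k, edge j k -> edge j l -> forall x, Sp j x ->
    `|Ef (Q eps) f (tau eps j) x (Sp k) - Ef (Q eps) f (tau eps j) (ref j) (Sp l)| < e1])).
near=> eps => j k l x ejl jx; have eps0 : 0 < eps by near: eps; exact: near0_gt0.
have [ejk|nejk] := pselect (edge j k); last first.
  have P0jk : P0 j k = 0.
    by apply/eqP; rewrite eq_le P0_ge0 andbT leNgt; apply/negP => /edge_of_P0.
  rewrite Rintegral_null//; first by rewrite P0jk mul0r subrr normr0.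
    exact: Pk_nonedge nejk.
  apply: integrable_null => //; last exact: Pk_nonedge nejk.
  exact: measurable_funTS (measurable_scaled _ cf).
have h1 : forall j k x, Sp j x -> (edge j k -> 0 < fine (Pk (Q eps) x (Sp k))) /\
    `|fine (Pk (Q eps) x (Sp k)) - P0 j k| < e1 by near: eps.
have [/(_ ejk) pk0 pkP] := h1 j k x jx.
have h2 : `|Ef (Q eps) f (tau eps j) x (Sp k) - Ef (Q eps) f (tau eps j) (ref j) (Sp l)| < e1.
  by move: l j k ejk ejl x jx {pk0 pkP}; near: eps.
have [-> EK] := cell_Ef (tau eps j) cf fK pk0.
move: pkP h2 EK; set p := fine _; set E1 := Ef _ _ _ x _; set E2 := Ef _ _ _ _ _.
move=> pkP h2 EK; rewrite (_ : _ - _ = (p - P0 j k) * E1 + P0 j k * (E1 - E2)); last by ring.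
apply: (le_lt_trans (ler_normD _ _)).
rewrite [X in X + _]normrM [X in _ + X]normrM (ger0_norm (P0_ge0 j k)).
have : `|p - P0 j k| * `|E1| <= e1 * K by rewrite ler_pM// ltW.
have : P0 j k * `|E1 - E2| <= 1 * e1 by rewrite ler_pM ?P0_ge0 ?P0_le1// ltW.
lra.
Unshelve. all: by end_near. Qed.

(** The unconditional law is the mixture of the conditional ones with weights close to [P0 j k];
    these sum to one and all the components nearly agree. *)
Lemma law_ref_near (f : R -> R) (e : R) : bounded_continuous f -> 0 < e ->
  \forall eps \near (0 : R)^'+, forall j l, edge j l ->
  `|\int[Q eps (ref j)]_p f (p.2 / tau eps j)
    - Ef (Q eps) f (tau eps j) (ref j) (Sp l)| < e.
Proof.
move=> bf e0; have [cf [K fK]] := bf.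
have M0 : 0 < M.+1%:R :> R by [].
have e10 : 0 < e / M.+1%:R by rewrite divr_gt0.
apply: filterS (law_cell_near bf e10) => eps h j l ejl.
rewrite (Rintegral_cells HSmeas HSdisj HScover (Q1 eps (ref j))); last first.
  apply: (integrable_of_bounded (Q1 eps (ref j)) (K := K)) => //.
  exact: measurable_scaled.
rewrite -[X in _ - X]mul1r -(P0_sum j) mulr_suml -sumrB.
apply: (le_lt_trans (ler_norm_sum _ _ _)).
apply: (@le_lt_trans _ _ (\sum_(k < M) e / M.+1%:R)).
  by apply: ler_sum => k _; apply/ltW/h.
rewrite sumr_const card_ord -[_ *+ M]mulr_natr mulrAC ltr_pdivrMr// ltr_pM2l//.
by rewrite ltr_nat.
Qed.

(** The auxiliary target [l] is eliminated: next class and scaled holding time become independent in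
    the limit, with a law depending on the class of the starting state only. *)
Lemma law_uniform_near (f : R -> R) (e : R) : bounded_continuous f -> 0 < e ->
  \forall eps \near (0 : R)^'+, forall j k x, Sp j x ->
  `|\int[Q eps x]_(p in cell Sp k) f (p.2 / tau eps j)
    - P0 j k * \int[Q eps (ref j)]_p f (p.2 / tau eps j)| < e.
Proof.
move=> bf e0; have e20 : 0 < e / 2 by rewrite divr_gt0.
apply: filterS (filterI (law_cell_near bf e20) (law_ref_near bf e20)) => eps [h1 h2] j k x jx.
have [l ejl] := exists_edge j.
have {}h1 := h1 j k l x ejl jx; have {}h2 := h2 j l ejl.
set A := \int[_]_(_ in _) _ in h1 *; set B := \int[_]_p _ in h2 *; set E := Ef _ _ _ _ _ in h1 h2.
rewrite (_ : A - _ = (A - P0 j k * E) - P0 j k * (B - E)); last by ring.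
apply: (le_lt_trans (ler_normB _ _)); rewrite normrM (ger0_norm (P0_ge0 j k)).
have : P0 j k * `|B - E| <= 1 * (e / 2) by rewrite ler_pM ?P0_ge0 ?P0_le1// ltW.
lra.
Qed.

(* Condition (d) speaks of one test function at a time; interpolating by finitely many ramps makes it uniform over all bounded Lipschitz functions. *)
Lemma law_lipschitz_near (Lf e : R) : 0 <= Lf -> 0 < e ->
  \forall eps \near (0 : R)^'+, forall j k x (f : R -> R), Sp j x ->
  (forall s, `|f s| <= 1) -> (forall s s', `|f s - f s'| <= Lf * `|s - s'|) ->
  `|\int[Q eps x]_(p in cell Sp k) f (holding p)
    - P0 j k * \int[Q eps (ref j)]_p f (holding p)| <= e.
Proof.
move=> Lf0 e0; have [C C0 HM] := moments.
(* Rescaling the time by [tau eps j], which is at most 2 near 0, multiplies the Lipschitz constant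
   by at most 2. *)
pose L := 2 * Lf; have L0 : 0 <= L by rewrite mulr_ge0.
pose g := e / (16 * (L + 1)); have g0 : 0 < g by rewrite divr_gt0// mulr_gt0//; lra.
have Lg : 2 * L * g <= e / 8.
  rewrite /g mulrA ler_pdivrMr; last by lra.
  have : L * e <= (L + 1) * e by rewrite ler_wpM2r//; lra.
  lra.
(* The last node is placed so far that the second-moment error [2 * C / A ^+ 2] of the interpolation
   is at most [e / 8]. *)
pose A0 := 16 * C / e + 1.
have A01 : 1 <= A0 by rewrite lerDr divr_ge0 ?(ltW e0)// mulr_ge0.
pose N := (Num.truncn (A0 / g)).+1.
pose A := N%:R * g.
have A0A : A0 <= A by rewrite -ler_pdivrMr//; exact/ltW/truncnS_gt.
have AC : 2 / A ^+ 2 * C <= e / 8.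
  rewrite mulrAC ler_pdivrMr ?exprn_gt0//; last by lra.
  have : A <= A ^+ 2 by rewrite expr2 ler_peMl; lra.
  have : e * A0 = 16 * C + e by rewrite /A0; field; rewrite gt_eqF.
  have : e * A0 <= e * A by rewrite ler_wpM2l// ltW.
  move=> h1 h2 h3; have : e * A <= e * A ^+ 2 by rewrite ler_wpM2l// ltW.
  lra.
(* The constant term contributes one error [e1], and each of the [N] ramps, whose coefficient is at
   most 2, contributes two. *)
pose e1 := e / 2 / (2 * N%:R + 1).
have N1 : 0 < 2 * N%:R + 1 :> R by rewrite ltr_wpDl// mulr_ge0.
have e10 : 0 < e1 by rewrite !divr_gt0.
have Hr : \forall eps \near (0 : R)^'+, forall l : 'I_N, forall j k x, Sp j x ->
  `|\int[Q eps x]_(p in cell Sp k) ramp g l (p.2 / tau eps j)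
    - P0 j k * \int[Q eps (ref j)]_p ramp g l (p.2 / tau eps j)| < e1.
  apply: (@filter_forall _ _ (fun l : 'I_N => [set eps | forall j k x, Sp j x ->
  `|\int[Q eps x]_(p in cell Sp k) ramp g l (p.2 / tau eps j)
    - P0 j k * \int[Q eps (ref j)]_p ramp g l (p.2 / tau eps j)| < e1])) => l.
  by apply: law_uniform_near e10; exact: ramp_bounded_continuous.
have Hp := Pk_cvg e10; have Ht := tau_le2; have Hm := HM 1 ltr01.
near=> eps => j k x f jx f1 fL; have eps0 : 0 < eps by near: eps; exact: near0_gt0.
have t0 := Hb_pos j eps0.
have t2 : tau eps j <= 2 by move: j x jx {t0}; near: eps; apply: filterS Ht.
pose Y (p : T * R) := holding p / tau eps j.
have Y0 p : 0 <= Y p by rewrite divr_ge0 ?holding_ge0// ltW.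
have YE p : Y p = Num.max (p.2 / tau eps j) 0.
  by rewrite /Y /holding maxr_pMl ?mul0r// invr_ge0 ltW.
pose ft r := f (tau eps j * r).
have ft1 r : `|ft r| <= 1 by exact: f1.
have ftL s s' : `|ft s - ft s'| <= L * `|s - s'|.
  apply: (le_trans (fL _ _)); rewrite -mulrBr normrM (gtr0_norm t0) mulrA.
  by rewrite ler_wpM2r// /L mulrC ler_wpM2r.
have fE p : f (holding p) = ft (Y p) by rewrite /ft /Y mulrC divfK// gt_eqF.
pose cs l := ft (l.+1%:R * g) - ft (l%:R * g).
pose W (p : T * R) := ft 0 + \sum_(l < N) cs l * ramp g l (p.2 / tau eps j).
have WE p : W p = interpolant ft g N (Y p).
  by rewrite /W /interpolant YE; congr (_ + _); apply: eq_bigr => l _; rewrite ramp_max0.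
have mramp l : measurable_fun setT (fun p : T * R => ramp g l (p.2 / tau eps j)).
  by apply: measurable_scaled; have [] := ramp_bounded_continuous g l.
have ramp1 l p : `|ramp g l p| <= 1.
  by have /andP[? ?] := ramp01 g l p; rewrite ger0_norm.
have mf : measurable_fun setT (fun p : T * R => f (holding p)).
  exact: measurableT_comp (lipschitz_measurable fL) mhold.
have mW : measurable_fun setT W.
  apply: measurable_funD => //; apply: measurable_sum => l; exact: measurable_funM.
have key z D : Sp j z -> measurable D ->
   `|\int[Q eps z]_(p in D) f (holding p) -
     (ft 0 * fine (Q eps z D) + \sum_(l < N) cs l * \int[Q eps z]_(p in D) ramp g l (p.2 / tau eps j))|
   <= e / 4.
  move=> jz mD.
  have [Ih Ih2 _ h2] : [/\ (Q eps z).-integrable setT (EFin \o @holding R T),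
      (Q eps z).-integrable setT (EFin \o (fun p => holding p ^+ 2)),
      `|\int[Q eps z]_p holding p - tau eps j| <= 1 * tau eps j &
      \int[Q eps z]_p (holding p ^+ 2) <= C * tau eps j ^+ 2].
    by move: j z jz {jx t0 t2 Y Y0 YE ft ft1 ftL fE cs W WE mramp mW}; near: eps.
  have If : (Q eps z).-integrable setT (EFin \o (fun p => f (holding p))).
    exact: (integrable_of_bounded (Q1 eps z) (K := 1)).
  have IW : (Q eps z).-integrable setT (EFin \o W).
    apply: (integrable_of_bounded (Q1 eps z) (K := 1 + \sum_(l < N) 2)) => // p _.
    apply: (le_trans (ler_normD _ _)); rewrite lerD//.
    apply: (le_trans (ler_norm_sum _ _ _)); apply: ler_sum => l _.
    rewrite normrM -[leRHS]mulr1 ler_pM//; exact: normrB_le2.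
  rewrite -(Rintegral_affine (Q1 eps z) N (ft 0) cs mD mramp); last by move=> l p; exact: ramp1.
  rewrite -/W -RintegralB//; [|exact: integrableS If|exact: integrableS IW].
  have IY : (Q eps z).-integrable setT (EFin \o (fun p => Y p ^+ 2)).
    rewrite (_ : (fun p => _) = (fun p => (tau eps j ^- 2) * holding p ^+ 2)).
      exact: integrable_mulrl.
    by apply/funext => p; rewrite /Y exprMn exprVn mulrC.
  have YC : \int[Q eps z]_p (Y p ^+ 2) <= C.
    rewrite (_ : (fun p => _) = (fun p => (tau eps j ^- 2) * holding p ^+ 2)); last first.
      by apply/funext => p; rewrite /Y exprMn exprVn mulrC.
    by rewrite RintegralZl// mulrC ler_pdivrMr ?exprn_gt0.
  apply: le_trans (_ : 2 * L * g + 2 / A ^+ 2 * C <= _).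
    2: by rewrite (_ : e / 4 = e / 8 + e / 8) ?lerD//; field.
  apply: (normr_Rintegral_le_moment (Q1 eps z) (Y := Y)) => //.
  - exact: integrable_subr.
  - by rewrite mulr_ge0 ?(ltW g0)// mulr_ge0.
  - by rewrite divr_ge0 ?sqr_ge0.
  - by move=> p; rewrite fE -[X in _ - X]/(W p) WE; exact: interpolant_le.
have k1 := key x (cell Sp k) jx (mcell k).
have k2 := key (ref j) setT (refP j) measurableT.
have hp : `|fine (Q eps x (cell Sp k)) - P0 j k| < e1.
  have : forall j k x, Sp j x -> (edge j k -> 0 < fine (Pk (Q eps) x (Sp k))) /\
    `|fine (Pk (Q eps) x (Sp k)) - P0 j k| < e1 by near: eps.
  by move=> /(_ j k x jx)[_].
have hr : forall l : 'I_N, `|\int[Q eps x]_(p in cell Sp k) ramp g l (p.2 / tau eps j)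
    - P0 j k * \int[Q eps (ref j)]_p ramp g l (p.2 / tau eps j)| < e1.
  have : forall l : 'I_N, forall j k x, Sp j x ->
  `|\int[Q eps x]_(p in cell Sp k) ramp g l (p.2 / tau eps j)
    - P0 j k * \int[Q eps (ref j)]_p ramp g l (p.2 / tau eps j)| < e1 by near: eps.
  by move=> + l => /(_ l j k x jx).
move: k1 k2; rewrite (fine_prob_setT (Q1 eps (ref j))) mulr1.
set I1 := \int[_]_(_ in _) _; set I2 := \int[_]_p f _.
set S1 := \sum_(l < N) _; set S2 := \sum_(l < N) _ => k1 k2.
have S12 : `|(ft 0 * fine (Q eps x (cell Sp k)) + S1) - P0 j k * (ft 0 + S2)| <= e / 2.
  rewrite (_ : _ - _ = ft 0 * (fine (Q eps x (cell Sp k)) - P0 j k) + (S1 - P0 j k * S2)); last by ring.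
  rewrite mulr_sumr -sumrB; apply: (le_trans (ler_normD _ _)).
  have h1 : `|ft 0 * (fine (Q eps x (cell Sp k)) - P0 j k)| <= 1 * e1.
    by rewrite normrM ler_pM// ltW.
  have h2 : e1 * (2 * N%:R + 1) = e / 2 by rewrite divfK// gt_eqF.
  have h3 : \sum_(l < N) 2 * e1 = 2 * e1 * N%:R by rewrite sumr_const card_ord mulr_natr.
  apply: (@le_trans _ _ (1 * e1 + \sum_(l < N) 2 * e1)).
    2: by rewrite h3 -h2 (_ : 1 * e1 + 2 * e1 * N%:R = e1 * (2 * N%:R + 1)) ?lexx//; ring.
  apply: lerD => //; apply: (le_trans (ler_norm_sum _ _ _)); apply: ler_sum => l _.
  rewrite mulrCA -mulrBr normrM ler_pM//; last exact/ltW/hr.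
  exact: normrB_le2.
rewrite (_ : I1 - _ = (I1 - (ft 0 * fine (Q eps x (cell Sp k)) + S1)) +
  ((ft 0 * fine (Q eps x (cell Sp k)) + S1) - P0 j k * (ft 0 + S2)) - P0 j k * (I2 - (ft 0 + S2))); last by ring.
have k3 : `|P0 j k * (I2 - (ft 0 + S2))| <= 1 * (e / 4).
  by rewrite normrM (ger0_norm (P0_ge0 j k)) ler_pM ?P0_ge0 ?P0_le1.
apply: (le_trans (ler_normB _ _)); apply: (le_trans (lerD (ler_normD _ _) (lexx _))).
by rewrite [leRHS](_ : e = e / 4 + e / 2 + 1 * (e / 4)) ?lerD//; field.
Unshelve. all: by end_near. Qed.

(** Otherwise a sequence [eps -> 0] keeps mass at least [c] in shrinking balls around [a]. As [tau]
    tends to 1, rescaling preserves this concentration, and a weak limit has an atom at [a], against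
    condition (e). *)
Lemma no_atoms i0 (a c : R) : tau0 i0 = 1 -> 0 < c -> exists2 del : R, 0 < del &
  \forall eps \near (0 : R)^'+, fine (Q eps (ref i0) [set p | `|holding p - a| < del]) < c.
Proof.
move=> tau1 c0; apply: contrapT => nex; have [C C0 HM] := moments.
have z0 m : 0 < m.+1%:R^-1 :> R by rewrite invr_gt0.
(* For each radius the negated claim provides such [eps] arbitrarily close to 0; the other three
   properties come along because they hold for all small [eps]. *)
pose good m eps := [/\ c <= fine (Q eps (ref i0) [set p | `|holding p - a| < m.+1%:R^-1]),
  `|1 - tau eps i0| < m.+1%:R^-1,
  (Q eps (ref i0)).-integrable setT (EFin \o (fun p => holding p ^+ 2)) &
  \int[Q eps (ref i0)]_p (holding p ^+ 2) <= C * tau eps i0 ^+ 2].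
have step m e : 0 < e -> exists eps, [/\ 0 < eps, eps < e, eps < m.+1%:R^-1 & good m eps].
  move=> e0; apply: contrapT => ne; apply: nex; exists m.+1%:R^-1 => //.
  have H1 := HM 1 ltr01; have H2 := tau_near (z0 m).
  near=> eps; rewrite ltNge; apply/negP => ce; apply: ne; exists eps; split.
  - by near: eps; exact: near0_gt0.
  - by near: eps; exact: nbhs_right_lt.
  - by near: eps; exact: nbhs_right_lt.
  - have [_ h1 _ h2] : [/\ (Q eps (ref i0)).-integrable setT (EFin \o @holding R T),
      (Q eps (ref i0)).-integrable setT (EFin \o (fun p => holding p ^+ 2)),
      `|\int[Q eps (ref i0)]_p holding p - tau eps i0| <= 1 * tau eps i0 &
      \int[Q eps (ref i0)]_p (holding p ^+ 2) <= C * tau eps i0 ^+ 2].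
      have : forall j x, Sp j x ->
  [/\ (Q eps x).-integrable setT (EFin \o @holding R T),
      (Q eps x).-integrable setT (EFin \o (fun p => holding p ^+ 2)),
      `|\int[Q eps x]_p holding p - tau eps j| <= 1 * tau eps j &
      \int[Q eps x]_p (holding p ^+ 2) <= C * tau eps j ^+ 2] by near: eps.
      by apply; exact: refP.
    have h3 : forall j, `|tau0 j - tau eps j| < m.+1%:R^-1 by near: eps.
    by split => //; have := h3 i0; rewrite tau1.
(* The value 0 is a default where the second component is not positive; the recursion below never
   meets that case. *)
have /choice[f fP] (me : nat * R) : exists eps, 0 < me.2 ->
    [/\ 0 < eps, eps < me.2, eps < me.1.+1%:R^-1 & good me.1 eps].
  have [me0|] := ltP 0 me.2; first by have [eps] := step me.1 me.2 me0; exists eps.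
  by exists 0.
(* Each term is taken below its predecessor because condition (e) speaks of decreasing sequences. *)
pose fix epss n := if n is n'.+1 then f (n, epss n') else f (0%N, 1).
have epssP n : [/\ 0 < epss n, epss n < n.+1%:R^-1, epss n.+1 <= epss n & good n (epss n)].
  have e0 m : 0 < epss m.
    by elim: m => [|m IH]; [have [] := fP (0%N, 1) ltr01|have [] := fP (m.+1, epss m) IH].
  have dec m : epss m.+1 <= epss m by have [_ /ltW] := fP (m.+1, epss m) (e0 m).
  by split => //; case: n => [|n]; [have [] := fP (0%N, 1) ltr01|have [] := fP (n.+1, epss n) (e0 n)
    |have [] := fP (0%N, 1) ltr01|have [] := fP (n.+1, epss n) (e0 n)].
have e0 n : 0 < epss n by have [] := epssP n.
pose Y n (p : T * R) := holding p / tau (epss n) i0.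
have t0 n : 0 < tau (epss n) i0 by exact: Hb_pos.
have mY n : measurable_fun setT (Y n) by exact: measurable_funM.
have YE n : (fun p => Y n p ^+ 2) = (fun p => (tau (epss n) i0 ^- 2) * holding p ^+ 2).
  by apply/funext => p; rewrite /Y exprMn exprVn mulrC.
have IY n : (Q (epss n) (ref i0)).-integrable setT (EFin \o (fun p => Y n p ^+ 2)).
  by have [_ _ _ [_ _ ? _]] := epssP n; rewrite YE; exact: integrable_mulrl.
have YC n : \int[Q (epss n) (ref i0)]_p (Y n p ^+ 2) <= C.
  have [_ _ _ [_ _ ? ?]] := epssP n.
  by rewrite YE RintegralZl// mulrC ler_pdivrMr ?exprn_gt0.
have conc del : 0 < del -> \forall n \near \oo,
    c <= fine (Q (epss n) (ref i0) [set p | `|Y n p - a| <= del]).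
  (* Below [r] the scale [tau] is at least [1 / 2], and the displacement by the ball and by the
     rescaling, at most [r * (1 + |a|)], is at most [del / 2]. *)
  move=> del0; pose r := Num.min (1 / 2) (del / (2 * (1 + `|a|))).
  have a1 : 0 < 1 + `|a| by rewrite ltr_pwDl.
  have r0 : 0 < r by rewrite lt_min !divr_gt0// mulr_gt0.
  apply: filterS (near_infty_natSinv_lt (PosNum r0)) => n /=.
  rewrite /r lt_min => /andP[r1 r2]; have [_ _ _ [ch th _ _]] := epssP n.
  apply: (le_trans ch).
  have mb s : measurable [set p : T * R | `|holding p - a| < s].
    rewrite (_ : [set p | _] = setT `&` (@holding R T) @^-1` (ball a s)).
      exact: (mhold measurableT (measurable_ball a s)).
    by rewrite setTI; apply/seteqP; split => p /=; rewrite /ball/= distrC.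
  have mb2 : measurable [set p : T * R | `|Y n p - a| <= del].
    rewrite (_ : [set p | _] = setT `&` (Y n) @^-1` `[a - del, a + del]%classic).
      exact: (mY n measurableT _ (measurable_itv _)).
    by rewrite setTI; apply/seteqP; split => p /=; rewrite in_itv/= ler_distl.
  apply: (fine_prob_le (Q1 _ _)) => // p /= ha.
  have t2 : 1 / 2 <= tau (epss n) i0.
    by move: th r1; rewrite ltr_norml => /andP[_]; move: (n.+1%:R^-1) => z; lra.
  rewrite (_ : Y n p - a = ((holding p - a) + a * (1 - tau (epss n) i0)) / tau (epss n) i0); last first.
    by rewrite /Y; field; rewrite gt_eqF.
  rewrite normrM normfV (gtr0_norm (t0 n)) ler_pdivrMr//.
  apply: (le_trans (ler_normD _ _)); rewrite normrM.
  have h1 : `|a| * `|1 - tau (epss n) i0| <= `|a| * n.+1%:R^-1 by rewrite ler_wpM2l// ltW.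
  have h2 : n.+1%:R^-1 * (2 * (1 + `|a|)) < del by rewrite -ltr_pdivlMr// mulr_gt0.
  have h3 : del * (1 / 2) <= del * tau (epss n) i0 by rewrite ler_wpM2l// ltW.
  move: ha h1 h2 h3; move: (n.+1%:R^-1) => z; move: (`|holding p - a|) => u; lra.
have [phi [xi [phiS phixi xia]]] := atom_of_concentration (fun n => Q1 (epss n) (ref i0)) mY IY YC conc.
have phin n : (n <= phi n)%N by elim: n => // n IH; exact: (leq_ltn_trans IH).
have zle n : epss (phi n) < n.+1%:R^-1.
  have [_ h _ _] := epssP (phi n); apply: (lt_le_trans h).
  by rewrite lef_pV2 ?posrE// ler_nat ltnS phin.
have nearphi (A : set R) : (\forall eps \near (0 : R)^'+, A eps) ->
    \forall n \near \oo, A (epss (phi n)).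
  move=> /near_at_right0[del del0 hdel].
  apply: filterS (near_infty_natSinv_lt (PosNum del0)) => n /= nd.
  by apply: hdel; rewrite e0/=; apply: lt_trans nd; exact: zle.
have [l i0l] := exists_edge i0.
have := @He i0 l (fun=> ref i0) (epss \o phi) xi i0l (fun=> refP i0) (fun n => e0 (phi n)).
have dec m n : (m <= n)%N -> epss n <= epss m.
  move=> mn; rewrite -(subnK mn); elim: (n - m)%N => // k IH.
  by apply: le_trans IH; have [_ _ ? _] := epssP (k + m)%N.
move=> /(_ (fun n => dec _ _ (ltnW (phiS n)))).
have cv0 : (epss \o phi) @ \oo --> (0 : R).
  apply/(@cvgrPdist_lt _ R^o) => e' e'0.
  apply: filterS (near_infty_natSinv_lt (PosNum e'0)) => n /= ne.
  by rewrite sub0r normrN gtr0_norm//; apply: lt_trans ne.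
move=> /(_ cv0) H; suff : xi [set a] = 0%E.
  by move=> xi0; move: xia; rewrite xi0 lee_fin leNgt c0.
(* Condition (e) concerns conditional laws given the target [l]; they have the same weak limit as
   the unconditional laws of [Y], for which convergence is known. *)
apply: H => g bg; rewrite -/(Rintegral xi setT g).
apply/(@cvgrPdist_lt _ R^o) => e' e'0.
have e2 : 0 < e' / 2 by rewrite divr_gt0.
have h1 := nearphi _ (law_ref_near bg e2).
have h2 : \forall n \near \oo, `|\int[xi]_x g x - \int[Q (epss (phi n)) (ref i0)]_p g (Y (phi n) p)| < e' / 2.
  by have /(@cvgrPdist_lt _ R^o) := phixi g bg; apply.
apply: filterS (filterI h1 h2) => n [/(_ i0 l i0l) h3 h4] /=.
have [cg [K gK]] := bg.
have gE : \int[Q (epss (phi n)) (ref i0)]_p g (p.2 / tau (epss (phi n)) i0) =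
    \int[Q (epss (phi n)) (ref i0)]_p g (Y (phi n) p).
  rewrite /Rintegral; congr fine; apply: ae_eq_integral => //.
  - by apply/measurable_EFinP; exact: measurable_scaled.
  - apply/measurable_EFinP; apply: measurableT_comp => //; exact: continuous_measurable_fun.
  - apply: filterS (ae_holding (fun x => Hsupp x (e0 (phi n))) (ref i0)) => p hp _.
    by rewrite /Y hp.
move: h3; rewrite gE => h3.
set u := \int[xi]_x _ in h4 *; set v := \int[_]_p _ in h3 h4; set w := Ef _ _ _ _ _ in h3 *.
rewrite (_ : u - w = (u - v) + (v - w)); last by ring.
by apply: (le_lt_trans (ler_normD _ _)); rewrite [ltRHS](_ : e' = e' / 2 + e' / 2) ?ltrD//; field.
Unshelve. all: by end_near. Qed.

(** * Positivity of the stationary weights *)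

Context (lam : 'I_M -> R) (lam0 : forall i, 0 <= lam i) (lam1 : \sum_i lam i = 1)
  (lamP : forall j, lam j = \sum_i lam i * P0 i j)
  (i0 : 'I_M) (tau0i0 : tau0 i0 = 1).

(** Some weight is positive since they sum to one, and invariance carries positivity along the paths
    of [P0]. At [i0] this makes the stationary mean sojourn positive. *)
Lemma lam_gt0 j : 0 < lam j.
Proof.
have [k lamk] : exists k, 0 < lam k.
  apply: contrapT => nk; have : \sum_i lam i = 0.
    apply: big1 => k _; apply/eqP; rewrite eq_le lam0 andbT leNgt; apply/negP => lamk.
    by apply: nk; exists k.
  by rewrite lam1 => /eqP; rewrite oner_eq0.
have /connectP[p] := Herg k j.
elim: p k lamk => [k lamk _ -> //|l p IH k lamk /= /andP[Pkl pp] jE].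
apply: (IH l _ pp jE); rewrite lamP (bigD1 k)//=; apply: ltr_wpDr.
  by rewrite sumr_ge0// => m _; rewrite mulr_ge0// P0_ge0.
by rewrite mulr_gt0.
Qed.

Lemma lam_tau0_gt0 : 0 < \sum_j lam j * tau0 j.
Proof.
rewrite (bigD1 i0)//= tau0i0 mulr1; apply: ltr_wpDr; last exact: lam_gt0.
by rewrite sumr_ge0// => m _; rewrite mulr_ge0//; have /andP[] := Htau_range m.
Qed.

(** * The lower bound for one class *)

Section one_class.
Context (i : 'I_M) (h : R) (h0 : 0 < h).
Local Notation v eps := (value (Q eps) (Sp i) h).

(** The infimum keeps exactly the information needed for lower bounds and reduces the functions of
    state and time to [M] functions of time with the same Lipschitz constant. *)
Definition class_inf eps j t : R := inf [set v eps (x, t) | x in Sp j].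

Let has_infv eps j t : has_inf [set v eps (x, t) | x in Sp j].
Proof.
split; first by exists (v eps (ref j, t)), (ref j).
by exists 0 => _ [x _ <-]; exact: value_ge0.
Qed.

Lemma class_inf_le eps j t x : Sp j x -> class_inf eps j t <= v eps (x, t).
Proof. by move=> jx; apply: ge_inf; [have [] := has_infv eps j t|exists x]. Qed.

Lemma le_class_inf eps j t c : (forall x, Sp j x -> c <= v eps (x, t)) ->
  c <= class_inf eps j t.
Proof.
move=> cv; apply: lb_le_inf; first by have [] := has_infv eps j t.
by move=> _ [x jx <-]; exact: cv.
Qed.

Lemma class_inf01 eps j t : 0 <= class_inf eps j t <= 1.
Proof.
apply/andP; split; first by apply: le_class_inf => x _; exact: value_ge0.
by apply: (le_trans (class_inf_le eps t (refP j))); exact: value_le1.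
Qed.

Lemma class_inf_lip eps j t t' :
  `|class_inf eps j t - class_inf eps j t'| <= h^-1 * `|t - t'|.
Proof.
have H s s' : class_inf eps j s - h^-1 * `|s - s'| <= class_inf eps j s'.
  apply: le_class_inf => x jx; have := class_inf_le eps s jx.
  have := value_lip (Q eps) (HSmeas i) h0 x s s'.
  rewrite mulrC ler_norml => /andP[_]; lra.
by rewrite ler_norml; have := H t t'; have := H t' t; rewrite (distrC t'); lra.
Qed.

(** On each cell the continuation is at least the infimum over the class entered, a function of the
    holding time alone. The law from [x] is then exchanged for that from [ref j]. Uniformity in [t]
    holds because [t] only shifts test functions of fixed Lipschitz constant. *)
Lemma superharmonic_near (eta : R) : 0 < eta -> \forall eps \near (0 : R)^'+, forall j t,
  (j == i)%:R * \int[Q eps (ref i)]_p trap h t (holding p)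
  + \sum_k P0 j k * \int[Q eps (ref j)]_p class_inf eps k (t - holding p) - eta
  <= class_inf eps j t.
Proof.
(* Up to [M] cell errors for the reward and as many for the continuation, half of [eta] each. *)
move=> eta0; pose e1 := eta / (2 * M.+1%:R).
have e10 : 0 < e1 by rewrite divr_gt0// mulr_gt0.
have hV : 0 <= h^-1 by rewrite invr_ge0 ltW.
have H := law_lipschitz_near hV e10.
near=> eps => j t; apply: le_class_inf => x jx.
have hF : forall j k x (f : R -> R), Sp j x ->
  (forall s, `|f s| <= 1) -> (forall s s', `|f s - f s'| <= h^-1 * `|s - s'|) ->
  `|\int[Q eps x]_(p in cell Sp k) f (holding p)
    - P0 j k * \int[Q eps (ref j)]_p f (holding p)| <= e1.
  by move: {jx} x => _; near: eps.
have Itr z D : measurable D -> (Q eps z).-integrable D (EFin \o (fun p => trap h t (holding p))).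
  move=> mD; apply: (integrable_of_bounded (Q1 eps z) (K := 1)) => //.
    by apply: measurable_funTS; exact: measurable_trap.
  by move=> p _; rewrite ger0_norm ?trap_ge0 ?trap_le1.
have Iv z D : measurable D -> (Q eps z).-integrable D (EFin \o (fun p => v eps (p.1, t - holding p))).
  by move=> mD; apply: integrableS (integrable_value_shift (Q eps) (HSmeas i) h0 z t).
have Im k z D : measurable D -> (Q eps z).-integrable D (EFin \o (fun p => class_inf eps k (t - holding p))).
  move=> mD; apply: (integrable_of_bounded (Q1 eps z) (K := 1)) => //.
    apply: measurable_funTS; apply: measurableT_comp.
      exact: (lipschitz_measurable (class_inf_lip eps k)).
    exact: measurable_funB.
  by move=> p _; have /andP[? ?] := class_inf01 eps k (t - holding p); rewrite ger0_norm.
apply: le_trans (value_superharmonic (Q eps) (HSmeas i) h0 x t).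
rewrite RintegralD//; [|exact: integrable_mulrl (Itr _ _ _)|exact: Iv].
rewrite RintegralZl//; last exact: Itr.
have sumM : \sum_(k < M) e1 <= eta / 2.
  rewrite sumr_const card_ord -[_ *+ M]mulr_natr /e1 mulrAC ler_pdivrMr ?mulr_gt0//.
  by rewrite mulrA divfK// ler_pM2l// ler_nat.
have h1 : (j == i)%:R * \int[Q eps (ref i)]_p trap h t (holding p) - eta / 2 <=
    \1_(Sp i) x * \int[Q eps x]_p trap h t (holding p).
  have [ji|ji] := eqVneq j i; last first.
    rewrite mul0r add0r; apply: (@le_trans _ _ 0); first by rewrite oppr_le0 divr_ge0 ?ltW.
    by rewrite mulr_ge0 ?Rintegral_ge0// => p _; exact: trap_ge0.
  rewrite indicE mem_set ?mul1r -?ji//.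
  rewrite (Rintegral_cells HSmeas HSdisj HScover (Q1 eps x)); last exact: Itr.
  rewrite (_ : \int[Q eps (ref j)]_p _ = \sum_k P0 j k * \int[Q eps (ref j)]_p trap h t (holding p)).
    2: by rewrite -mulr_suml P0_sum mul1r.
  apply: (ler_sum_sub sumM) => k.
  have := hF j k x (trap h t) jx.
  move=> /(_ (fun s => _) (fun s s' => _)); rewrite ler_norml => H'.
  have /andP[+ _] : - e1 <= \int[Q eps x]_(p in cell Sp k) trap h t (holding p)
    - P0 j k * \int[Q eps (ref j)]_p trap h t (holding p) <= e1.
    apply: H' => s; first by rewrite ger0_norm ?trap_ge0 ?trap_le1.
    by move=> s'; rewrite mulrC; exact: trap_lip_r.
  by rewrite lerBrDl addrC.
have h2 : \sum_k P0 j k * \int[Q eps (ref j)]_p class_inf eps k (t - holding p) - eta / 2 <=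
    \int[Q eps x]_p v eps (p.1, t - holding p).
  rewrite (Rintegral_cells HSmeas HSdisj HScover (Q1 eps x)); last exact: Iv.
  apply: (ler_sum_sub sumM) => k.
  apply: (@le_trans _ _ (\int[Q eps x]_(p in cell Sp k) class_inf eps k (t - holding p))).
    have := hF j k x (fun s => class_inf eps k (t - s)) jx.
    have c1 s : `|class_inf eps k (t - s)| <= 1.
      by have /andP[? ?] := class_inf01 eps k (t - s); rewrite ger0_norm.
    have c2 s s' : `|class_inf eps k (t - s) - class_inf eps k (t - s')| <= h^-1 * `|s - s'|.
      apply: (le_trans (class_inf_lip eps k _ _)).
      by rewrite (_ : t - s - (t - s') = s' - s) 1?distrC//; ring.
    by move=> /(_ c1 c2); rewrite ler_norml => /andP[+ _]; rewrite lerBrDl addrC.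
  apply: le_Rintegral => //; [exact: Im|exact: Iv|].
  by move=> p [kp _]; exact: class_inf_le.
rewrite (_ : _ - eta = ((j == i)%:R * \int[Q eps (ref i)]_p trap h t (holding p) - eta / 2) +
  (\sum_k P0 j k * \int[Q eps (ref j)]_p class_inf eps k (t - holding p) - eta / 2)); last by field.
exact: lerD.
Unshelve. all: by end_near. Qed.

(** The threshold [S] is chosen before [eps]: these are the lower bounds valid from a time on that
    is common to all small [eps] and all states. *)
Definition eventual_bound : set R := [set c | exists S : R,
  \forall eps \near (0 : R)^'+, forall x t, S <= t -> c <= v eps (x, t)].

Let b := sup eventual_bound.

Lemma eventual_bound_le1 c : eventual_bound c -> c <= 1.
Proof.
move=> [S Sc]; have [eps epsP] := @filter_ex _ _ (at_right_proper_filter (0 : R)) _ Sc.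
by apply: (le_trans (epsP (ref i) S (lexx _))); exact: value_le1.
Qed.

Let has_sup_b : has_sup eventual_bound.
Proof.
split; last by exists 1 => c; exact: eventual_bound_le1.
by exists 0, 0; apply: nearW => eps x t _; exact: value_ge0.
Qed.

Let b_ge0 : 0 <= b.
Proof.
apply: ub_le_sup; first by case: has_sup_b.
by exists 0; apply: nearW => eps x t _; exact: value_ge0.
Qed.

Let b_le1 : b <= 1.
Proof. by apply: ge_sup => [|c]; [case: has_sup_b|exact: eventual_bound_le1]. Qed.

Lemma eventual_bound_sup (e : R) : 0 < e -> eventual_bound (b - e).
Proof.
move=> e0; have [c [S Sc] cb] := sup_adherent e0 has_sup_b.
exists S; apply: filterS Sc => eps H x t St; apply: le_trans (H x t St); exact: ltW.
Qed.

Lemma reference_moments : exists C2 : R, forall z, 0 < z -> \forall eps \near (0 : R)^'+, forall j,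
  [/\ (Q eps (ref j)).-integrable setT (EFin \o @holding R T),
      (Q eps (ref j)).-integrable setT (EFin \o (fun p => holding p ^+ 2)),
      `|\int[Q eps (ref j)]_p holding p - tau0 j| <= 3 * z &
      \int[Q eps (ref j)]_p (holding p ^+ 2) <= C2].
Proof.
(* Since [tau eps j <= 2] near 0, its square contributes the 4, and the first moment is off by at
   most [2 * z] from [tau] plus [z] from the limit. *)
have [C C0 HM] := moments; exists (C * 4) => z z0.
have H1 := HM z z0; have H2 := tau_near z0; have H3 := tau_le2.
near=> eps => j; have eps0 : 0 < eps by near: eps; exact: near0_gt0.
have t0 := Hb_pos j eps0.
have [h1 h2 h3 h4] : [/\ (Q eps (ref j)).-integrable setT (EFin \o @holding R T),
      (Q eps (ref j)).-integrable setT (EFin \o (fun p => holding p ^+ 2)),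
      `|\int[Q eps (ref j)]_p holding p - tau eps j| <= z * tau eps j &
      \int[Q eps (ref j)]_p (holding p ^+ 2) <= C * tau eps j ^+ 2].
  have : forall j x, Sp j x ->
    [/\ (Q eps x).-integrable setT (EFin \o @holding R T),
      (Q eps x).-integrable setT (EFin \o (fun p => holding p ^+ 2)),
      `|\int[Q eps x]_p holding p - tau eps j| <= z * tau eps j &
      \int[Q eps x]_p (holding p ^+ 2) <= C * tau eps j ^+ 2] by near: eps.
  by apply; exact: refP.
have h5 : `|tau0 j - tau eps j| < z by move: (j) {t0 h1 h2 h3 h4}; near: eps.
have t2 : tau eps j <= 2 by move: (j) {t0 h1 h2 h3 h4 h5}; near: eps.
split=> //.
  have h6 : z * tau eps j <= z * 2 by rewrite ler_pM2l.
  move: h3 h5; rewrite !ler_norml !ltr_norml => /andP[? ?] /andP[? ?].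
  by apply/andP; split; lra.
apply: (le_trans h4); rewrite ler_wpM2l// (_ : 4 = 2 ^+ 2 :> R); last by ring.
by rewrite ler_pXn2r// nnegrE ltW.
Unshelve. all: by end_near. Qed.

(* With c = 8 C + 2, E holding >= tau / 2 and E holding^2 <= 2 C tau make the drift of the maximum principle at least tau. *)
Lemma maximum_near (n : nat) : exists2 K : R, 0 < K &
  \forall eps \near (0 : R)^'+, forall beta T0, beta <= 1 ->
  (forall x t, T0 <= t <= T0 + K -> beta <= v eps (x, t)) ->
  forall x t, T0 + K <= t -> beta - n.+1%:R^-1 <= v eps (x, t).
Proof.
have [C C0 HM] := moments.
pose c := 8 * C + 2; have c0 : 0 < c by rewrite ltr_wpDl// mulr_ge0.
have n0 : 0 < n.+1%:R :> R by [].
(* This length makes the loss [2 * c / K] of the maximum principle equal to [1 / (n + 1)]. *)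
pose K := 2 * c * n.+1%:R; have K0 : 0 < K by rewrite !mulr_gt0.
exists K => //.
have e2 : 0 < 1 / 2 :> R by rewrite divr_gt0.
have H1 := HM _ e2; have H2 := tau_le2.
have cK : 2 * c / K = n.+1%:R^-1 by rewrite /K; field; rewrite ?gt_eqF.
have cK1 : c / K <= 1.
  have h1 : 2 * (c / K) <= 1 by rewrite mulrA cK invf_le1// ler1n.
  have h2 : 0 <= c / K by rewrite divr_ge0// ltW.
  by apply: le_trans h1; rewrite ler_peMl// ler1n.
near=> eps => beta T0 beta1 win x t tT; have eps0 : 0 < eps by near: eps; exact: near0_gt0.
have mom : forall j x, Sp j x ->
    [/\ (Q eps x).-integrable setT (EFin \o @holding R T),
      (Q eps x).-integrable setT (EFin \o (fun p => holding p ^+ 2)),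
      `|\int[Q eps x]_p holding p - tau eps j| <= 1 / 2 * tau eps j &
      \int[Q eps x]_p (holding p ^+ 2) <= C * tau eps j ^+ 2] by near: eps.
have t2 : forall j, tau eps j <= 2 by near: eps.
(* This bound may vanish with [eps]; only its positivity matters, since neither [c] nor [K] depends
   on it. *)
pose kap := \big[Num.min/1]_j tau eps j.
have kap0 : 0 < kap by apply: lt_bigmin => // j _; exact: Hb_pos.
rewrite -cK; apply: (maximum_principle (HSmeas i) h0 c0 K0 kap0 beta1 _ _ _ win) => //.
- by move=> y; have [j jy] := class_exists HScover y; have [] := mom j y jy.
- by move=> y; have [j jy] := class_exists HScover y; have [] := mom j y jy.
- move=> y; have [j jy] := class_exists HScover y; have [_ _ h1 h2] := mom j y jy.
  have kt : kap <= tau eps j by exact: bigmin_le_cond.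
  apply: (le_trans kt); have t0 := Hb_pos j eps0; have t2j := t2 j.
  set m1 := \int[_]_p _ in h1 *; set m2 := \int[_]_p _ in h2 *.
  have m20 : 0 <= m2 by apply: Rintegral_ge0 => p _; exact: sqr_ge0.
  have h3 : tau eps j / 2 <= m1 by move: h1; rewrite ler_norml => /andP[+ _]; lra.
  have h4 : m2 <= 2 * C * tau eps j.
    apply: (le_trans h2); rewrite (_ : 2 * C * tau eps j = C * (2 * tau eps j)).
      by rewrite ler_wpM2l// expr2 ler_pM2r.
    by rewrite mulrCA mulrA.
  have h5 : (c / K + 1) * m2 <= 2 * (2 * C * tau eps j) by apply: ler_pM => //; [rewrite addr_ge0// divr_ge0 ?ltW|lra].
  have h6 : c * (tau eps j / 2) <= c * m1 by rewrite ler_pM2l.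
  have h7 : c * (tau eps j / 2) = 4 * C * tau eps j + tau eps j by rewrite /c; field.
  lra.
Unshelve. all: by end_near. Qed.

(** If no small [eps] had a touching time in [[n, n + K]], the values there would exceed
    [b + 2 / (n + 1)]. The maximum principle would extend this, up to [1 / (n + 1)], to all later
    times and contradict the choice of [b] as a supremum. *)
Lemma exists_touching (n : nat) (A : set R) : (\forall eps \near (0 : R)^'+, A eps) ->
  exists eps t, [/\ A eps, n%:R <= t,
    forall j s, (j == i)%:R * \int[Q eps (ref i)]_p trap h s (holding p)
      + \sum_k P0 j k * \int[Q eps (ref j)]_p class_inf eps k (s - holding p)
      - (n.+1%:R * (t + 1))^-1 <= class_inf eps j s &
    exists j, class_inf eps j t <= b + 2 / n.+1%:R].
Proof.
move=> nearA; have n0 : 0 < n.+1%:R :> R by [].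
have [K K0 HK] := maximum_near n.
(* At a time [t <= n + K] this error is at most the allowed [1 / ((n + 1) * (t + 1))]; it is fixed
   before [eps] because [K] is. *)
have eta0 : 0 < (n.+1%:R * (n%:R + K + 1))^-1 by rewrite invr_gt0 mulr_gt0// ltr_wpDl// addr_ge0// ltW.
have HS := superharmonic_near eta0.
apply: contrapT => nex.
(* The maximum principle requires a level at most 1; above that level every value touches. *)
have [b1|b1] := leP (b + 2 / n.+1%:R) 1; last first.
  have [eps [Aeps Seps]] := @filter_ex _ _ (at_right_proper_filter (0 : R)) _ (filterI nearA HS).
  apply: nex; exists eps, (n%:R + K); split=> //; first by rewrite lerDl ltW.
  by exists i; apply: le_trans (ltW b1); have /andP[] := class_inf01 eps i (n%:R + K).
have : eventual_bound (b + n.+1%:R^-1).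
  exists (n%:R + K); apply: filterS (filterI nearA (filterI HS HK)) => eps [Aeps [Seps Keps]].
  move=> x t tK; rewrite (_ : b + n.+1%:R^-1 = b + 2 / n.+1%:R - n.+1%:R^-1); last by field; rewrite gt_eqF.
  apply: (Keps _ n%:R b1) => // y s /andP[s1 s2]; rewrite leNgt; apply/negP => vb.
  apply: nex; exists eps, s; split=> //.
    move=> j u; apply: le_trans (Seps j u); rewrite lerD2l lerN2.
    rewrite lef_pV2 ?posrE ?mulr_gt0 ?ler_pM2l//.
    - by rewrite lerD2r.
    - by rewrite ltr_wpDl// addr_ge0// ltW.
    - by rewrite ltr_wpDl//; apply: le_trans s1.
  have [j jy] := class_exists HScover y; exists j; apply: le_trans (ltW vb).
  exact: class_inf_le.
move=> /(ub_le_sup (has_sup_b.2)); rewrite -/b gerDl leNgt invr_gt0.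
by rewrite n0.
Qed.

(** One touching pair for each [n], with [eps < 1 / (n + 1)], gives the sequence to which the limit
    argument applies; the laws from the reference states play the role of [mu n]. *)
Lemma value_lower_bound : lam i * (tau0 i - 2 * h) <= b * \sum_j lam j * tau0 j.
Proof.
have z0 m : 0 < m.+1%:R^-1 :> R by rewrite invr_gt0.
have [C2 HC2] := reference_moments.
have /choice[epst epstP] n : exists et : R * R, [/\
    [/\ 0 < et.1, et.1 < n.+1%:R^-1 & forall j,
    [/\ (Q et.1 (ref j)).-integrable setT (EFin \o @holding R T),
      (Q et.1 (ref j)).-integrable setT (EFin \o (fun p => holding p ^+ 2)),
      `|\int[Q et.1 (ref j)]_p holding p - tau0 j| <= 3 * n.+1%:R^-1 &
      \int[Q et.1 (ref j)]_p (holding p ^+ 2) <= C2]],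
    n%:R <= et.2,
    forall j s, (j == i)%:R * \int[Q et.1 (ref i)]_p trap h s (holding p)
      + \sum_k P0 j k * \int[Q et.1 (ref j)]_p class_inf et.1 k (s - holding p)
      - (n.+1%:R * (et.2 + 1))^-1 <= class_inf et.1 j s &
    exists j, class_inf et.1 j et.2 <= b + 2 / n.+1%:R].
  have H1 : \forall eps \near (0 : R)^'+, 0 < eps < n.+1%:R^-1.
    near=> eps; apply/andP; split; near: eps; [exact: near0_gt0|exact: nbhs_right_lt].
  have [eps [t [[/andP[e0 en] hm] h2 h3 h4]]] := exists_touching n (filterI H1 (HC2 _ (z0 n))).
  by exists (eps, t).
pose eps n := (epst n).1.
have nearn (A : set R) : (\forall eps \near (0 : R)^'+, A eps) -> \forall n \near \oo, A (eps n).
  move=> /near_at_right0[del del0 hdel].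
  apply: filterS (near_infty_natSinv_lt (PosNum del0)) => n /= nd.
  have [[e0 en _] _ _ _] := epstP n.
  by apply: hdel; rewrite e0/=; apply: lt_trans nd.
have [U [UU ooU]] := @ultraFilterLemma nat \oo _.
pose mu n j : {measure set (T * R) -> \bar R} := Q (eps n) (ref j).
have mu1 n j : mu n j setT = 1%E by exact: Q1.
have Ith n j : (mu n j).-integrable setT (EFin \o @holding R T).
  by have [[_ _ /(_ j)[]]] := epstP n.
have Ith2 n j : (mu n j).-integrable setT (EFin \o (fun p => holding p ^+ 2)).
  by have [[_ _ /(_ j)[]]] := epstP n.
have C2P n j : \int[mu n j]_p (holding p ^+ 2) <= C2.
  by have [[_ _ /(_ j)[]]] := epstP n.
have tauP j : (fun n => \int[mu n j]_p holding p) @ \oo --> tau0 j.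
  apply/(@cvgrPdist_lt _ R^o) => e e0; have e3 : 0 < e / 3 by rewrite divr_gt0.
  apply: filterS (near_infty_natSinv_lt (PosNum e3)) => n /= ne.
  have [[_ _ /(_ j)[_ _ hj _]] _ _ _] := epstP n.
  rewrite distrC; apply: (le_lt_trans hj).
  by rewrite mulrC -ltr_pdivlMr.
pose m n := class_inf (eps n).
have L0 : 0 < h^-1 by rewrite invr_gt0.
have m01 n j s : 0 <= m n j s <= 1 by exact: class_inf01.
have mL n j s s' : `|m n j s - m n j s'| <= h^-1 * `|s - s'| by exact: class_inf_lip.
pose tn n := (epst n).2.
have tnP n : n%:R <= tn n by have [_ ? _ _] := epstP n.
have super n j s : (j == i)%:R * \int[mu n i]_p trap h s (holding p)
      + \sum_k P0 j k * \int[mu n j]_p m n k (s - holding p)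
      - (n.+1%:R * (tn n + 1))^-1 <= m n j s by have [_ _ + _] := epstP n; exact.
have lowb (e : R) : 0 < e -> exists (S : R) (N : nat), forall n j s,
    (N <= n)%N -> S <= s -> b - e <= m n j s.
  move=> /eventual_bound_sup[S Se]; have [N _ hN] := nearn _ Se.
  by exists S, N => n j s Nn Ss; apply: le_class_inf => x _; exact: hN.
have touch n : exists j, m n j (tn n) <= b + 2 / n.+1%:R by have [_ _ _ ?] := epstP n.
have noatom (a c : R) : 0 < c -> exists2 del : R, 0 < del &
    \forall n \near \oo, fine (mu n i0 [set p | `|holding p - a| < del]) < c.
  move=> c0; have [del del0 hdel] := no_atoms a tau0i0 c0.
  by exists del => //; exact: nearn hdel.
exact: (limit_lower_bound mhold (@holding_ge0 _ R T) mu1 Ith Ith2 C2P tauP P0_ge0 P0_sum Herg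
  lam0 lam1 lamP L0 m01 mL h0 tnP super b_le1 b_ge0 lowb touch noatom UU ooU).
Unshelve. all: by end_near. Qed.

Lemma eventual_bound_stationary (e : R) : 0 < e ->
  eventual_bound (lam i * (tau0 i - 2 * h) / (\sum_j lam j * tau0 j) - e).
Proof.
move=> /eventual_bound_sup[S Se]; exists S; apply: filterS Se => eps H x t St.
apply: le_trans (H x t St); rewrite lerD2r ler_pdivrMr ?lam_tau0_gt0//.
exact: value_lower_bound.
Qed.

End one_class.

(** * Convergence of the occupation probabilities *)

Lemma probX_lower_bound i (e : R) : 0 < e -> exists S : R,
  \forall eps \near (0 : R)^'+, forall x t, S <= t ->
  ((lam i * tau0 i / (\sum_j lam j * tau0 j) - e)%:E <= probX (Q eps) x t (Sp i))%E.
Proof.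
move=> e0; have s0 := lam_tau0_gt0; set s := \sum_j _ in s0 *.
have l1 : lam i <= 1 by rewrite -lam1 (bigD1 i)//= lerDl sumr_ge0.
(* The smoothing loss [lam i * 2 * h / s] becomes [lam i * e / 2], at most half of [e]. *)
pose h := e * s / 4; have h0 : 0 < h by rewrite divr_gt0// mulr_gt0.
have e2 : 0 < e / 2 by rewrite divr_gt0.
have [S HS] := eventual_bound_stationary i h0 e2; exists S.
near=> eps => x t St; have eps0 : 0 < eps by near: eps; exact: near0_gt0.
apply: le_trans (value_le_probX (fun x => Hsupp x eps0) h0 (HSmeas i) x t).
rewrite lee_fin; have H : forall x t, S <= t ->
  lam i * (tau0 i - 2 * h) / s - e / 2 <= value (Q eps) (Sp i) h (x, t) by near: eps.
apply: le_trans (H x t St).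
rewrite (_ : lam i * (tau0 i - 2 * h) / s = lam i * tau0 i / s - lam i * (e / 2)).
  have : lam i * (e / 2) <= e / 2 by rewrite ler_piMl// ltW.
  by move: (lam i * tau0 i / s) (lam i * (e / 2)) => u w ?; lra.
by rewrite /h; field; rewrite gt_eqF.
Unshelve. all: by end_near. Qed.

Lemma probX_stationary (t : R -> R) : t eps @[eps --> 0^'+] --> +oo ->
  forall i (e : R), 0 < e -> \forall eps \near (0 : R)^'+, forall x,
  (`| probX (Q eps) x (t eps) (Sp i)
      - (lam i * tau0 i / (\sum_j lam j * tau0 j))%:E | < e%:E)%E.
Proof.
move=> too i e e0; have s0 := lam_tau0_gt0; set s := \sum_j _ in s0 *.
have M0 : 0 < M.+1%:R :> R by [].
(* The upper bound for class [i] collects the errors of the other classes; with [M + 1] in the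
   denominator their total stays strictly below [e]. *)
pose e1 := e / M.+1%:R; have e10 : 0 < e1 by rewrite divr_gt0.
have H : \forall eps \near (0 : R)^'+, forall j x,
    ((lam j * tau0 j / s - e1)%:E <= probX (Q eps) x (t eps) (Sp j))%E.
  apply: (@filter_forall _ _ (fun j => [set eps | forall x,
    ((lam j * tau0 j / s - e1)%:E <= probX (Q eps) x (t eps) (Sp j))%E])) => j.
  have [S HS] := probX_lower_bound j e10.
  have HT : \forall eps \near (0 : R)^'+, S <= t eps.
    by move/cvgryPge : too => /(_ S).
  by apply: filterS (filterI HS HT) => eps [h1 h2] x; exact: h1.
near=> eps => x; have eps0 : 0 < eps by near: eps; exact: near0_gt0.
have H' j : ((lam j * tau0 j / s - e1)%:E <= probX (Q eps) x (t eps) (Sp j))%E.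
  by move: j x; near: eps.
have := sum_probX_le1 (fun x => Hsupp x eps0) HSmeas HSdisj (t eps) x.
have p0 j : (0 <= probX (Q eps) x (t eps) (Sp j))%E.
  apply: le_trans (value_le_probX (fun x => Hsupp x eps0) ltr01 (HSmeas j) x (t eps)).
  by rewrite lee_fin value_ge0.
have pfin j : (probX (Q eps) x (t eps) (Sp j) <= 1)%E ->
    probX (Q eps) x (t eps) (Sp j) = (fine (probX (Q eps) x (t eps) (Sp j)))%:E.
  by move=> p1; rewrite fineK// ge0_fin_numE//; apply: (le_lt_trans p1); rewrite ltry.
move=> ple; have p1 j : (probX (Q eps) x (t eps) (Sp j) <= 1)%E.
  apply: le_trans ple; rewrite (bigD1 j)//= leeDl//.
  by apply: sume_ge0 => k _; exact: p0.
pose p j := fine (probX (Q eps) x (t eps) (Sp j)).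
have pE j : probX (Q eps) x (t eps) (Sp j) = (p j)%:E by exact: pfin.
have {}H' j : lam j * tau0 j / s - e1 <= p j by rewrite -lee_fin -pE.
move: ple; under eq_bigr do rewrite pE; rewrite sumEFin lee_fin => ple.
rewrite pE -EFinB abse_EFin lte_fin ltr_norml.
have e1e : e1 < e + e1 by rewrite ltrDr.
have e1M : e = e1 *+ M.+1 by rewrite /e1 -mulr_natr divfK.
have e1lt : e1 <= e by rewrite e1M mulrS lerDl mulrn_wge0// ltW.
have M1 : (0 < M)%N by apply: leq_ltn_trans (ltn_ord i).
apply/andP; split.
  have : e1 < e.
    rewrite e1M -(prednK M1) !mulrS ltrDl ltr_wpDr// mulrn_wge0// ltW//.
  have := H' i; move: (lam i * tau0 i / s) => u; lra.
have sum1 : \sum_j lam j * tau0 j / s = 1 by rewrite -mulr_suml mulfV// gt_eqF.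
have : \sum_(j | j != i) (lam j * tau0 j / s - e1) <= \sum_(j | j != i) p j.
  by apply: ler_sum => j _; exact: H'.
rewrite sumrB sumr_const => h1.
move: ple sum1; rewrite (bigD1 i)//= [X in X = 1](bigD1 i)//= => h2 h3.
have h4 : e1 *+ #|[pred j : 'I_M | j != i]| < e.
  rewrite e1M ltr_pMn2l// ltnS -[leqRHS](card_ord M); exact: max_card.
move: h1 h2 h3 h4; set u := \sum_(j | j != i) _ / s; set w := \sum_(j | j != i) p j.
set z := e1 *+ _; move: (lam i * tau0 i / s) => y; lra.
Unshelve. all: by end_near. Qed.

End asymptotics.

Unset Implicit Arguments.
Set Strict Implicit.

Theorem theorem7p2
  (d : measure_display) (R : realType) (T : measurableType d)
  (M : nat) (Sp : 'I_M -> set T)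
  (Q : R -> R.-pker T ~> (T * R)%type)
  (Pm : R -> 'I_M -> 'I_M -> R) (tau : R -> 'I_M -> R)
  (tau0 : 'I_M -> R) (i0 : 'I_M) (P0 : 'I_M -> 'I_M -> R)
  (lambda : 'I_M -> R)
  (* partition of S into Borel sets *)
  (HSmeas : forall i, measurable (Sp i))
  (HSdisj : forall i j, i != j -> Sp i `&` Sp j = set0)
  (HScover : \bigcup_i Sp i = setT)
  (* Q^eps are kernels from S to S x [0,oo) *)
  (Hsupp : forall eps x, 0 < eps -> Q eps x [set p | p.2 < 0] = 0%E)
  (* (a) *)
  (Ha_diag : forall eps i x, 0 < eps -> Sp i x -> Pk (Q eps) x (Sp i) = 0%E)
  (Ha_dich : forall i j, i != j ->
     ((forall eps x, 0 < eps -> Sp i x -> Pk (Q eps) x (Sp j) = 0%E) /\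
      (forall eps, 0 < eps -> Pm eps i j = 0))
     \/
     ((forall eps, 0 < eps -> 0 < Pm eps i j) /\
      (forall e : R, 0 < e -> exists2 delta : R, 0 < delta &
         forall eps x, 0 < eps < delta -> Sp i x ->
           `| fine (Pk (Q eps) x (Sp j)) / Pm eps i j - 1 | < e)))
  (Ha_diag0 : forall eps i, 0 < eps -> Pm eps i i = 0)
  (Ha_sum : forall eps i, 0 < eps -> \sum_j Pm eps i j = 1)
  (Ha_conn : forall i j, i != j ->
     connect (fun a b => `[< forall eps, 0 < eps -> 0 < Pm eps a b >]) i j)
  (* (b) *)
  (Hb_pos : forall eps i, 0 < eps -> 0 < tau eps i)
  (Hb : forall i j, (forall eps, 0 < eps -> 0 < Pm eps i j) ->
     forall e : R, 0 < e -> exists2 delta : R, 0 < delta &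
       forall eps x, 0 < eps < delta -> Sp i x ->
         (`| ET (Q eps) x (Sp j) * ((tau eps i)^-1)%:E - 1 | < e%:E)%E)
  (* (c) *)
  (Hc : exists C : R, exists2 eps0 : R, 0 < eps0 &
     forall eps i j x, 0 < eps <= eps0 ->
       (forall eps', 0 < eps' -> 0 < Pm eps' i j) -> Sp i x ->
       (VarT (Q eps) x (Sp j) <= (C * (tau eps i) ^+ 2)%:E)%E)
  (* (d) *)
  (Hd : forall (f : R -> R), bounded_continuous f ->
     forall i j1 j2,
       (forall eps, 0 < eps -> 0 < Pm eps i j1) ->
       (forall eps, 0 < eps -> 0 < Pm eps i j2) ->
     forall e : R, 0 < e -> exists2 delta : R, 0 < delta &
       forall eps x1 x2, 0 < eps < delta -> Sp i x1 -> Sp i x2 ->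
         `| Ef (Q eps) f (tau eps i) x1 (Sp j1)
            - Ef (Q eps) f (tau eps i) x2 (Sp j2) | < e)
  (* (e) *)
  (He : forall i j (xs : nat -> T) (epss : nat -> R) (xi : probability R R),
     (forall eps, 0 < eps -> 0 < Pm eps i j) ->
     (forall n, Sp i (xs n)) ->
     (forall n, 0 < epss n) -> (forall n, epss n.+1 <= epss n) ->
     epss @ \oo --> 0 ->
     (forall f : R -> R, bounded_continuous f ->
        (fun n => Ef (Q (epss n)) f (tau (epss n) i) (xs n) (Sp j)) @ \oo
          --> fine (\int[xi]_r (f r)%:E)) ->
     forall r : R, xi [set r] = 0%E)
  (* (f) *)
  (Hf : forall (n : nat) (a b dd : 'I_n -> 'I_M) (a' c : 'I_M),
     (forall k, forall eps, 0 < eps -> 0 < Pm eps (a k) (b k)) ->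
     (forall k, forall eps, 0 < eps -> 0 < Pm eps (a k) (dd k)) ->
     exists l : \bar R,
       ((\prod_(k < n) (Pm eps (a k) (b k) / Pm eps (a k) (dd k)))
          * (tau eps a' / tau eps c))%:E @[eps --> 0^'+] --> l)
  (* limits tau_i and P^0 *)
  (Htau : forall i, tau eps i @[eps --> 0^'+] --> tau0 i)
  (Htau_i0 : tau0 i0 = 1)
  (Htau_range : forall i, 0 <= tau0 i <= 1)
  (HP0 : forall i j, Pm eps i j @[eps --> 0^'+] --> P0 i j)
  (* one ergodic class w.r.t. P^0, with invariant probability lambda *)
  (Herg : forall i j, connect (fun a b => 0 < P0 a b) i j)
  (Hlam_nonneg : forall i, 0 <= lambda i)
  (Hlam_sum : \sum_i lambda i = 1)
  (Hlam_inv : forall j, lambda j = \sum_i lambda i * P0 i j)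
  :
  forall t : R -> R, t eps @[eps --> 0^'+] --> +oo ->
  forall i, forall e : R, 0 < e -> exists2 delta : R, 0 < delta &
    forall eps x, 0 < eps < delta ->
      (`| probX (Q eps) x (t eps) (Sp i)
          - (lambda i * tau0 i / \sum_j (lambda j * tau0 j))%:E | < e%:E)%E.
Proof.
move=> t too i e e0.
(* An empty state space makes the claim vacuous; otherwise one state suffices to produce a reference
   state in every class. *)
have [[x0 _]|noT] := pselect (exists x : T, True); last first.
  by exists 1 => // eps x; case: noT; exists x.
have /choice[ref refP] :=
  class_nonempty HScover Ha_diag Ha_dich Ha_diag0 Ha_sum HP0 Herg x0.
have [delta delta0 H] := (near_at_right0 _).1
  (probX_stationary HSmeas HSdisj HScover Hsupp Ha_diag Ha_dich Ha_diag0 Ha_sum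
    Hb_pos Hb Hc Hd He Htau Htau_range HP0 Herg refP Hlam_nonneg Hlam_sum Hlam_inv
    Htau_i0 too i e0).
by exists delta => // eps x epsd; exact: H.
Qed.
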